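(* Let $r\colon\mathbb{R}^d\to\mathbb{R}\cup\{+\infty\}$ be a closed function, $f\colon\mathbb{R}^d\to\mathbb{R}$ locally Lipschitz, and $\varphi=f+r$. Suppose there are reals $\tau\ge0$, $\eta$ and $\mathsf{L}\ge0$ such that: (B1) one can generate i.i.d. realizations $\xi_0,\xi_1,\ldots\sim P$ from a probability space $(\Omega,\mathcal{F},P)$; (B2) there is an open convex set $U\supseteq\mathrm{dom}\,r$ and a measurable function $(x,y,\xi)\mapsto f_x(y,\xi)$ on $U\times U\times\Omega$ with $\mathbb{E}_\xi[f_x(x,\xi)]=f(x)$ for all $x\in U$ and $\mathbb{E}_\xi[f_x(y,\xi)-f(y)]\le\frac{\tau}{2}\|y-x\|^2$ for all $x,y\in U$; (B3) for all $x\in U$ and a.e. $\xi$, $f_x(\cdot,\xi)+r(\cdot)$ is $\eta$-weakly convex; (B4) there is a measurable $L\colon\Omega\to\mathbb{R}_+$ with $\sqrt{\mathbb{E}_\xi[L(\xi)^2]}\le\mathsf{L}$ and $f_x(x,\xi)-f_x(y,\xi)\le L(\xi)\|x-y\|$ for all $x,y\in U$ and a.e. $\xi$. Fix $T\ge0$, a real $\bar\rho>\max\{\tau+\eta,0\}$, reals $\beta_t>\bar\rho$ ($t=0,\ldots,T$), and $x_0\in U$. Define $x_{t+1}=\operatorname{argmin}_x\{r(x)+f_{x_t}(x,\xi_t)+\frac{\beta_t}{2}\|x-x_t\|^2\}$ for $t=0,\ldots,T$, and let $t^*\in\{0,\ldots,T\}$ be sampled independently with $\mathbb{P}(t^*=t)\propto\frac{\bar\rho-\tau-\eta}{\beta_t-\eta}$.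 Then for every $t\in\{0,\ldots,T\}$, $$\mathbb{E}\big[\varphi_{1/\bar\rho}(x_{t+1})\big]\le\mathbb{E}\big[\varphi_{1/\bar\rho}(x_t)\big]-\frac{\bar\rho-\tau-\eta}{2\bar\rho(\beta_t-\eta)}\mathbb{E}\big[\|\nabla\varphi_{1/\bar\rho}(x_t)\|^2\big]+\frac{2\bar\rho\mathsf{L}^2}{(\beta_t-\eta)(\beta_t-\bar\rho)},$$ and $$\mathbb{E}\|\nabla\varphi_{1/\bar\rho}(x_{t^*})\|^2\le\frac{\bar\rho\big(\varphi_{1/\bar\rho}(x_0)-\min\varphi\big)+2\bar\rho^2\mathsf{L}^2\sum_{t=0}^T\frac{1}{(\beta_t-\eta)(\beta_t-\bar\rho)}}{\sum_{t=0}^T\frac{\bar\rho-\tau-\eta}{2(\beta_t-\eta)}}.$$ In particular, if $\beta_t=\bar\rho+\gamma^{-1}\sqrt{T+1}$ for all $t$, for some real $\gamma>0$, then $$\mathbb{E}\|\nabla\varphi_{1/\bar\rho}(x_{t^*})\|^2\le\frac{2\big(\bar\rho(\varphi_{1/\bar\rho}(x_0)-\min\varphi)+2\bar\rho^2\mathsf{L}^2\gamma^2\big)}{\bar\rho-\tau-\eta}\cdot\left(\frac{\bar\rho-\eta}{T+1}+\frac{1}{\gamma\sqrt{T+1}}\right).$$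
   Context: A function $g$ is $\rho$-weakly convex (for a real $\rho$, possibly negative) if $x\mapsto g(x)+\frac{\rho}{2}\|x\|^2$ is convex; under the assumptions, $\varphi$ is $(\tau+\eta)$-weakly convex. For $\lambda>0$: $\varphi_\lambda(x)=\min_y\{\varphi(y)+\frac{1}{2\lambda}\|y-x\|^2\}$ (Moreau envelope) and $\mathrm{prox}_{\lambda\varphi}(x)=\operatorname{argmin}_y\{\varphi(y)+\frac{1}{2\lambda}\|y-x\|^2\}$; for $\bar\rho>0$ exceeding the weak convexity parameter of $\varphi$, $\varphi_{1/\bar\rho}$ is $C^1$ with $\nabla\varphi_{1/\bar\rho}(x)=\bar\rho\,(x-\mathrm{prox}_{\varphi/\bar\rho}(x))$. $\min\varphi$ denotes $\inf\varphi$. $\mathbb{E}$ is expectation over all randomness. *)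

(* Defs.v *)
From HB Require Import structures.
From mathcomp Require Import all_boot all_order all_algebra.
From mathcomp Require Import all_classical all_reals all_analysis.
Import Order.TTheory GRing.Theory Num.Theory.
Import numFieldNormedType.Exports.

Set Implicit Arguments.
Unset Strict Implicit.
Unset Printing Implicit Defensive.

Local Open Scope classical_set_scope.
Local Open Scope ring_scope.

Section Defs.
Variables (R : realType) (d : nat).
Notation vec := 'rV[R]_d.

Definition sqnorm (x : vec) : R := \sum_(i < d) (x 0 i) ^+ 2.
Definition enorm (x : vec) : R := Num.sqrt (sqnorm x).

Definition locally_lipschitz (f : vec -> R) : Prop :=
  forall x, exists2 delta : R, 0 < delta & exists K : R, forall y z,
    enorm (y - x) < delta -> enorm (z - x) < delta ->
    `|f y - f z| <= K * enorm (y - z).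

Definition weakly_convex (rho : R) (g : vec -> \bar R) : Prop :=
  let h := fun y => (g y + (rho / 2 * sqnorm y)%:E)%E in
  forall (a b : vec) (l : R), 0 < l < 1 ->
    (h ((l *: a + (1 - l) *: b)%R) <= l%:E * h a + (1 - l)%:E * h b)%E.

Definition moreau (phi : vec -> \bar R) (lam : R) (x : vec) : \bar R :=
  ereal_inf (range (fun y => (phi y + ((2 * lam)^-1 * sqnorm (y - x))%:E)%E)).

Definition grad (g : vec -> R) (x : vec) : vec :=
  \row_(i < d) derive g x (delta_mx 0 i : vec).

Definition inf_fun (phi : vec -> \bar R) : \bar R := ereal_inf (range phi).

(* an R^d-valued map on a measurable space is (Borel) measurable
   iff all its coordinates are *)
Definition rvec_measurable {dT} {T : measurableType dT} (X : T -> vec) : Prop :=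
  forall i : 'I_d, measurable_fun setT (fun w => X w 0 i).

(* coordinates: identify d.-tuple R (which carries the product Borel
   sigma-algebra in mathcomp-analysis) with R^d *)
Definition row_of_tuple (t : d.-tuple R) : vec := \row_(i < d) tnth t i.

End Defs.

(* Probabilistic setting: on a probability space (W, Q) we have random
   elements xi_0, xi_1, ... with values in (Omega, P), and a random index
   tstar.  [iid_with_index Q P xi p tstar] says that the xi_i are i.i.d. with
   law P and that tstar is independent of (xi_i)_i with P(tstar = t) = p t:
   for every n, every measurable A_0,...,A_{n-1} and every t,
   Q(tstar = t, xi_0 in A_0, ..., xi_{n-1} in A_{n-1}) = p t * prod_i P(A_i). *)
Definition iid_with_index {R : realType} {dW dO} {W : measurableType dW}
    {Omega : measurableType dO} (Q : probability W R) (P : probability Omega R)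
    (xi : nat -> W -> Omega) (p : nat -> R) (tstar : W -> nat) : Prop :=
  (forall i, measurable_fun setT (xi i)) /\
  (forall t, measurable [set w | tstar w = t]) /\
  (forall (n t : nat) (A : nat -> set Omega), (forall i, measurable (A i)) ->
     Q ([set w | tstar w = t] `&` \bigcap_(i in [set j | (j < n)%N]) (xi i @^-1` A i))
     = (p t * \prod_(i < n) fine (P (A i)))%:E).

Definition sqgrad_moreau {R : realType} {d : nat} (phi : 'rV[R]_d -> \bar R)
    (lam : R) (x : 'rV[R]_d) : R :=
  sqnorm (grad (fun y => fine (moreau phi lam y)) x).

(* Main.v *)
Require Import Defs.
From HB Require Import structures.
From mathcomp Require Import all_boot all_order all_algebra.
From mathcomp Require Import all_classical all_reals all_analysis.
From mathcomp Require Import measurable_realfun.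
From mathcomp Require Import ring lra.
Import Order.TTheory GRing.Theory Num.Theory.
Import numFieldNormedType.Exports.

Set Implicit Arguments.
Unset Strict Implicit.
Unset Printing Implicit Defensive.

Local Open Scope classical_set_scope.
Local Open Scope ring_scope.

(* Writing p for the proximal point of x_t, the strong convexity of the
   subproblem compares its minimizer x_{t+1} with p, and the Moreau envelope at
   x_{t+1} is at most phi(p) + rhob/2 |p - x_{t+1}|^2; taking expectations and
   using that x_t is independent of xi_t gives the one-step descent, which
   telescopes.

   Two measure-theoretic points are hidden in the informal argument.  The null
   sets in (B3) and (B4) depend on the base point, and the iterates are only
   assumed to be measurable random vectors minimizing almost surely, not
   measurable functions of the samples, so the independence of x_{t+1} from the
   later samples has to be proved.  Both are settled by a selection lemma: a
   measurable set that the random pair (u, v) meets with positive probability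
   contains, over a set of positive probability, the graph of a measurable
   function of u.  Applied to the sublevel sets of the subproblem, whose
   minimizer is pinned down by strong convexity, it shows that the events
   {x_{t+1} in C} are determined by (x_t, xi_t) up to null events. *)

(** Nothing is assumed about joint integrability of the model in [x_t] and [xi_t], and (B2) bounds
    an expectation from one side only. The increment of the model from [x_t] to p, minus that of
    [f], is therefore shifted by (L(xi_t) + Lbar) |p - x_t|, where Lbar turns out to be a Lipschitz
    constant of [f] on [U]. The shifted quantity is almost surely nonnegative, so Tonelli applies,
    and the shift, whose expectation is finite, cancels afterwards. Finiteness throughout rests on
    the second moments of the iterates: the proximal map grows at most linearly, and [x_{t+1}] stays
    at finite mean square distance from p. The noise constant arises by moving the values of the
    model and of [f] from [x_{t+1}] back to [x_t]. This costs (L + Lbar) |x_{t+1} - x_t|, which the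
    surplus curvature (beta - rhob)/2 |x_{t+1} - x_t|^2 absorbs up to (L^2 + Lbar^2)/(beta - rhob),
    hence 2 Lbar^2/(beta - rhob) in mean. *)

Section euclidean.
Context {R : realType} {d : nat}.
Implicit Types (x y z a b c : 'rV[R]_d) (l e : R).

(** * Euclidean inner product, squared norm and the topology of R^d *)

Definition dot x y : R := \sum_(i < d) x 0 i * y 0 i.

Lemma dotC x y : dot x y = dot y x.
Proof. by apply: eq_bigr => i _; rewrite mulrC. Qed.

Lemma dotDl x y z : dot (x + y) z = dot x z + dot y z.
Proof. by rewrite -big_split; apply: eq_bigr => i _; rewrite !mxE mulrDl. Qed.

Lemma dotZl l x y : dot (l *: x) y = l * dot x y.
Proof. by rewrite mulr_sumr; apply: eq_bigr => i _; rewrite !mxE mulrA. Qed.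

Lemma dotNl x y : dot (- x) y = - dot x y.
Proof. by rewrite -scaleN1r dotZl mulN1r. Qed.

Lemma dotDr x y z : dot x (y + z) = dot x y + dot x z.
Proof. by rewrite dotC dotDl !(dotC x). Qed.

Lemma dotZr l x y : dot x (l *: y) = l * dot x y.
Proof. by rewrite dotC dotZl (dotC x). Qed.

Lemma dotNr x y : dot x (- y) = - dot x y.
Proof. by rewrite dotC dotNl (dotC x). Qed.

Lemma sqnorm_dot x : sqnorm x = dot x x.
Proof. by apply: eq_bigr => i _; rewrite expr2. Qed.

Definition dotE := (dotDl, dotDr, dotNl, dotNr, dotZl, dotZr).

Lemma sqnorm_ge0 x : 0 <= sqnorm x.
Proof. by apply: sumr_ge0 => i _; exact: sqr_ge0. Qed.

Lemma sqnormN x : sqnorm (- x) = sqnorm x.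
Proof. by rewrite !sqnorm_dot !dotE opprK. Qed.

Lemma sqnormBC x y : sqnorm (x - y) = sqnorm (y - x).
Proof. by rewrite -sqnormN opprB. Qed.

Lemma sqnormZ l x : sqnorm (l *: x) = l ^+ 2 * sqnorm x.
Proof. by rewrite !sqnorm_dot !dotE; ring. Qed.

Lemma sqnorm0 : sqnorm (0 : 'rV[R]_d) = 0.
Proof. by rewrite /sqnorm big1// => i _; rewrite mxE expr0n. Qed.

(** The defect term does not depend on [c]; it is what turns weak convexity plus a larger quadratic
    into strong convexity. *)
Lemma sqnorm_mix a b c l :
  sqnorm (l *: a + (1 - l) *: b - c) =
  l * sqnorm (a - c) + (1 - l) * sqnorm (b - c) - l * (1 - l) * sqnorm (a - b).
Proof.
by rewrite !sqnorm_dot !dotE (dotC b a) (dotC c a) (dotC c b); ring.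
Qed.

Lemma sqnorm_mix0 a b l :
  sqnorm (l *: a + (1 - l) *: b) =
  l * sqnorm a + (1 - l) * sqnorm b - l * (1 - l) * sqnorm (a - b).
Proof. by have := sqnorm_mix a b 0 l; rewrite !subr0. Qed.

Lemma sqnormD_le x y : sqnorm (x + y) <= 2 * sqnorm x + 2 * sqnorm y.
Proof.
have := sqnorm_ge0 (x - y).
by rewrite !sqnorm_dot !dotE (dotC y x) opprK; lra.
Qed.

Lemma young_dot x y e : 0 < e -> dot x y <= (e * sqnorm x + e^-1 * sqnorm y) / 2.
Proof.
move=> e0; have := sqnorm_ge0 (e *: x - y).
rewrite !sqnorm_dot !dotE (dotC y x).
rewrite -(pmulr_rge0 _ (_ : 0 < e^-1)) ?invr_gt0//.
set h := (X in 0 <= X -> _).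
have -> : h = e * dot x x + e^-1 * dot y y - 2 * dot x y by rewrite /h; field; rewrite gt_eqF.
lra.
Qed.

Lemma sqr_coord_le x i : (x 0 i) ^+ 2 <= sqnorm x.
Proof.
rewrite /sqnorm (bigD1 i)//= lerDl.
by apply: sumr_ge0 => j _; exact: sqr_ge0.
Qed.

Lemma enorm_ge0 x : 0 <= enorm x.
Proof. exact: sqrtr_ge0. Qed.

Lemma sqr_enorm x : enorm x ^+ 2 = sqnorm x.
Proof. by rewrite sqr_sqrtr// sqnorm_ge0. Qed.

Lemma enormN x : enorm (- x) = enorm x.
Proof. by rewrite /enorm sqnormN. Qed.

Lemma enormBC x y : enorm (x - y) = enorm (y - x).
Proof. by rewrite -enormN opprB. Qed.

Lemma enormZ l x : 0 <= l -> enorm (l *: x) = l * enorm x.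
Proof.
by move=> l0; rewrite /enorm sqnormZ sqrtrM ?sqr_ge0// sqrtr_sqr ger0_norm.
Qed.

Lemma coord_near x e : 0 < e ->
  \forall y \near x, forall i, `|(y : 'rV[R]_d) 0 i - x 0 i| < e.
Proof.
move=> e0; exists (fun _ j => [set t | `|t - x 0 j| < e]).
  move=> i j; rewrite (ord1 i); apply/nbhs_ballP; exists e => //= t.
  by rewrite /ball/= distrC.
by move=> y /= H i; exact: (H 0 i).
Qed.

Lemma sqnorm_lt_near x e : 0 < e -> \forall y \near x, sqnorm ((y : 'rV[R]_d) - x) < e.
Proof.
(* With [d.+1] in place of [d] the sum of the [d] coordinate bounds is strictly below [e], and
   [d = 0] needs no separate case. *)
move=> e0; have d0 : 0 < Num.sqrt (e / d.+1%:R) by rewrite sqrtr_gt0 divr_gt0.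
apply: filterS (coord_near x d0) => y H.
apply: (@le_lt_trans _ _ (\sum_(i < d) (e / d.+1%:R))).
  apply: ler_sum => i _; rewrite !mxE.
  rewrite -real_normK ?num_real// -[leRHS]sqr_sqrtr; last by rewrite divr_ge0// ltW.
  by rewrite ler_pXn2r ?nnegrE// ?sqrtr_ge0// ltW.
rewrite sumr_const card_ord -[ltLHS]mulr_natl mulrCA -[ltRHS]mulr1 ltr_pM2l//.
by rewrite ltr_pdivrMr// mul1r ltr_nat.
Qed.

Lemma sqr_lt_normE (t e : R) : 0 < e -> (t ^+ 2 < e ^+ 2) = (`|t| < e).
Proof.
by move=> e0; rewrite -real_normK ?num_real// ltr_pXn2r ?nnegrE ?normr_ge0 ?(ltW e0).
Qed.

Lemma nbhs_sqnorm x (V : set 'rV[R]_d) : nbhs x V ->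
  exists2 e, 0 < e & forall y, sqnorm (y - x) < e -> V y.
Proof.
case/nbhs_ballP => e /= e0 xV; exists (e ^+ 2); first by rewrite exprn_gt0.
move=> y yx; apply: xV; split => // i j; rewrite (ord1 i) /ball/= distrC.
have : (y 0 j - x 0 j) ^+ 2 < e ^+ 2.
  by apply: le_lt_trans yx; have := sqr_coord_le (y - x) j; rewrite !mxE.
by rewrite sqr_lt_normE.
Qed.

Lemma continuous_sqnormP (f : 'rV[R]_d -> R) x : {for x, continuous f} <->
  forall e, 0 < e -> exists2 e', 0 < e' &
    forall y, sqnorm (y - x) < e' -> `|f y - f x| < e.
Proof.
split => [fx e e0|H].
  move/cvgrPdist_lt : fx => /(_ _ e0)/nbhs_sqnorm[e' e'0 He'].
  by exists e' => // y /He'; rewrite distrC.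
apply/(@cvgrPdist_lt _ _ _ (nbhs x)) => e /H[e' e'0 He']; apply: filterS (sqnorm_lt_near x e'0).
by move=> y /He'; rewrite distrC.
Qed.

Lemma expansion_continuous (f : 'rV[R]_d -> R) x v (C : R) :
  (forall y, `|f y - f x - dot v (y - x)| <= C * sqnorm (y - x)) ->
  {for x, continuous f}.
Proof.
move=> H; apply/continuous_sqnormP => e e0.
(* Young weight for the linear term: its [v] part is then at most [e / 4], and the rest is a
   multiple of [sqnorm (y - x)]. *)
set s := e / (2 * (sqnorm v + 1)).
have v0 := sqnorm_ge0 v.
have s0 : 0 < s by rewrite divr_gt0// mulr_gt0// ltr_wpDl.
have sv : s * sqnorm v <= e / 2.
  rewrite /s mulrAC ler_pdivrMr ?mulr_gt0 ?ltr_wpDl//.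
  have : 0 <= e * sqnorm v by rewrite mulr_ge0// ltW.
  lra.
set B := s^-1 / 2 + `|C| + 1.
have B0 : 0 < B by rewrite ltr_wpDl// addr_ge0// divr_ge0// ltW// invr_gt0.
exists (e / 2 / B); first by rewrite !divr_gt0.
move=> y; rewrite ltr_pdivlMr// => yx.
have h0 := sqnorm_ge0 (y - x).
have Y1 := young_dot v (y - x) s0.
have Y2 := young_dot (- v) (y - x) s0; rewrite dotNl sqnormN in Y2.
have CC : C * sqnorm (y - x) <= `|C| * sqnorm (y - x).
  by rewrite ler_wpM2r// ler_norm.
have := H y; rewrite ler_norml => /andP[H1 H2].
have : sqnorm (y - x) * (s^-1 / 2) + `|C| * sqnorm (y - x) < e / 2.
  by apply: le_lt_trans yx; rewrite /B; lra.
by rewrite ltr_norml => H3; apply/andP; split; lra.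
Qed.

Lemma sqnorm_sub_continuous l c : continuous (fun y => l * sqnorm (y - c)).
Proof.
move=> x; apply: (@expansion_continuous _ _ ((l * 2) *: (x - c)) `|l|) => y.
have -> : l * sqnorm (y - c) - l * sqnorm (x - c) - dot ((l * 2) *: (x - c)) (y - x) =
    l * sqnorm (y - x).
  by rewrite !sqnorm_dot !dotE (dotC x y) (dotC c x) (dotC c y); ring.
by rewrite normrM (ger0_norm (sqnorm_ge0 _)).
Qed.

End euclidean.

Lemma lower_semicontinuousD {R : realType} {T : topologicalType}
    (g : T -> \bar R) (k : T -> R) :
  lower_semicontinuous g -> continuous k ->
  lower_semicontinuous (fun y => g y + (k y)%:E)%E.
Proof.
move=> lg ck x a agk.
have [b ab bg] : exists2 b : R, a < b & ((b - k x)%:E < g x)%E.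
  case: (g x) agk => [s| |] //=.
    rewrite -EFinD lte_fin => H; exists ((a + (s + k x)) / 2); first lra.
    by rewrite lte_fin; lra.
  by move=> _; exists (a + 1); [lra|rewrite ltry].
have [V xV HV] := lg _ _ bg.
have ab0 : 0 < b - a by rewrite subr_gt0.
exists (V `&` [set y | `|k x - k y| < b - a]).
  apply: filterI => //.
  by have /cvgrPdist_lt := ck x; apply.
move=> y [/HV H /= kxy].
have : ((b - k x)%:E + (k y)%:E < g y + (k y)%:E)%E by rewrite lteD2rE.
apply: lt_trans; rewrite -EFinD lte_fin.
by move: kxy; rewrite ltr_norml => /andP[]; lra.
Qed.

(** * Proximal map and Moreau envelope of a weakly convex function *)

Section prox.
Context {R : realType} {d : nat}.
Notation vec := 'rV[R]_d.
Implicit Types (x y a b : vec).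

(** [k] is the inverse of the envelope parameter, so [prox phi k] goes with [moreau phi k^-1]. The
    default value [0] is taken only when no minimizer exists. *)
Definition prox (phi : vec -> \bar R) (k : R) (x : vec) : vec :=
  xget 0 [set p | forall y, (phi p + (k / 2 * sqnorm (p - x))%:E <=
                             phi y + (k / 2 * sqnorm (y - x))%:E)%E].

Variables (phi : vec -> \bar R) (rho k : R).
Hypothesis phi_lsc : lower_semicontinuous phi.
Hypothesis phi_proper : exists z, (phi z < +oo)%E.
Hypothesis phi_Nny : forall z, phi z != -oo%E.
Hypothesis phi_wc : weakly_convex rho phi.
Hypotheses (k_gt0 : 0 < k) (rho_lt_k : rho < k).

Let D := [set y | (phi y < +oo)%E].
Let g y := fine (phi y).
Let q x y := g y + k / 2 * sqnorm (y - x).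
Let mu := k - rho.

Let mu_gt0 : 0 < mu. Proof. by rewrite subr_gt0. Qed.

Let phiE y : D y -> phi y = (g y)%:E.
Proof.
by move=> Dy; rewrite /g fineK// fin_numE phi_Nny//= -ltey.
Qed.

Let wc a b l : D a -> D b -> 0 < l < 1 ->
  D (l *: a + (1 - l) *: b) /\
  g (l *: a + (1 - l) *: b) <=
    l * g a + (1 - l) * g b + rho / 2 * (l * (1 - l) * sqnorm (a - b)).
Proof.
move=> Da Db l01; have := phi_wc a b l01.
rewrite (phiE Da) (phiE Db) -!EFinD => H.
have Dc : D (l *: a + (1 - l) *: b).
  by rewrite /D/= ltNge leye_eq; apply/negP => /eqP E; move: H; rewrite E.
split=> //; move: H; rewrite (phiE Dc) -EFinD lee_fin sqnorm_mix0; lra.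
Qed.

Let q_sc x a b l : D a -> D b -> 0 < l < 1 ->
  D (l *: a + (1 - l) *: b) /\
  q x (l *: a + (1 - l) *: b) <=
    l * q x a + (1 - l) * q x b - mu / 2 * (l * (1 - l) * sqnorm (a - b)).
Proof.
move=> Da Db l01; have [Dc H] := wc Da Db l01; split => //.
by rewrite /q sqnorm_mix /mu; lra.
Qed.

(** Near a point [a] of the domain the bound is lower semicontinuity. Farther away, the segment from
    [a] to [y] crosses the good ball, and strong convexity along it forces quadratic growth in the
    distance [s] to [a]. *)
Let q_bounded x : exists m, forall y, D y -> m <= q x y.
Proof.
have [a Da] := phi_proper.
have [|V aV HV] := phi_lsc (x := a) (a := g a - 1).
  by rewrite (phiE Da) lte_fin; lra.
have [e e0 {aV}HVe] := nbhs_sqnorm aV.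
have qball y : D y -> sqnorm (y - a) < e -> g a - 1 <= q x y.
  move=> Dy /HVe/HV; rewrite (phiE Dy) lte_fin => H.
  have := sqnorm_ge0 (y - x); rewrite /q => H1.
  have : 0 <= k / 2 * sqnorm (y - x) by rewrite mulr_ge0// divr_ge0// ltW.
  lra.
(* [K] is the slope that results along rays from [a]; completing the square in
   [mu / 4 * s ^+ 2 + K * s] gives the bound [- K ^+ 2 / mu]. *)
set m0 := g a - 1; set K := 2 * (m0 - q x a) / Num.sqrt e.
exists (Num.min m0 (q x a - K ^+ 2 / mu)) => y Dy.
rewrite ge_min; have [ye|ye] := ltP (sqnorm (y - a)) e.
  by rewrite qball.
apply/orP; right.
set s := enorm (y - a); set t := Num.sqrt e.
have t0 : 0 < t by rewrite sqrtr_gt0.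
have ts : t <= s by rewrite ler_sqrt// (le_trans (ltW e0)).
have s0 : 0 < s by exact: lt_le_trans ts.
(* This weight puts the convex combination at distance [t / 2] from [a], inside the ball. *)
set l := t / (2 * s).
have l0 : 0 < l by rewrite divr_gt0// mulr_gt0.
have l12 : l <= 1 / 2.
  by rewrite /l ler_pdivrMr ?mulr_gt0//; apply: le_trans ts _; lra.
have l01 : 0 < l < 1 by rewrite l0/=; lra.
have [Dc H] := q_sc x Dy Da l01.
have ca : sqnorm (l *: y + (1 - l) *: a - a) = e / 4.
  rewrite sqnorm_mix subrr sqnorm0 mulr0 addr0 -sqr_enorm -/s.
  have -> : l * s ^+ 2 - l * (1 - l) * s ^+ 2 = (l * s) ^+ 2 by ring.
  have -> : l * s = t / 2 by rewrite /l; field; rewrite gt_eqF.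
  by rewrite expr_div_n sqr_sqrtr ?ltW//; congr (_ / _); ring.
have := qball _ Dc; rewrite ca => /(_ ltac:(lra)); rewrite -/m0 => H1.
have {H1 H} := le_trans H1 H.
rewrite -sqr_enorm -/s => H.
have H1 : m0 - q x a <= l * (q x y - q x a - mu / 2 * ((1 - l) * s ^+ 2)) by lra.
have {}H1 : (m0 - q x a) / l <= q x y - q x a - mu / 2 * ((1 - l) * s ^+ 2).
  by rewrite ler_pdivrMr// mulrC.
have E : (m0 - q x a) / l = K * s.
  by rewrite /K /l -/t; field; rewrite !gt_eqF.
rewrite E in H1.
have H2 : mu / 4 * s ^+ 2 <= mu / 2 * ((1 - l) * s ^+ 2).
  have -> : mu / 2 * ((1 - l) * s ^+ 2) = (mu / 2 * (1 - l)) * s ^+ 2 by ring.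
  rewrite ler_wpM2r ?sqr_ge0//.
  have : mu * l <= mu * (1 / 2) by rewrite ler_pM2l.
  lra.
have H3 : 0 <= mu / 4 * (s + 2 * K / mu) ^+ 2 by rewrite mulr_ge0 ?sqr_ge0// divr_ge0// ltW.
have E3 : mu / 4 * (s + 2 * K / mu) ^+ 2 = mu / 4 * s ^+ 2 + K * s + K ^+ 2 / mu.
  by field; rewrite gt_eqF.
by rewrite E3 in H3; lra.
Qed.

(* A minimizing sequence is Cauchy by strong convexity, so no compactness is
   needed. *)
Let q_min x : exists2 p, D p & forall y, D y -> q x p <= q x y.
Proof.
have [m Hm] := q_bounded x.
have [a Da] := phi_proper.
set S := q x @` D.
have S0 : S !=set0 by exists (q x a), a.
have lbS : has_lbound S by exists m => _ [y Dy <-]; exact: Hm.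
set I := inf S.
have I_le y : D y -> I <= q x y by move=> Dy; apply: ge_inf => //; exists y.
have /choice[u Hu] : forall n : nat, exists y, D y /\ q x y < I + n.+1%:R^-1.
  move=> n; have n0 : 0 < n.+1%:R^-1 :> R by rewrite invr_gt0.
  have hS : has_inf S by split.
  by have [_ [y Dy <-] H] := inf_adherent n0 hS; exists y.
have cauchy_u n p : sqnorm (u n - u p) <= 4 / mu * (n.+1%:R^-1 + p.+1%:R^-1).
  (* At the midpoint strong convexity gains [mu / 8] times the squared distance, while the midpoint
     value is still at least [I]. *)
  have h01 : 0 < (1 / 2 : R) < 1 by lra.
  have [Dn Hn] := Hu n; have [Dp Hp] := Hu p.
  have [Dc H] := q_sc x Dn Dp h01.
  have := I_le _ Dc.
  have : 0 < mu / 8 by rewrite divr_gt0.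
  move=> mu8 HI.
  rewrite -(ler_pM2l mu8) mulrA.
  have -> : mu / 8 * (4 / mu) = 1 / 2 by field; rewrite gt_eqF.
  by move: Hn Hp; move: (n.+1%:R^-1) (p.+1%:R^-1) => n1 p1 Hn Hp; lra.
have cvu : cvg (u @ \oo).
  apply: cauchy_cvg; apply/cauchy_ballP => e e0.
  have e2 : 0 < mu * e ^+ 2 / 8 by rewrite divr_gt0// mulr_gt0// exprn_gt0.
  have [N _ HN] := near_infty_natSinv_lt (PosNum e2).
  have Nbar : forall n : nat, (N <= n)%N -> n.+1%:R^-1 < mu * e ^+ 2 / 8 by exact: HN.
  exists (u @` [set n | (N <= n)%N], u @` [set n | (N <= n)%N]) => /=.
    by split; exists N => // n Nn; exists n.
  move=> _ [[n /Nbar Hn <-] [p /Nbar Hp <-]]; split => // i j.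
  rewrite (ord1 i) /ball/=.
  have H : (u n 0 j - u p 0 j) ^+ 2 < e ^+ 2.
    have := sqr_coord_le (u n - u p) j; rewrite !mxE => /le_lt_trans; apply.
    apply: le_lt_trans (cauchy_u n p) _.
    rewrite -(ltr_pM2l mu_gt0) mulrA.
    have -> : mu * (4 / mu) = 4 by field; rewrite gt_eqF.
    by move: Hn Hp; move: (n.+1%:R^-1) (p.+1%:R^-1) => n1 p1 Hn Hp; lra.
  by move: H; rewrite -real_normK ?num_real// ltr_pXn2r ?nnegrE// ltW.
set p := lim (u @ \oo) in cvu *.
have hlsc : lower_semicontinuous (fun y => phi y + (k / 2 * sqnorm (y - x))%:E)%E.
  by apply: lower_semicontinuousD => //; exact: sqnorm_sub_continuous.
have hp : (phi p + (k / 2 * sqnorm (p - x))%:E <= I%:E)%E.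
  rewrite leNgt; apply/negP => Ih.
  have [b Ib bh] : exists2 b : R, I < b & (b%:E < phi p + (k / 2 * sqnorm (p - x))%:E)%E.
    case: (phi p + _)%E Ih => [s| |] //=.
      rewrite lte_fin => H; exists ((I + s) / 2); first lra.
      by rewrite lte_fin; lra.
    by move=> _; exists (I + 1); [lra|rewrite ltry].
  have [V pV HV] := hlsc _ _ bh.
  have bI : 0 < b - I by rewrite subr_gt0.
  have [N1 _ HN1] := near_infty_natSinv_lt (PosNum bI).
  have [N2 _ HN2] := cvu _ pV.
  have [Du Hu'] := Hu (maxn N1 N2).
  have /= := HN1 (maxn N1 N2) (leq_maxl _ _).
  have /HV := HN2 (maxn N1 N2) (leq_maxr _ _).
  rewrite (phiE Du) -EFinD lte_fin -/(q x _).
  by move: Hu'; move: ((maxn N1 N2).+1%:R^-1) => n1; lra.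
have Dp : D p.
  rewrite /D/= ltNge leye_eq; apply/negP => /eqP E; move: hp; rewrite E.
  by rewrite addye// leye_eq.
exists p => // y Dy.
by move: hp; rewrite (phiE Dp) -EFinD lee_fin => /le_trans; apply; exact: I_le.
Qed.

Let proxP x : D (prox phi k x) /\ forall y, D y -> q x (prox phi k x) <= q x y.
Proof.
have [p Dp Hp] := q_min x.
have : [set p | forall y, (phi p + (k / 2 * sqnorm (p - x))%:E <=
                             phi y + (k / 2 * sqnorm (y - x))%:E)%E] (prox phi k x).
  apply: xgetPex; exists p => y.
  rewrite (phiE Dp); have [Dy|] := boolP ((phi y < +oo)%E).
    by rewrite (phiE Dy) -!EFinD lee_fin; exact: Hp.
  by rewrite -leNgt leye_eq => /eqP ->; rewrite addye// leey.
move=> /= H.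
have Dpr : D (prox phi k x).
  rewrite /D/= ltNge leye_eq; apply/negP => /eqP E.
  by have := H p; rewrite E (phiE Dp) addye.
split=> // y Dy.
by have := H y; rewrite (phiE Dy) (phiE Dpr) -!EFinD lee_fin.
Qed.

Lemma prox_dom x : (phi (prox phi k x) < +oo)%E.
Proof. by have [] := proxP x. Qed.

(** Minimality is tested on the segment towards [y], at a point close to the minimizer; dividing by
    its small weight leaves the strong convexity gain. *)
Lemma prox_strong_min x y : (phi y < +oo)%E ->
  fine (phi (prox phi k x)) + k / 2 * sqnorm (prox phi k x - x)
    + (k - rho) / 2 * sqnorm (y - prox phi k x)
  <= fine (phi y) + k / 2 * sqnorm (y - x).
Proof.
move=> Dy; have [Dp Hp] := proxP x.
rewrite -/(q x y) -/(q x _) -/mu; set p := prox phi k x in Dp Hp *.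
apply/ler_addgt0Pl => e e0.
set s := mu / 2 * sqnorm (y - p).
have s0 : 0 <= s by rewrite mulr_ge0 ?sqnorm_ge0// divr_ge0// ltW.
(* Small enough that the loss [l * s] is at most [e]. *)
set l := e / (s + e + e).
have den : 0 < s + e + e by rewrite addr_gt0// ltr_wpDl.
have l0 : 0 < l by rewrite divr_gt0.
have l01 : 0 < l < 1 by rewrite l0/= ltr_pdivrMr// mul1r ltrDr ltr_wpDl.
have [Dc H] := q_sc x Dy Dp l01.
have {H}H : l * (q x p + (1 - l) * s) <= l * q x y.
  have := le_trans (Hp _ Dc) H; rewrite /s; lra.
move: H; rewrite ler_pM2l// => H.
have : l * s <= e.
  rewrite /l mulrAC ler_pdivrMr// ler_pM2l//; lra.
lra.
Qed.

Lemma moreau_prox x : moreau phi k^-1 x =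
  (fine (phi (prox phi k x)) + k / 2 * sqnorm (prox phi k x - x))%:E.
Proof.
rewrite /moreau.
have -> : (2 * k^-1)^-1 = k / 2 by rewrite invfM invrK mulrC.
have [Dp Hp] := proxP x.
apply/eqP; rewrite eq_le; apply/andP; split.
  apply: ereal_inf_lbound; exists (prox phi k x) => //.
  by rewrite (phiE Dp).
apply/ereal_infP => _ [y _ <-].
have [Dy|] := boolP ((phi y < +oo)%E).
  by rewrite (phiE Dy) -!EFinD lee_fin; exact: Hp.
by rewrite -leNgt leye_eq => /eqP ->; rewrite addye// leey.
Qed.

(** Each proximal point is inserted as a competitor in the strong minimality of the other. The sum
    bounds [mu * sqnorm (p' - p)] by an inner product, and Young with weight [mu / k] absorbs half
    of it. *)
Lemma prox_lipschitz x y :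
  sqnorm (prox phi k y - prox phi k x) <= (k / (k - rho)) ^+ 2 * sqnorm (y - x).
Proof.
have H1 := prox_strong_min x (prox_dom y).
have H2 := prox_strong_min y (prox_dom x).
rewrite -/mu in H1 H2 *.
set p := prox phi k x in H1 H2 *; set p' := prox phi k y in H1 H2 *.
have E : sqnorm (p' - x) - sqnorm (p' - y) + sqnorm (p - y) - sqnorm (p - x) =
  2 * dot (p' - p) (y - x).
  rewrite !sqnorm_dot !dotE (dotC x p) (dotC x p') (dotC y p) (dotC y p').
  ring.
have H : mu * sqnorm (p' - p) <= k * dot (p' - p) (y - x).
  have {}E : k / 2 * (sqnorm (p' - x) - sqnorm (p' - y) + sqnorm (p - y) - sqnorm (p - x)) =
    k / 2 * (2 * dot (p' - p) (y - x)) by rewrite E.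
  by move: H1 H2; rewrite (sqnormBC p p'); lra.
have Y := @young_dot _ _ (p' - p) (y - x) (mu / k) (divr_gt0 mu_gt0 k_gt0).
have {}Y : k * dot (p' - p) (y - x) <=
    mu / 2 * sqnorm (p' - p) + (k ^+ 2 / mu) / 2 * sqnorm (y - x).
  have -> : mu / 2 * sqnorm (p' - p) + (k ^+ 2 / mu) / 2 * sqnorm (y - x) =
     k * ((mu / k * sqnorm (p' - p) + (mu / k)^-1 * sqnorm (y - x)) / 2).
    by field; rewrite !gt_eqF.
  by rewrite ler_pM2l.
have : mu / 2 * sqnorm (p' - p) <= mu / 2 * ((k / mu) ^+ 2 * sqnorm (y - x)).
  have -> : mu / 2 * ((k / mu) ^+ 2 * sqnorm (y - x)) =
    (k ^+ 2 / mu) / 2 * sqnorm (y - x) by field; rewrite !gt_eqF.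
  lra.
by rewrite ler_pM2l// divr_gt0.
Qed.

Let M x := fine (moreau phi k^-1 x).

(** The proximal point of [x] is a competitor in the minimum that defines [M y]. *)
Let M_upper x y :
  M y <= M x + k * dot (x - prox phi k x) (y - x) + k / 2 * sqnorm (y - x).
Proof.
rewrite /M !moreau_prox/=; set p := prox phi k x.
have := prox_strong_min y (prox_dom x); rewrite -/p -/mu => H.
have : 0 <= mu / 2 * sqnorm (p - prox phi k y).
  by rewrite mulr_ge0 ?sqnorm_ge0// divr_ge0// ltW.
have -> : sqnorm (p - x) = sqnorm (p - y) + 2 * dot (p - x) (y - x) - sqnorm (y - x).
  rewrite !sqnorm_dot !dotE (dotC x p) (dotC y p) (dotC x y); ring.
have -> : dot (x - p) (y - x) = - dot (p - x) (y - x) by rewrite -dotNl opprB.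
lra.
Qed.

Let C := k / 2 + k * ((k / mu) ^+ 2 + 1) / 2.

(** The lower bound is [M_upper] with [x] and [y] exchanged; replacing the gradient at [y] by the
    one at [x] costs a quadratic term by [prox_lipschitz], which is the second summand of [C]. *)
Let M_expansion x y :
  `|M y - M x - k * dot (x - prox phi k x) (y - x)| <= C * sqnorm (y - x).
Proof.
have H1 := M_upper x y; have H2 := M_upper y x.
have L := prox_lipschitz x y; rewrite -/mu in L.
have s0 := sqnorm_ge0 (y - x).
set p := prox phi k x in H1 L *; set p' := prox phi k y in H2 L.
have Y := @young_dot _ _ (p' - p) (y - x) 1 ltr01.
rewrite invr1 !mul1r in Y.
have E : dot (y - p') (x - y) = - dot (x - p) (y - x) - sqnorm (y - x) + dot (p' - p) (y - x).
  rewrite !sqnorm_dot !dotE (dotC x y).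
  ring.
rewrite E (sqnormBC x y) in H2.
have Y' : k * dot (p' - p) (y - x) <= k * (((k / mu) ^+ 2 + 1) * sqnorm (y - x) / 2).
  rewrite ler_pM2l//; lra.
have k0 : 0 <= k * ((k / mu) ^+ 2 + 1) / 2 * sqnorm (y - x).
  by rewrite mulr_ge0// divr_ge0// mulr_ge0 ?(ltW k_gt0)// addr_ge0// sqr_ge0.
have k1 : 0 <= k * sqnorm (y - x) by rewrite mulr_ge0// ltW.
by rewrite ler_norml /C; apply/andP; split; lra.
Qed.

Lemma moreau_continuous : continuous (fun x => fine (moreau phi k^-1 x)).
Proof.
move=> x; apply: (@expansion_continuous _ _ _ _ (k *: (x - prox phi k x)) C) => y.
by rewrite dotZl; exact: M_expansion.
Qed.

Lemma grad_moreau x :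
  grad (fun y => fine (moreau phi k^-1 y)) x = k *: (x - prox phi k x).
Proof.
apply/rowP => i; rewrite mxE; set v := delta_mx 0 i.
have vE : dot (k *: (x - prox phi k x)) v = (k *: (x - prox phi k x)) 0 i.
  rewrite /dot (bigD1 i)//= big1 ?addr0.
    by rewrite [v _ _]mxE !eqxx mulr1.
  by move=> j ji; rewrite [v _ _]mxE (negbTE ji) andbF mulr0.
rewrite -vE; apply/cvg_lim => //; apply/cvgrPdist_le => e e0.
have v0 := sqnorm_ge0 v.
have C0 : 0 <= C.
  by rewrite /C addr_ge0 ?divr_ge0 ?mulr_ge0 ?addr_ge0 ?sqr_ge0// ltW.
have B0 : 0 < C * sqnorm v + 1 by rewrite ltr_wpDl// mulr_ge0.
near=> h.
have h0 : h != 0 by near: h; exact: nbhs_dnbhs_neq.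
have hn0 : 0 < `|h| by rewrite normr_gt0.
have he : `|h| * (C * sqnorm v + 1) <= e.
  rewrite -ler_pdivlMr// ltW//; near: h; apply: dnbhs0_lt; exact: divr_gt0.
rewrite distrC /= -(ler_pM2l hn0) -normrM.
have := M_expansion x (h *: v + x); rewrite addrK sqnormZ dotZr dotZl.
rewrite [h *: v + x]addrC => H.
have -> : h * (h^-1 * (M (x + h *: v) - M x) - k * dot (x - prox phi k x) v) =
    M (x + h *: v) - M x - k * (h * dot (x - prox phi k x) v).
  by field.
apply: (le_trans H); rewrite -real_normK ?num_real//.
have : `|h| * (`|h| * (C * sqnorm v + 1)) <= `|h| * e by rewrite ler_pM2l.
have : 0 <= `|h| * `|h| by rewrite mulr_ge0.
rewrite expr2; lra.
Unshelve. all: by end_near. Qed.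

Lemma sqgrad_moreauE x :
  sqgrad_moreau phi k^-1 x = k ^+ 2 * sqnorm (prox phi k x - x).
Proof. by rewrite /sqgrad_moreau grad_moreau sqnormZ sqnormBC. Qed.

Lemma prox_coord_continuous i : continuous (fun x => prox phi k x 0 i).
Proof.
move=> x; apply/continuous_sqnormP => e e0.
have K0 : 0 < (k / mu) ^+ 2 by rewrite exprn_gt0// divr_gt0.
exists (e ^+ 2 / (k / mu) ^+ 2); first by rewrite divr_gt0// exprn_gt0.
move=> y; rewrite ltr_pdivlMr// mulrC => H; rewrite -sqr_lt_normE//.
apply: le_lt_trans H; apply: le_trans (prox_lipschitz x y).
by have := sqr_coord_le (prox phi k y - prox phi k x) i; rewrite !mxE.
Qed.

(** With this and the next growth bound, second moments of a random point make everything built from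
    its proximal point and its envelope integrable. *)
Lemma sqnorm_prox_bound : exists A, forall x,
  sqnorm (prox phi k x) <= A * (sqnorm x + 1).
Proof.
set p0 := prox phi k 0.
exists (2 * (k / mu) ^+ 2 + 2 * sqnorm p0) => x.
have := sqnormD_le (prox phi k x - p0) p0; rewrite subrK => /le_trans; apply.
have := prox_lipschitz 0 x; rewrite subr0 -/mu -/p0 => H.
have : 0 <= (k / mu) ^+ 2 by exact: sqr_ge0.
have : 0 <= sqnorm p0 * sqnorm x by rewrite mulr_ge0// sqnorm_ge0.
lra.
Qed.

Lemma moreau_bound : exists A, forall x,
  `|fine (moreau phi k^-1 x)| <= A * (sqnorm x + 1).
Proof.
set v := k *: (0 - prox phi k 0).
exists (`|M 0| + C + 1 + sqnorm v) => x.
have := M_expansion 0 x; rewrite subr0 -dotZl -/v => H.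
have Y1 := @young_dot _ _ v x 1 ltr01.
have Y2 := @young_dot _ _ (- v) x 1 ltr01; rewrite dotNl sqnormN in Y2.
rewrite invr1 !mul1r in Y1 Y2.
have C0 : 0 <= C.
  by rewrite /C addr_ge0 ?divr_ge0 ?mulr_ge0 ?addr_ge0 ?sqr_ge0// ltW.
have x0 := sqnorm_ge0 x; have v0 := sqnorm_ge0 v.
have p1 : 0 <= `|M 0| * sqnorm x by rewrite mulr_ge0.
have p2 : 0 <= sqnorm v * sqnorm x by rewrite mulr_ge0.
have n1 := ler_norm (M 0).
have n2 := ler_norm (- M 0); rewrite normrN in n2.
rewrite -/(M x).
move: H; rewrite !ler_norml => /andP[H1 H2]; apply/andP; split; lra.
Qed.

End prox.

(** * Measurability of countable combinations and of maps on R^d *)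

Lemma measurable_set_pred dT (T : measurableType dT) (b : T -> bool) :
  measurable_fun setT b -> measurable [set t | b t].
Proof.
move=> mb; have := mb measurableT [set true] Logic.I.
by rewrite setTI preimage_true.
Qed.

Lemma measurable_bigcap_countType dT (T : measurableType dT) (I : countType)
    (F : I -> set T) :
  (forall i, measurable (F i)) -> measurable [set t | forall i, F i t].
Proof.
move=> mF; rewrite (_ : [set t | _] = ~` \bigcup_i (~` F i)).
  apply: measurableC; apply: countable_bigcupT_measurable => // i.
  exact: measurableC.
apply/seteqP; split=> [t Ft [i _]|t nF i]; first exact.
by apply: contrapT => nFi; apply: nF; exists i.
Qed.

Lemma measurable_bigcup_countType dT (T : measurableType dT) (I : countType)
    (F : I -> set T) :
  (forall i, measurable (F i)) -> measurable [set t | exists i, F i t].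
Proof.
move=> mF; rewrite (_ : [set t | _] = \bigcup_i F i).
  exact: countable_bigcupT_measurable.
by apply/seteqP; split=> [t [i Fi]|t [i _ Fi]]; exists i.
Qed.

Section row_measurability.
Context {R : realType} {d : nat}.
Notation vec := 'rV[R]_d.
Notation row := (@row_of_tuple R d).

Definition tuple_of_row (v : vec) : d.-tuple R := [tuple v 0 i | i < d].

Lemma tuple_of_rowK : cancel tuple_of_row row.
Proof. by move=> v; apply/rowP => i; rewrite mxE tnth_mktuple. Qed.

Lemma measurable_tuple_of_row dT (T : measurableType dT) (X : T -> vec) :
  rvec_measurable X <-> measurable_fun setT (tuple_of_row \o X).
Proof.
split=> [mX|mX i].
  apply/measurable_fun_tnthP => i; apply: eq_measurable_fun (mX i) => w _ /=.
  by rewrite tnth_mktuple.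
move/measurable_fun_tnthP : mX => /(_ i); apply: eq_measurable_fun => w _ /=.
by rewrite tnth_mktuple.
Qed.

(** The sigma-algebra on tuples is generated by coordinates, so the open set is written as the union
    of the countably many boxes of rational centre and radius [n.+1%:R^-1] that it contains. *)
Lemma open_row_measurable (U : set vec) : open U -> measurable (row @^-1` U).
Proof.
move=> oU.
pose box (k : 'rV[rat]_d * nat) : set (d.-tuple R) :=
  [set t | forall i : 'I_d, `|tnth t i - ratr (k.1 0 i)| < k.2.+1%:R^-1].
have mbox k : measurable (box k).
  apply: (@measurable_bigcap_countType _ _ _
    (fun i : 'I_d => [set t : d.-tuple R | `|tnth t i - ratr (k.1 0 i)| < k.2.+1%:R^-1])) => i.
  apply: (@measurable_set_pred _ (d.-tuple R) (fun t => `|tnth t i - ratr (k.1 0 i)| < k.2.+1%:R^-1)).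
  apply: measurable_fun_ltr => //; apply: measurableT_comp => //.
  by apply: measurable_funB => //; exact: measurable_tnth.
rewrite (_ : _ @^-1` _ = [set t | exists k, (if `[<box k `<=` row @^-1` U>] then box k else set0) t]).
  by apply: measurable_bigcup_countType => k; case: ifP.
apply/seteqP; split=> [t Ut|t [k /=]]; last by case: asboolP => // kU /kU.
suff [k kU kt] : exists2 k, box k `<=` row @^-1` U & box k t.
  by exists k; case: asboolP.
have [e /= e0 tU] : exists2 e : R, 0 < e & forall s : d.-tuple R,
    (forall i, `|tnth s i - tnth t i| < e) -> U (row s).
  have /nbhs_ballP[e /= e0 H] : nbhs (row t) U by exact: open_nbhs_nbhs.
  exists e => // s H1; apply: H; split=> // i j; rewrite !mxE /ball/= distrC.
  exact: H1.
have e20 : 0 < e / 2 by rewrite divr_gt0.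
have [n _ /(_ n (leqnn _)) /= ne] := near_infty_natSinv_lt (PosNum e20).
have n0 : 0 < n.+1%:R^-1 :> R by rewrite invr_gt0.
have /choice[c Hc] : forall i, exists q : rat, `|tnth t i - ratr q| < n.+1%:R^-1 :> R.
  move=> i; have [|q] := @rat_in_itvoo R (tnth t i) (tnth t i + n.+1%:R^-1).
    by rewrite ltrDl.
  rewrite in_itv/= => /andP[q1 q2]; exists q.
  by move: q1 q2 n0; move: (_.+1%:R^-1) => n1 q1 q2 n0; rewrite ltr_norml; apply/andP; split; lra.
exists (\row_i c i, n); last by move=> i /=; rewrite mxE.
move=> s /= Hs; apply: tU => i.
have := Hs i; have := Hc i; rewrite mxE.
move: ne; move: (_.+1%:R^-1) => n1 ne.
rewrite !ltr_norml => /andP[? ?] /andP[? ?]; apply/andP; split; lra.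
Qed.

Lemma lsc_row_measurable (g : vec -> \bar R) : lower_semicontinuous g ->
  measurable_fun setT (g \o row).
Proof.
move=> /lower_semicontinuousP sg; apply: (measurability _ (ErealGenOInfty.measurableE R)).
move=> /= _ [_ [a ->]] <-; apply: measurableI => //.
by rewrite preimage_itvoy; exact: (open_row_measurable (sg a)).
Qed.

Lemma continuous_row_measurable (g : vec -> R) : continuous g ->
  measurable_fun setT (g \o row).
Proof.
move=> cg; apply: (measurability _ (RGenOInfty.measurableE R)).
move=> /= _ [_ [a ->]] <-; apply: measurableI => //.
apply: (@open_row_measurable (g @^-1` `]a, +oo[)).
by move/continuousP : cg; apply; rewrite set_itvE; exact: open_gt.
Qed.

Lemma measurable_sqnormB dT (T : measurableType dT) (X Y : T -> vec) :
  rvec_measurable X -> rvec_measurable Y ->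
  measurable_fun setT (fun t => sqnorm (X t - Y t)).
Proof.
move=> mX mY; apply: (eq_measurable_fun
  (fun t => \sum_(i < d) (X t 0 i - Y t 0 i) ^+ 2)).
  by move=> t _; apply: eq_bigr => i _; rewrite !mxE.
apply: measurable_sum => i; apply: measurable_funX.
by apply: measurable_funB; [exact: mX|exact: mY].
Qed.

Lemma measurable_enormB dT (T : measurableType dT) (X Y : T -> vec) :
  rvec_measurable X -> rvec_measurable Y ->
  measurable_fun setT (fun t => enorm (X t - Y t)).
Proof.
move=> mX mY.
have ms : measurable_fun setT (@Num.sqrt R).
  by apply: continuous_measurable_fun => t; exact: sqrt_continuous.
exact: (measurableT_comp ms (measurable_sqnormB mX mY)).
Qed.

Lemma rvec_measurable_row dT (T : measurableType dT) (X : T -> d.-tuple R) :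
  measurable_fun setT X -> rvec_measurable (row \o X).
Proof.
move=> mX i; apply: (eq_measurable_fun (fun t => tnth (X t) i)).
  by move=> t _; rewrite mxE.
exact: (measurableT_comp (measurable_tnth i) mX).
Qed.

Lemma rvec_measurable_mix dT (T : measurableType dT) (X Y : T -> vec) (a b : R) :
  rvec_measurable X -> rvec_measurable Y ->
  rvec_measurable (fun t => a *: X t + b *: Y t).
Proof.
move=> mX mY i; apply: (eq_measurable_fun (fun t => a * X t 0 i + b * Y t 0 i)).
  by move=> t _; rewrite !mxE.
by apply: measurable_funD; apply: measurable_funM.
Qed.

End row_measurability.

(** * Measurable selection in Cantor space, by binary trees *)

Lemma measurable_mkseq dT (T : measurableType dT) (b : T -> nat -> bool) n s :
  (forall k, measurable_fun setT (b ^~ k)) ->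
  measurable [set t | mkseq (b t) n = s].
Proof.
move=> mb; elim: n s => [|n IHn] s.
  have [->|s0] := eqVneq s [::].
    by rewrite (_ : [set t | _] = setT)//; apply/seteqP; split.
  rewrite (_ : [set t | _] = set0)//; apply/seteqP; split=> // t /= H.
  by move: s0; rewrite -H.
case/lastP: s => [|s c].
  by rewrite (_ : [set t | _] = set0)//; apply/seteqP; split=> // t /=; rewrite mkseqS; case: (mkseq _ _).
rewrite (_ : [set t | _] = [set t | mkseq (b t) n = s] `&` [set t | b t n = c]).
  apply: measurableI => //.
  by have := mb n measurableT [set c] Logic.I; rewrite setTI.
by apply/seteqP; split=> t /=; rewrite mkseqS; [move/rcons_inj => []|move=> [-> ->]].
Qed.

Section selection.
Context {R : realType} {dW dX : measure_display}.
Context {W : measurableType dW} {X : measurableType dX}.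
Variables (Q : probability W R) (u : W -> X) (v : W -> nat -> bool).
Hypothesis mu : measurable_fun setT u.
Hypothesis mv : forall n, measurable_fun setT (v ^~ n).
Notation pt := (X * (nat -> bool))%type.
Implicit Types (A : seq bool -> set X) (B K : set pt).

(* Closed-section sets: [tree_set A] is closed in its second coordinate, and is
   given by a measurable family of binary trees. *)
Definition tree_set A : set pt := [set p | forall n, A (mkseq p.2 n) p.1].

Definition is_tree_set K :=
  exists A, (forall s, measurable (A s)) /\ K = tree_set A.

Definition is_prefix_closed A :=
  forall s b, A (rcons s b) `<=` A s.

(** Requiring all prefixes makes the tree prefix-closed without changing the set it describes. *)
Let tree_closure A : seq bool -> set X :=
  fun s => [set x | forall n, A (take n s) x].

Let tree_closureE A : tree_set A = tree_set (tree_closure A).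
Proof.
apply/seteqP; split=> [[x b] H n m|[x b] H n] /=.
  have [mn|nm] := leqP m n.
    suff -> : take m (mkseq b n) = mkseq b m by exact: H.
    by rewrite /mkseq -map_take take_iota (minn_idPl mn).
  by rewrite take_oversize ?size_mkseq ?(ltnW nm)//; exact: H.
by have := H n n; rewrite /= take_oversize ?size_mkseq.
Qed.

Let tree_setP K : is_tree_set K -> exists A,
  [/\ forall s, measurable (A s), is_prefix_closed A & K = tree_set A].
Proof.
move=> [A [mA ->]]; exists (tree_closure A); split.
- by move=> s; exact: measurable_bigcap_countType.
- move=> s b x H n; have [ns|sn] := leqP n (size s).
    by have := H n; rewrite -cats1 take_cat ltn_neqAle ns andbT; case: eqP => [->|//] /=;
      rewrite subnn take0 cats0 take_size.
  by rewrite take_oversize ?(ltnW sn)//; have := H (size s); rewrite -cats1 take_size_cat.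
- exact: tree_closureE.
Qed.

Let pull B : set W := [set w | B (u w, v w)].

Let measurable_pull_tree K : is_tree_set K -> measurable (pull K).
Proof.
move=> [A [mA ->]].
rewrite (_ : pull _ = [set w | forall n, exists s, (mkseq (v w) n = s /\ A s (u w))]).
  apply: measurable_bigcap_countType => n.
  apply: (@measurable_bigcup_countType _ _ (seq bool)
    (fun s => [set w | mkseq (v w) n = s] `&` (u @^-1` A s))) => s.
  apply: measurableI; first exact: measurable_mkseq.
  by rewrite -[X in measurable X]setTI; exact: mu.
apply/seteqP; split=> [w H n|w H n] /=; first by exists (mkseq (v w) n); split=> //; exact: H.
by have [s [<-]] := H n.
Qed.

(** Prefix-closedness matters here: a branch that leaves one tree at level [n] and the other at
    level [m] has left both at level [maxn n m]. *)
Let tree_setU K1 K2 : is_tree_set K1 -> is_tree_set K2 -> is_tree_set (K1 `|` K2).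
Proof.
have mono A : is_prefix_closed A -> forall b x n m, (n <= m)%N ->
    A (mkseq b m) x -> A (mkseq b n) x.
  move=> pA b x n m /subnKC <-; elim: (m - n)%N => [|k IHk]; first by rewrite addn0.
  by rewrite addnS mkseqS => /pA /IHk.
move=> /tree_setP[A1 [mA1 pA1 ->]] /tree_setP[A2 [mA2 pA2 ->]].
exists (fun s => A1 s `|` A2 s); split; first by move=> s; exact: measurableU.
apply/seteqP; split=> [[x b] [H n|H n]|[x b] H] /=; [by left; exact: H|by right; exact: H|].
apply: contrapT => /not_orP[/existsNP[n nA1] /existsNP[m mA2']].
have [] := H (maxn n m) => /mono.
  by move=> /(_ pA1 n (leq_maxl _ _)).
by move=> /(_ pA2 m (leq_maxr _ _)).
Qed.

Let tree_set0 : is_tree_set set0.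
Proof.
exists (fun _ => set0); split=> //; apply/seteqP; split=> // -[x b] H.
exact: (H 0%N).
Qed.

Let tree_setT : is_tree_set setT.
Proof. by exists (fun _ => setT); split=> //; apply/seteqP; split. Qed.

Let tree_set_bigcap (K : (set pt)^nat) :
  (forall i, is_tree_set (K i)) -> is_tree_set (\bigcap_i K i).
Proof.
move=> /choice[A HA]; exists (fun s => \bigcap_i A i s); split.
  by move=> s; apply: bigcap_measurableType => i _; have [] := HA i.
apply/seteqP; split=> [p H n i _|p H i _].
  by have := H i Logic.I; have [_ ->] := HA i; apply.
by have [_ ->] := HA i => n; exact: (H n i Logic.I).
Qed.

Let tree_set_bigsetU (K : (set pt)^nat) n :
  (forall i, is_tree_set (K i)) -> is_tree_set (\big[setU/set0]_(i < n) K i).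
Proof.
move=> tK; elim: n => [|n IHn]; first by rewrite big_ord0.
by rewrite big_ord_recr/=; exact: tree_setU.
Qed.

(** Inner regularity of the law of [(u, v)] with respect to tree sets, phrased through pull-backs to
    [W] so that no sigma-algebra on [pt] has to be fixed beforehand. *)
Let inner_regular B := measurable (pull B) /\ forall e : R, 0 < e ->
  exists K, [/\ is_tree_set K, K `<=` B & (Q (pull (B `\` K)) <= e%:E)%E].

Let pullD B K : pull (B `\` K) = pull B `\` pull K. Proof. by []. Qed.

Let inner_regular_tree K : is_tree_set K -> inner_regular K.
Proof.
move=> tK; split; first exact: measurable_pull_tree.
move=> e e0; exists K; split=> //.
by rewrite pullD setDv measure0 lee_fin ltW.
Qed.

Let pull_bigcup (B : (set pt)^nat) : pull (\bigcup_i B i) = \bigcup_i pull (B i).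
Proof. by []. Qed.

Let sum_bound (F : (set W)^nat) (D : set W) (e : R) : 0 <= e ->
  measurable D -> (forall i, measurable (F i)) -> D `<=` \bigcup_i F i ->
  (forall i, (Q (F i) <= (e / (2 ^ i.+1)%:R)%:E)%E) -> (Q D <= e%:E)%E.
Proof.
move=> e0 mD mF DF FE.
apply: (@le_trans _ _ (\sum_(0 <= i <oo) Q (F i))%E).
  exact: measure_sigma_subadditive.
apply: le_trans (epsilon_trick0 xpredT e0).
by apply: lee_nneseries.
Qed.

Let inner_regular_bigcap (B : (set pt)^nat) :
  (forall i, inner_regular (B i)) -> inner_regular (\bigcap_i B i).
Proof.
move=> rB; split.
  rewrite (_ : pull _ = \bigcap_i pull (B i))//.
  by apply: bigcap_measurableType => i _; have [] := rB i.
move=> e e0.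
have /choice[K HK] : forall i, exists K, [/\ is_tree_set K, K `<=` B i &
    (Q (pull (B i `\` K)) <= (e / (2 ^ i.+1)%:R)%:E)%E].
  by move=> i; have [_] := rB i; apply; rewrite divr_gt0// ltr0n expn_gt0.
exists (\bigcap_i K i); split.
- by apply: tree_set_bigcap => i; have [] := HK i.
- by move=> p Kp i _; have [_ + _] := HK i; apply; exact: Kp.
apply: (@sum_bound (fun i => pull (B i `\` K i))) => //.
- exact: ltW.
- rewrite pullD; apply: measurableD.
    rewrite (_ : pull _ = \bigcap_i pull (B i))//.
    by apply: bigcap_measurableType => i _; have [] := rB i.
  by apply: measurable_pull_tree; apply: tree_set_bigcap => i; have [] := HK i.
- move=> i; rewrite pullD; apply: measurableD; first by have [] := rB i.
  by apply: measurable_pull_tree; have [] := HK i.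
- move=> w [Bw /existsNP[i /not_implyP[_ nK]]]; exists i => //; split=> //.
  exact: Bw.
- by move=> i; have [] := HK i.
Qed.

(** Only finite unions of tree sets are tree sets. Half of [e] pays for cutting the union off at
    [n], by continuity from above; the other half is spread geometrically over the pieces. *)
Let inner_regular_bigcup (B : (set pt)^nat) :
  (forall i, inner_regular (B i)) -> inner_regular (\bigcup_i B i).
Proof.
move=> rB.
have mB i : measurable (pull (B i)) by have [] := rB i.
have mU : measurable (pull (\bigcup_i B i)).
  by rewrite pull_bigcup; exact: bigcupT_measurable.
split=> // e e0; have e20 : 0 < e / 2 by rewrite divr_gt0.
have /choice[K HK] : forall i, exists K, [/\ is_tree_set K, K `<=` B i &
    (Q (pull (B i `\` K)) <= (e / 2 / (2 ^ i.+1)%:R)%:E)%E].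
  by move=> i; have [_] := rB i; apply; rewrite divr_gt0// ltr0n expn_gt0.
pose F n := pull (\bigcup_i B i) `\` \big[setU/set0]_(i < n) pull (B i).
have mF n : measurable (F n).
  by apply: measurableD => //; exact: bigsetU_measurable.
have F0 : Q \o F @ \oo --> 0%E.
  have <- : Q (\bigcap_n F n) = 0%E.
    rewrite (_ : \bigcap_n F n = set0) ?measure0//.
    apply/seteqP; split=> // w H; have [[i _ Bi] _] := H 0%N Logic.I.
    have [_] := H i.+1 Logic.I; apply.
    by rewrite big_ord_recr/=; right.
  apply: nonincreasing_cvg_mu => //.
  - by rewrite -ge0_fin_numE// fin_num_measure.
  - by apply: bigcap_measurableType => i _.
  - move=> n m nm; apply/subsetPset; apply: setDS.
    rewrite -!(bigcup_mkord _ (fun i => pull (B i))) => w [i /= ni Bi].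
    by exists i => //=; exact: leq_trans nm.
have [n Hn] : exists n, (Q (F n) <= (e / 2)%:E)%E.
  have : nbhs (0%E : \bar R) [set x | (x < (e / 2)%:E)%E].
    by apply: open_nbhs_nbhs; split; [exact: open_ereal_lt_ereal|rewrite /= lte_fin].
  by move=> /F0[N _ /(_ N (leqnn _)) /ltW H]; exists N.
have tK : is_tree_set (\big[setU/set0]_(i < n) K i).
  by apply: tree_set_bigsetU => i; have [] := HK i.
exists (\big[setU/set0]_(i < n) K i); split=> //.
  rewrite -bigcup_mkord => p [i /= _ Kp]; exists i => //.
  by have [_ + _] := HK i; apply.
pose G := pull (\bigcup_i B i) `&` \bigcup_i pull (B i `\` K i).
have mBK i : measurable (pull (B i `\` K i)).
  by rewrite pullD; apply: measurableD => //; apply: measurable_pull_tree; have [] := HK i.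
have mG : measurable G by apply: measurableI => //; exact: bigcupT_measurable.
have QG : (Q G <= (e / 2)%:E)%E.
  apply: (@sum_bound (fun i => pull (B i `\` K i))) => //; first exact: ltW.
  - by move=> w [].
  - by move=> i; have [] := HK i.
apply: (@le_trans _ _ (Q (F n `|` G))).
  apply: le_measure; rewrite ?inE//.
  - by rewrite pullD; apply: measurableD => //; exact: measurable_pull_tree.
  - exact: measurableU.
  rewrite pullD => w [Bw nK].
  have [Fw|nF] := pselect (F n w); [by left|right].
  split=> //; have [//|] := pselect ((\big[setU/set0]_(i < n) pull (B i)) w); last first.
    by move=> H; exfalso; apply: nF; split.
  rewrite -(bigcup_mkord _ (fun i => pull (B i))) => -[i /= ni Bi].
  exists i => //; split=> // Ki.
  by apply: nK; rewrite /pull/= -bigcup_mkord; exists i.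
apply: (le_trans (measureU2 _ _ _)) => //.
have -> : e%:E = ((e / 2)%:E + (e / 2)%:E)%E by rewrite -EFinD -splitr.
exact: leeD.
Qed.

(** Asking the same of the complement gives closure under complements, so the regular sets form a
    sigma-algebra and it is enough to check generators. *)
Let regular := [set B | inner_regular B /\ inner_regular (~` B)].

Let regular_sigma_algebra : sigma_algebra setT regular.
Proof.
split.
- by split; [|rewrite setC0]; apply: inner_regular_tree.
- by move=> B [H1 H2]; rewrite setTD; split=> //; rewrite setCK.
- move=> B rB; split.
    by apply: inner_regular_bigcup => i; have [] := rB i.
  by rewrite setC_bigcup; apply: inner_regular_bigcap => i; have [] := rB i.
Qed.

(** Carrying the regular sets as the sigma-algebra of a type turns regularity of a preimage into
    measurability of a map. *)
Let T := g_sigma_algebraType regular.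

Let measurable_regular B : regular B -> measurable (B : set T).
Proof. exact: sub_sigma_algebra. Qed.

Let regular_measurable (B : set T) : measurable B -> regular B.
Proof. by rewrite measurable_g_measurableTypeE. Qed.

Let measurable_regular_fst : measurable_fun setT (fst : T -> X).
Proof.
move=> _ C mC; rewrite setTI; apply: measurable_regular.
have treeD (D : set X) : measurable D -> is_tree_set (fst @^-1` D).
  move=> mD; exists (fun=> D); split=> //.
  by apply/seteqP; split=> [p Dp n //|p H]; exact: (H 0%N).
split; apply: inner_regular_tree; first exact: treeD.
by apply: (treeD (~` C)); exact: measurableC.
Qed.

Let bit_tree c n : is_tree_set [set p : pt | p.2 n = c].
Proof.
exists (fun s => if (n < size s)%N && (nth (~~ c) s n != c) then set0 else setT); split.
  by move=> s; case: ifP.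
apply/seteqP; split=> [[x b] bn k|[x b] H].
  by case: ifPn => // /andP[]; rewrite size_mkseq => nk; rewrite nth_mkseq// bn eqxx.
by have := H n.+1; rewrite size_mkseq ltnSn nth_mkseq//=; case: eqP.
Qed.

Let measurable_regular_bit n : measurable_fun setT (fun p : T => p.2 n).
Proof.
apply: (@measurable_fun_bool _ _ _ _ true); rewrite setTI; apply: measurable_regular.
split; apply: inner_regular_tree; first exact: bit_tree.
rewrite (_ : ~` _ = [set p : pt | p.2 n = false]); first exact: bit_tree.
by apply/seteqP; split=> p /=; case: (p.2 n).
Qed.

Section branch.
Variable A : seq bool -> set X.
Hypotheses (mA : forall s, measurable (A s)) (pA : is_prefix_closed A).

(** Nodes with extensions of every length, as in Koenig's lemma: branching is binary, so an alive
    node has an alive child, and [branch] below follows the leftmost one. *)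
Let alive s : set X := [set x | forall n, exists t : n.-tuple bool, A (s ++ t) x].

Let measurable_alive s : measurable (alive s).
Proof.
apply: measurable_bigcap_countType => n.
by apply: (@measurable_bigcup_countType _ _ (n.-tuple bool)).
Qed.

Let alive_le s n m (t : m.-tuple bool) x : (n <= m)%N -> A (s ++ t) x ->
  exists t' : n.-tuple bool, A (s ++ t') x.
Proof.
move=> nm; rewrite -(subnKC nm) in t *; move: (m - n)%N t => k {m nm}.
elim: k => [|k IHk]; first by rewrite addn0 => t At; exists t.
rewrite addnS => t; case: t => t st At.
case/lastP: t st At => [//|t c] st; rewrite -rcons_cat => /pA At.
have st' : size t == (n + k)%N by move: st; rewrite size_rcons eqSS.
exact: (IHk (Tuple st') At).
Qed.

Let alive_rcons s x : alive s x -> alive (rcons s false) x \/ alive (rcons s true) x.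
Proof.
move=> al; apply: contrapT => /not_orP[/existsNP[n nf] /existsNP[m mt]].
have [] := al (maxn n m).+1.
case/tupleP => c t; rewrite /= -cat_rcons.
case: c => At; first by apply: mt; exact: (alive_le (leq_maxr n m) At).
by apply: nf; exact: (alive_le (leq_maxl n m) At).
Qed.

Let branch x n := iter n (fun s => rcons s (~~ `[<alive (rcons s false) x>])) [::].

Let bit x n := ~~ `[<alive (rcons (branch x n) false) x>].

Let mkseq_bit x n : mkseq (bit x) n = branch x n.
Proof. by elim: n => // n IHn; rewrite mkseqS IHn. Qed.

Let alive_branch x n : alive [::] x -> alive (branch x n) x.
Proof.
move=> al; elim: n => //= n /alive_rcons.
by case: asboolP => /= [//|nf [/nf|]].
Qed.

Let measurable_branch n s : measurable [set x | branch x n = s].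
Proof.
elim: n s => [|n IHn] s.
  have [->|s0] := eqVneq s [::].
    by rewrite (_ : [set t | _] = setT)//; apply/seteqP; split.
  rewrite (_ : [set t | _] = set0)//; apply/seteqP; split=> // t /= H.
  by move: s0; rewrite -H.
case/lastP: s => [|s c].
  rewrite (_ : [set t | _] = set0)//; apply/seteqP; split=> // x /(congr1 size).
  by rewrite /branch iterS size_rcons.
rewrite (_ : [set t | _] = [set x | branch x n = s] `&`
    (if c then ~` alive (rcons s false) else alive (rcons s false))).
  by apply: measurableI => //; case: c => //; exact: measurableC.
apply/seteqP; split=> x /=.
  by move/rcons_inj => [-> <-]; split=> //; case: asboolP.
by move=> [->]; case: c => H; congr rcons; case: asboolP.
Qed.

Let measurable_bit n : measurable_fun setT (bit ^~ n).
Proof.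
apply: (@measurable_fun_bool _ _ _ _ true); rewrite setTI.
rewrite (_ : _ @^-1` _ = [set x | exists s, ([set x | branch x n = s] `&`
    ~` alive (rcons s false)) x]).
  apply: measurable_bigcup_countType => s; apply: measurableI.
    exact: measurable_branch.
  exact/measurableC/measurable_alive.
apply/seteqP; split=> x /=; rewrite /bit.
  by case: asboolP => // H _; exists (branch x n).
by move=> [s [<-]] H; case: asboolP.
Qed.

(** By compactness the projection of a tree set is measurable: it is [alive [::]], where the tree is
    infinite. The leftmost infinite branch is a measurable selection over it. *)
Lemma tree_set_selector : exists (G : set X) (b : X -> nat -> bool),
  [/\ measurable G, forall n, measurable_fun setT (b ^~ n),
      forall p, tree_set A p -> G p.1 & forall x, G x -> tree_set A (x, b x)].
Proof.
exists (alive [::]), bit; split=> //.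
- move=> [x b] H n; have sb : size (mkseq b n) == n by rewrite size_mkseq.
  by exists (Tuple sb); exact: H.
- move=> x /alive_branch al n; rewrite /= mkseq_bit.
  by have [t] := al n 0%N; rewrite tuple0 cats0.
Qed.

End branch.

(** Tree sets inside the preimage of [B] exhaust it up to measure [n.+1%:R^-1]; each has a selector,
    and these are glued. The condition on [h] quantifies over all measurable types so that it can be
    used with the sigma-algebra of regular sets. *)
Lemma bit_selection dS (S : measurableType dS) (h : pt -> S) (B : set S) :
  (forall dP (P : measurableType dP) (k : P -> pt),
     measurable_fun setT (fst \o k) ->
     (forall n, measurable_fun setT (fun p => (k p).2 n)) ->
     measurable_fun setT (h \o k)) ->
  measurable B ->
  exists (G : set X) (b : X -> nat -> bool),
    [/\ measurable G, forall n, measurable_fun setT (b ^~ n),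
        Q [set w | B (h (u w, v w)) /\ ~ G (u w)] = 0%E &
        forall x, G x -> B (h (x, b x))].
Proof.
move=> mh mB.
have [[mpB rB] _] : regular (h @^-1` B).
  apply: regular_measurable.
  have := mh _ T id measurable_regular_fst measurable_regular_bit measurableT B mB.
  by rewrite setTI.
have /choice[K HK] : forall n : nat, exists K,
    [/\ is_tree_set K, K `<=` h @^-1` B & (Q (pull (h @^-1` B `\` K)) <= n.+1%:R^-1%:E)%E].
  by move=> n; apply: rB; rewrite invr_gt0.
have /choice[Gn HGn] : forall n, exists G : set X, exists b : X -> nat -> bool,
    [/\ measurable G, forall k, measurable_fun setT (b ^~ k),
      forall p, K n p -> G p.1 & forall x, G x -> B (h (x, b x))].
  move=> n; have [/tree_setP[A [mA pA KE]] KB _] := HK n.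
  have [G [b [mG mb KG Gb]]] := tree_set_selector mA pA.
  exists G, b; split=> // [p|x /Gb]; first by rewrite KE => /KG.
  by rewrite -KE => /KB.
have {HGn}/choice[bn Hbn] := HGn.
have mG n : measurable (Gn n) by have [] := Hbn n.
(* The points whose first available selector is the [n]-th; these sets are disjoint, so the glued
   selection is well defined. *)
pose first n := Gn n `&` [set x | forall m : nat, (if (m < n)%N then ~` Gn m else setT) x].
have mfirst n : measurable (first n).
  apply: measurableI => //; apply: measurable_bigcap_countType => m.
  by case: ifP => // _; exact: measurableC.
pose b x k := `[<exists n, (first n `&` [set x | bn n x k]) x>].
have first_b x n : first n x -> b x = bn n x.
  move=> fx; apply/funext => k; rewrite /b; apply/asboolP/idP.
    move=> [m [fm bm]]; suff <- : m = n by [].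
    have [mn|nm|//] := ltngtP m n.
      by case: fx => _ /(_ m); rewrite mn; have [] := fm.
    by case: fm => _ /(_ n); rewrite nm; have [] := fx.
  by move=> bnx; exists n.
exists (\bigcup_n Gn n), b; split.
- exact: bigcupT_measurable.
- move=> k; apply: (@measurable_fun_bool _ _ _ _ true); rewrite setTI.
  rewrite (_ : _ @^-1` _ = [set x | exists n, (first n `&` [set x | bn n x k]) x]).
    apply: measurable_bigcup_countType => n; apply: measurableI => //.
    by apply: measurable_set_pred; have [_ + _ _] := Hbn n; apply.
  by apply/seteqP; split=> x /asboolP.
- apply/eqP; rewrite eq_le measure_ge0 andbT; apply/lee_addgt0Pr => e e0.
  rewrite add0e; have [N _ /(_ N (leqnn _)) /= HN] := near_infty_natSinv_lt (PosNum e0).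
  have [tK KB QK] := HK N; have [_ _ KG _] := Hbn N.
  apply: (@le_trans _ _ N.+1%:R^-1%:E); last by rewrite lee_fin ltW.
  apply: le_trans QK; apply: le_measure.
  + rewrite inE (_ : [set w | _] = pull (h @^-1` B) `\` u @^-1` (\bigcup_n Gn n))//.
    apply: measurableD => //; rewrite -[X in measurable X]setTI; apply: mu => //.
    exact: bigcupT_measurable.
  + by rewrite inE pullD; apply: measurableD => //; exact: measurable_pull_tree.
  + by move=> w [Bw nG]; split=> // /KG Gw; apply: nG; exists N.
- move=> x [n Gnx Gx].
  have ex : exists n, `[<Gn n x>] by exists n; exact/asboolP.
  have fm : first (ex_minn ex) x.
    case: ex_minnP => m /asboolP Gm Hm; split=> // k /=; case: ifPn => // km Gk.
    by move: km; rewrite ltnNge (Hm k)//; exact/asboolP.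
  rewrite (first_b _ _ fm).
  have [_ _ _] := Hbn (ex_minn ex); apply.
  by case: fm.
Qed.

End selection.

(** * Coding points of R^d by bit sequences, and the selection theorem *)

Section tuple_code.
Context {R : realType} {d : nat}.

(** Each coordinate is coded by its lower Dedekind cut, one bit per pair of a coordinate and a
    rational, and recovered as a supremum, for which [-oo] is neutral. Bit sequences that code no
    tuple get an arbitrary value through [fine]. *)
Let term (i : 'I_d) (n : nat) (c : bool) : \bar R :=
  if @unpickle ('I_d * rat)%type n is Some (j, q) then
    if (j == i) && c then (ratr q)%:E else -oo%E
  else -oo%E.

Definition decode (b : nat -> bool) : d.-tuple R :=
  [tuple fine (esups (fun n => term i n (b n)) 0%N) | i < d].

Definition encode (y : d.-tuple R) (n : nat) : bool :=
  if @unpickle ('I_d * rat)%type n is Some (j, q) then ratr q < tnth y j else false.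

Lemma encodeK : cancel encode decode.
Proof.
move=> y; apply: eq_from_tnth => i; rewrite tnth_mktuple.
suff -> : esups (fun n => term i n (encode y n)) 0%N = (tnth y i)%:E by [].
apply/eqP; rewrite eq_le; apply/andP; split.
  apply: ge_ereal_sup => _ [n _ <-]; rewrite /term /encode.
  case: unpickle => [[j q]|]; last by rewrite leNye.
  by case: eqP => [->|_]/=; [case: ifP => [/ltW|_]; rewrite ?lee_fin ?leNye|rewrite leNye].
apply/lee_addgt0Pr => e e0.
have [|q] := @rat_in_itvoo R (tnth y i - e) (tnth y i); first by lra.
rewrite in_itv/= => /andP[q1 q2].
rewrite -leeBlDr//; apply: (@le_trans _ _ (ratr q)%:E); first by rewrite lee_fin ltW.
apply: ereal_sup_ubound; exists (pickle (i, q)) => //.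
by rewrite /term /encode pickleK eqxx q2.
Qed.

Lemma measurable_decode dT (T : measurableType dT) (b : T -> nat -> bool) :
  (forall n, measurable_fun setT (b ^~ n)) -> measurable_fun setT (decode \o b).
Proof.
move=> mb; apply/measurable_fun_tnthP => i.
apply: (eq_measurable_fun (fine \o (fun t => esups (fun n => term i n (b t n)) 0%N))).
  by move=> t _ /=; rewrite tnth_mktuple.
apply: measurableT_comp; first exact: fine_measurable.
apply: (@measurable_fun_esups _ _ _ _ (fun n t => term i n (b t n))) => n.
rewrite /term; case: unpickle => [[j q]|]; last exact: measurable_cst.
case: (j == i) => /=; last exact: measurable_cst.
by apply: measurable_fun_ifT => //; exact: mb.
Qed.

Lemma measurable_encode n : measurable_fun setT (encode ^~ n).
Proof.
rewrite /encode; case: unpickle => [[j q]|]; last exact: measurable_cst.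
by apply: measurable_fun_ltr => //; exact: measurable_tnth.
Qed.

(* This replaces the measurable projection theorem: the sections of [B] met by
   the trajectory [(u, v)] have, up to a null event, a measurable selection. *)
Theorem measurable_selection {dW dX : measure_display}
    {W : measurableType dW} {X : measurableType dX}
    (Q : probability W R) (u : W -> X) (v : W -> d.-tuple R)
    (B : set (X * d.-tuple R)) :
  measurable_fun setT u -> measurable_fun setT v -> measurable B ->
  exists (G : set X) (s : X -> d.-tuple R),
    [/\ measurable G, measurable_fun setT s,
        Q [set w | B (u w, v w) /\ ~ G (u w)] = 0%E &
        forall x, G x -> B (x, s x)].
Proof.
move=> mu mv mB.
have := @bit_selection R _ _ W X Q u (encode \o v) mu.
move=> /(_ _ _ _ (fun p => (p.1, decode p.2)) B _ mB)[].
- move=> n; exact: (measurableT_comp (measurable_encode n) mv).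
- move=> dP P k mk1 mk2; apply: measurable_fun_pair => //.
  exact: measurable_decode.
move=> G [b [mG mb QG Gb]]; exists G, (decode \o b); split=> //.
- exact: measurable_decode.
- by move: QG; under eq_set do rewrite /= encodeK.
Qed.

End tuple_code.

(** * Expectations of real random variables *)

Section real_expectation.
Context {dT : measure_display} {T : measurableType dT} {R : realType}.
Variable P : probability T R.
Implicit Types f g h : T -> R.

Definition rintegrable f := P.-integrable setT (EFin \o f).

Definition expect f : R := fine (\int[P]_x (f x)%:E).

Lemma expectE f : rintegrable f -> (\int[P]_x (f x)%:E)%E = (expect f)%:E.
Proof. by move=> intf; rewrite fineK//; exact: integrable_fin_num. Qed.

Lemma rintegrable_measurable f : rintegrable f -> measurable_fun setT f.
Proof. by move=> /integrableP[/measurable_EFinP]. Qed.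

Lemma rintegrable_cst (c : R) : rintegrable (fun=> c).
Proof. exact: (@finite_measure_integrable_cst _ _ _ P setT c). Qed.

Lemma rintegrableD f g : rintegrable f -> rintegrable g ->
  rintegrable (fun x => f x + g x).
Proof.
by move=> intf intg; exact: (integrableD measurableT intf intg).
Qed.

Lemma rintegrableZ (c : R) f : rintegrable f -> rintegrable (fun x => c * f x).
Proof.
by move=> intf; exact: (integrableZl measurableT c intf).
Qed.

Lemma rintegrableB f g : rintegrable f -> rintegrable g ->
  rintegrable (fun x => f x - g x).
Proof.
by move=> intf intg; exact: (integrableB measurableT intf intg).
Qed.

Lemma expect_cst (c : R) : expect (fun=> c) = c.
Proof. transitivity (fine (c%:E * P setT)%E); first by congr fine; exact: integral_cst.
by rewrite probability_setT mule1. Qed.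

Lemma expectD f g : rintegrable f -> rintegrable g ->
  expect (fun x => f x + g x) = expect f + expect g.
Proof.
move=> intf intg; rewrite /expect -fineD; [|exact: integrable_fin_num..].
by congr fine; under eq_integral do rewrite EFinD; rewrite integralD.
Qed.

Lemma expectZ (c : R) f : rintegrable f -> expect (fun x => c * f x) = c * expect f.
Proof.
move=> intf; rewrite /expect.
under eq_integral do rewrite EFinM.
by rewrite integralZl// fineM//; exact: integrable_fin_num.
Qed.

Lemma expectB f g : rintegrable f -> rintegrable g ->
  expect (fun x => f x - g x) = expect f - expect g.
Proof.
move=> intf intg; rewrite -mulN1r -expectZ// -expectD//; last exact: rintegrableZ.
by congr expect; apply/funext => x; rewrite mulN1r.
Qed.

Lemma ae_le_rintegrable f g : measurable_fun setT f -> rintegrable g ->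
  {ae P, forall x, `|f x| <= g x} -> rintegrable f.
Proof.
move=> mf intg fg; apply/integrableP; split; first exact/measurable_EFinP.
move/integrableP : (intg) => [mg]; apply: le_lt_trans.
apply: ae_ge0_le_integral => //.
- by apply: measurableT_comp => //; exact/measurable_EFinP.
- by apply: measurableT_comp.
- by apply: filterS fg => x fg _ /=; rewrite lee_fin (le_trans fg)// ler_norm.
Qed.

Lemma ae_le_expect f g : rintegrable f -> rintegrable g ->
  {ae P, forall x, f x <= g x} -> expect f <= expect g.
Proof.
move=> intf intg fg; rewrite -subr_ge0 -expectB//.
have mh : measurable_fun setT (fun x => g x - f x).
  by apply: rintegrable_measurable; exact: rintegrableB.
rewrite /expect (@ae_eq_integral _ _ _ P setT (fun x => `|g x - f x|%:E)) //.
- by apply: fine_ge0; apply: integral_ge0 => x _; rewrite lee_fin.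
- exact/measurable_EFinP.
- by apply/measurable_EFinP; apply: measurableT_comp.
- by apply: filterS fg => x fg _; rewrite ger0_norm ?subr_ge0.
Qed.

Lemma le_expect f g : rintegrable f -> rintegrable g ->
  (forall x, f x <= g x) -> expect f <= expect g.
Proof. by move=> intf intg fg; apply: ae_le_expect => //; exact: aeW. Qed.

(** The minorant makes the negative part integrable, so that a bound on the integral controls the
    positive part. This is how the one-sided bound of (B2) yields integrability. *)
Lemma rintegrable_ge h k : measurable_fun setT h -> rintegrable k ->
  {ae P, forall x, k x <= h x} -> (\int[P]_x (h x)%:E < +oo)%E -> rintegrable h.
Proof.
move=> mh intk kh hoo.
have mEh : measurable_fun setT (EFin \o h) by exact/measurable_EFinP.
have negoo : (\int[P]_x ((EFin \o h)^\- x) < +oo)%E.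
  move/integrableP : (intk) => [mk]; apply: le_lt_trans.
  apply: ae_ge0_le_integral => //.
  - exact: measurable_funeneg.
  - by apply: measurableT_comp.
  apply: filterS kh => x kh _; rewrite funenegE /= -EFin_max lee_fin ge_max normr_ge0 andbT.
  by rewrite -[leRHS]normrN (le_trans _ (ler_norm _))// lerN2.
apply/integrableP; split=> //; rewrite integral_fin_num_abs//.
move: hoo; rewrite integralE.
have : (0 <= \int[P]_x ((EFin \o h)^\+ x))%E by exact: integral_ge0.
have : (0 <= \int[P]_x ((EFin \o h)^\- x))%E by exact: integral_ge0.
move: negoo.
by case: (\int[P]_x _)%E => // a; case: (\int[P]_x _)%E.
Qed.

Lemma ae_ex (B : T -> Prop) : {ae P, forall x, B x} -> exists x, B x.
Proof.
move=> [N [mN PN BN]]; apply: contrapT => /forallNP nB.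
have NT : N = setT by apply/seteqP; split=> // x _; apply: BN; exact: nB.
by move: PN; rewrite NT probability_setT => /eqP; rewrite onee_eq0.
Qed.

Lemma ae_forall_countType (I : countType) (B : I -> T -> Prop) :
  (forall i, {ae P, forall x, B i x}) -> {ae P, forall x, forall i, B i x}.
Proof.
move=> H.
have : {ae P, forall x, forall n, if @unpickle I n is Some i then B i x else True}.
  by apply: ae_foralln => n; case: unpickle => [i|]; [exact: H|exact: aeW].
by apply: filterS => x Bx i; have := Bx (pickle i); rewrite pickleK.
Qed.

End real_expectation.

(** * Integration against an independent sample *)

Section independence.
Context {R : realType} {dW dZ dO : measure_display}.
Context {W : measurableType dW} {Z : measurableType dZ} {Omega : measurableType dO}.
Variables (Q : probability W R) (P : probability Omega R).
Variables (zeta : W -> Z) (xi : W -> Omega).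
Hypothesis mzeta : measurable_fun setT zeta.
Hypothesis mxi : measurable_fun setT xi.
Hypothesis indep : forall A B, measurable A -> measurable B ->
  Q (zeta @^-1` A `&` xi @^-1` B) = (Q (zeta @^-1` A) * P B)%E.

Let u w := (zeta w, xi w).
Let mu : measurable_fun setT u. Proof. exact: measurable_fun_pair. Qed.

(** Independence on rectangles identifies the law of the pair as the product of the law of [zeta]
    with [P]; the rest is Tonelli. *)
Lemma indep_integral (k : Z * Omega -> \bar R) :
  measurable_fun setT k -> (forall p, (0 <= k p)%E) ->
  (\int[Q]_w k (zeta w, xi w) = \int[Q]_w \int[P]_y k (zeta w, y))%E.
Proof.
move=> mk k0.
pose X1 : {mfun W >-> Z} := HB.pack zeta (isMeasurableFun.Build _ _ _ _ _ mzeta).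
pose X2 : {mfun W >-> (Z * Omega)%type} := HB.pack u (isMeasurableFun.Build _ _ _ _ _ mu).
transitivity (\int[distribution Q X2]_p k p)%E.
  by rewrite ge0_integral_distribution.
transitivity (\int[distribution Q X1 \x P]_p k p)%E.
  apply: eq_measure_integral => A mA _; apply/esym.
  by apply: product_measure_unique => // B C mB mC; exact: indep.
rewrite fubini_tonelli1// ge0_integral_distribution//.
- exact: measurable_fun_fubini_tonelli_F.
- by move=> z; exact: integral_ge0.
Qed.

Lemma indep_null (N : set (Z * Omega)) : measurable N ->
  {ae Q, forall w, P [set y | N (zeta w, y)] = 0%E} ->
  Q [set w | N (zeta w, xi w)] = 0%E.
Proof.
move=> mN N0.
have mNu : measurable (u @^-1` N) by rewrite -[X in measurable X]setTI; exact: mu.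
have k0 (p : Z * Omega) : (0 <= (EFin \o \1_N) p :> \bar R)%E by rewrite lee_fin.
have mk : measurable_fun setT (EFin \o \1_N : Z * Omega -> \bar R).
  by apply/measurable_EFinP; exact: measurable_indic.
have -> : Q [set w | N (zeta w, xi w)] =
    (\int[Q]_w (EFin \o \1_N : Z * Omega -> \bar R) (zeta w, xi w))%E.
  transitivity (\int[Q]_w (\1_(u @^-1` N) w)%:E)%E => //.
  by rewrite integral_indic// setIT.
rewrite indep_integral// -[RHS](integral0 Q setT); apply: ae_eq_integral => //.
  have mF := @measurable_fun_fubini_tonelli_F _ _ _ _ _ P _ mk k0.
  exact: (measurableT_comp mF mzeta).
apply: filterS N0 => w N0 _ /=.
rewrite -[RHS]N0.
transitivity (\int[P]_y (\1_[set y | N (zeta w, y)] y)%:E)%E => //.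
rewrite integral_indic// ?setIT//.
rewrite (_ : [set y | _] = xsection N (zeta w)); first exact: measurable_xsection.
by rewrite /xsection; apply/seteqP; split=> y /=; rewrite inE.
Qed.

Lemma indep_expect_eq (k : Z * Omega -> R) (h : W -> R) :
  measurable_fun setT k -> (forall p, 0 <= k p) ->
  (forall w, (\int[P]_y (k (zeta w, y))%:E)%E = (h w)%:E) ->
  rintegrable Q h ->
  rintegrable Q (fun w => k (zeta w, xi w)) /\
  expect Q (fun w => k (zeta w, xi w)) = expect Q h.
Proof.
move=> mk k0 kh inth.
have E : (\int[Q]_w (k (zeta w, xi w))%:E = \int[Q]_w (h w)%:E)%E.
  rewrite (@indep_integral (EFin \o k)).
  - by apply: eq_integral => w _; exact: kh.
  - exact/measurable_EFinP.
  - by move=> p; rewrite lee_fin.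
split; last by rewrite /expect E.
apply/integrableP; split.
  by apply/measurable_EFinP; exact: (measurableT_comp mk mu).
rewrite integral_fin_num_abs//; last exact: (measurableT_comp mk mu).
by rewrite E expectE.
Qed.

Lemma indep_expect_le (k : Z * Omega -> R) (h : W -> R) :
  measurable_fun setT k -> (forall p, 0 <= k p) ->
  {ae Q, forall w, (\int[P]_y (k (zeta w, y))%:E <= (h w)%:E)%E} ->
  (forall w, 0 <= h w) -> rintegrable Q h ->
  rintegrable Q (fun w => k (zeta w, xi w)) /\
  expect Q (fun w => k (zeta w, xi w)) <= expect Q h.
Proof.
move=> mk k0 kh h0 inth.
have mEk : measurable_fun setT (EFin \o k) by exact/measurable_EFinP.
have E : (\int[Q]_w (k (zeta w, xi w))%:E <= \int[Q]_w (h w)%:E)%E.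
  have Ek0 p : (0 <= (EFin \o k) p)%E by rewrite lee_fin.
  rewrite (indep_integral mEk Ek0).
  apply: ae_ge0_le_integral => //.
  - by move=> w _; apply: integral_ge0 => y _; exact: Ek0.
  - have mF := @measurable_fun_fubini_tonelli_F _ _ _ _ _ P _ mEk Ek0.
    exact: (measurableT_comp mF mzeta).
  - by move=> w _; rewrite lee_fin.
  - by move/integrableP : inth => [].
  - by apply: filterS kh.
have intk : rintegrable Q (fun w => k (zeta w, xi w)).
  apply/integrableP; split.
    by apply/measurable_EFinP; exact: (measurableT_comp mk mu).
  rewrite integral_fin_num_abs//; last exact: (measurableT_comp mk mu).
  rewrite ge0_fin_numE; last by apply: integral_ge0 => w _; rewrite lee_fin.
  by apply: le_lt_trans E _; rewrite expectE ?ltry.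
by split=> //; rewrite -lee_fin -!expectE.
Qed.

(** This carries a property that holds for each base point, almost every sample and all [t] over to
    a random [v] that need not be a function of [(zeta, xi)]. The pairs admitting some [t] in [B]
    may fail to form a measurable set; the selection replaces them by a measurable [G], whose
    sections are null, so Tonelli makes it a null event. *)
Lemma ae_not_section {d : nat} (v : W -> d.-tuple R) (B : set ((Z * Omega) * d.-tuple R)) :
  measurable_fun setT v -> measurable B ->
  {ae Q, forall w, {ae P, forall y, forall t, ~ B ((zeta w, y), t)}} ->
  {ae Q, forall w, ~ B ((zeta w, xi w), v w)}.
Proof.
move=> mv mB nB.
have [G [s [mG ms QG Gs]]] := measurable_selection Q mu mv mB.
have QG0 : Q [set w | G (zeta w, xi w)] = 0%E.
  apply: indep_null => //; apply: filterS nB => w [N [mN PN NB]].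
  apply/eqP; rewrite -measure_le0 -PN; apply: le_measure; rewrite ?inE//.
    rewrite (_ : [set y | _] = xsection G (zeta w)); first exact: measurable_xsection.
    by rewrite /xsection; apply/seteqP; split=> y /=; rewrite inE.
  by move=> y Gy; apply: NB => /= H; exact: (H (s (zeta w, y)) (Gs _ Gy)).
have mBu : measurable [set w | B (u w, v w)].
  have mp : measurable_fun setT (fun w => (u w, v w)) by exact: measurable_fun_pair.
  by have := mp measurableT _ mB; rewrite setTI.
have mGu : measurable (u @^-1` G) by rewrite -[X in measurable X]setTI; exact: mu.
exists ([set w | B (u w, v w) /\ ~ G (u w)] `|` u @^-1` G); split.
- by apply: measurableU => //; exact: measurableD.
- by rewrite measureU0//; exact: measurableD.
- move=> w /= /contrapT Bw; have [Gw|nGw] := pselect (G (u w)); [by right|by left].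
Qed.

End independence.

Lemma ae_eq_event {dW : measure_display} {W : measurableType dW} {R : realType}
    (Q : probability W R) (E1 E2 : set W) :
  measurable E1 -> measurable E2 -> {ae Q, forall w, E1 w <-> E2 w} -> Q E1 = Q E2.
Proof.
move=> mE1 mE2 E12.
have H (A B : set W) : measurable A -> measurable B -> {ae Q, forall w, A w <-> B w} ->
    (Q A <= Q B)%E.
  move=> mA mB [N [mN QN ABN]].
  apply: (@le_trans _ _ (Q (B `|` N))); last by rewrite measureU0.
  apply: le_measure; rewrite ?inE//; first exact: measurableU.
  move=> w Aw; have [Bw|nB] := pselect (B w); [by left|right].
  by apply: ABN => -[/(_ Aw)].
apply/eqP; rewrite eq_le H//= H//.
by apply: filterS E12 => w ?; apply: iff_sym.
Qed.

(** Both sides are finite measures in [D] that agree on the pi-system of rectangles. *)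
Lemma pair_indep_event {dW d1 d2 : measure_display} {W : measurableType dW}
    {X1 : measurableType d1} {X2 : measurableType d2} {R : realType}
    (Q : probability W R) (u1 : W -> X1) (u2 : W -> X2) (H : set W) :
  measurable_fun setT u1 -> measurable_fun setT u2 -> measurable H ->
  (forall A B, measurable A -> measurable B ->
    Q (u1 @^-1` A `&` u2 @^-1` B `&` H) = (Q H * Q (u1 @^-1` A `&` u2 @^-1` B))%E) ->
  forall D : set (X1 * X2), measurable D ->
    Q ([set w | D (u1 w, u2 w)] `&` H) = (Q H * Q [set w | D (u1 w, u2 w)])%E.
Proof.
move=> mu1 mu2 mH rect D mD.
have mu := measurable_fun_pair mu1 mu2.
pose X : {mfun W >-> (X1 * X2)%type} := HB.pack (fun w => (u1 w, u2 w))
  (isMeasurableFun.Build _ _ _ _ _ mu).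
have QH : Q H \is a fin_num by exact: fin_num_measure.
pose c : {nonneg R} := NngNum (fine_ge0 (measure_ge0 Q H)).
pose m1 := pushforward (mrestr Q mH) X : {measure set (X1 * X2) -> \bar R}.
pose m2 : {measure set (X1 * X2) -> \bar R} := mscale c (distribution Q X).
have m2E A : m2 A = (Q H * Q (X @^-1` A))%E by rewrite /m2/= /mscale /= fineK.
rewrite -[RHS]m2E -[LHS]/(m1 mu D).
pose G : set (set (X1 * X2)) := [set A `*` B | A in measurable & B in measurable].
apply: (measure_unique G (fun=> setT)) => //.
- exact: measurable_prod_measurableType.
- move=> _ _ [A1 mA1 [B1 mB1 <-]] [A2 mA2 [B2 mB2 <-]].
  exists (A1 `&` A2); first exact: measurableI.
  by exists (B1 `&` B2); [exact: measurableI|rewrite setXI].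
- by move=> _; exists setT => //; exists setT => //; rewrite setXTT.
- by rewrite bigcup_const.
- by move=> _ [A mA [B mB <-]]; rewrite m2E; exact: rect.
- move=> _; apply: (@le_lt_trans _ _ 1%E); last exact: ltry.
  apply: (@le_trans _ _ (Q setT)); last by rewrite probability_setT.
  by apply: le_measure; rewrite ?inE// preimage_setT setTI.
Qed.

(** * Independence of the iterates from later samples and from the random index *)

Section iid_trajectory.
Context {R : realType} {dW dO dZ : measure_display}.
Context {W : measurableType dW} {Omega : measurableType dO} {Z : measurableType dZ}.
Variables (Q : probability W R) (P : probability Omega R).
Variables (xi : nat -> W -> Omega) (p : nat -> R) (tstar : W -> nat).
Hypothesis iid : iid_with_index Q P xi p tstar.

Let mxi i : measurable_fun setT (xi i). Proof. by have [] := iid. Qed.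

Lemma measurable_index (S : set nat) : measurable (tstar @^-1` S).
Proof.
have [_ [mt _]] := iid.
rewrite (_ : _ @^-1` _ = \bigcup_(s in S) [set w | tstar w = s]).
  by apply: bigcup_measurable => s _; exact: mt.
by apply/seteqP; split=> [w Sw|w [s Ss /= ->]//]; exists (tstar w).
Qed.

(** Putting the index into the same event lets a single induction give independence from the later
    samples and from [tstar]. *)
Definition future t n (S : set nat) (A : nat -> set Omega) : set W :=
  tstar @^-1` S `&` \bigcap_(i in [set j | (j < n)%N]) (xi (t + i) @^-1` A i).

Lemma measurable_future t n S A : (forall i, measurable (A i)) -> measurable (future t n S A).
Proof.
move=> mA; apply: measurableI; first exact: measurable_index.
by apply: bigcap_measurableType => i _; rewrite -[X in measurable X]setTI; exact: mxi.
Qed.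

Let future1 t n s A : (forall i, measurable (A i)) ->
  Q (future t n [set s] A) = (p s * \prod_(i < n) fine (P (A i)))%:E.
Proof.
move=> mA; have [_ [_ iidE]] := iid.
(* The samples before time [t] are left unconstrained and contribute factors 1. *)
pose A' j := if (j < t)%N then setT else A (j - t)%N.
have mA' j : measurable (A' j) by rewrite /A'; case: ifP.
rewrite (_ : future _ _ _ _ = [set w | tstar w = s] `&`
    \bigcap_(i in [set j | (j < t + n)%N]) (xi i @^-1` A' i)).
  rewrite iidE// big_split_ord/= big1 ?mul1r.
    by congr (_ * _)%:E; apply: eq_bigr => i _; rewrite /A' ltnNge leq_addr/= addKn.
  by move=> i _; rewrite /A' ltn_ord probability_setT.
congr (_ `&` _); apply/seteqP; split=> w /= H i /= ilt.
  rewrite /A'; case: ltnP => // ti.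
  by have := H (i - t)%N; rewrite /= subnKC//; apply; rewrite ltn_subLR.
have := H (t + i)%N; rewrite /= ltn_add2l => /(_ ilt).
by rewrite /A' ltnNge leq_addr/= addKn.
Qed.

Lemma index_prob s : Q (tstar @^-1` [set s]) = (p s)%:E.
Proof.
have := @future1 0 0 s (fun=> setT) (fun=> measurableT).
rewrite big_ord0 mulr1 => <-; congr (Q _); rewrite /future.
by rewrite (_ : [set j | _] = set0) ?bigcap_set0 ?setIT// -subset0 => i.
Qed.

Lemma future_prob t n S A : (forall i, measurable (A i)) ->
  Q (future t n S A) = (Q (tstar @^-1` S) * (\prod_(i < n) fine (P (A i)))%:E)%E.
Proof.
move=> mA.
have E (B : set W) : tstar @^-1` S `&` B =
    \bigcup_(s in S) (tstar @^-1` [set s] `&` B).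
  by apply/seteqP; split=> [w [Sw Bw]|w [s Ss [/= ws Bw]]]; [exists (tstar w)|rewrite -ws in Ss].
have tI (B : set W) : trivIset S (fun s => tstar @^-1` [set s] `&` B).
  by move=> i j _ _ [w [[/= <- _] [/= <- _]]].
rewrite /future E measure_bigcup//; last by move=> s _; exact: measurable_future.
transitivity (\sum_(s <oo | s \in S) ((\prod_(i < n) fine (P (A i)))%:E * (p s)%:E))%E.
  by apply: eq_eseriesr => s _; rewrite -EFinM mulrC; exact: future1.
rewrite nneseriesZl; last by move=> s _; rewrite -index_prob measure_ge0.
rewrite muleC; congr (_ * _)%E.
rewrite -[tstar @^-1` S]setIT E measure_bigcup//.
  by apply: eq_eseriesr => s _; rewrite setIT; apply/esym; exact: index_prob.
by move=> s _; rewrite setIT; exact: measurable_index.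
Qed.

Definition independent_of_future (t : nat) (z : W -> Z) : Prop :=
  forall n S A C, (forall i, measurable (A i)) -> measurable C ->
  Q (z @^-1` C `&` future t n S A) = (Q (z @^-1` C) * Q (future t n S A))%E.

Lemma independent_of_future_cst t (c : Z) : independent_of_future t (fun=> c).
Proof.
move=> n S A C mA mC; have [Cc|nCc] := pselect (C c).
  by rewrite (_ : _ @^-1` C = setT) ?setTI ?probability_setT ?mul1e// -subTset => w.
by rewrite (_ : _ @^-1` C = set0) ?set0I ?measure0 ?mul0e// -subset0 => w.
Qed.

Lemma independent_of_sample t (z : W -> Z) : independent_of_future t z ->
  forall C B, measurable C -> measurable B ->
  Q (z @^-1` C `&` xi t @^-1` B) = (Q (z @^-1` C) * P B)%E.
Proof.
move=> indz C B mC mB.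
have FE : xi t @^-1` B = future t 1 setT (fun=> B).
  rewrite /future preimage_setT setTI; apply/seteqP; split=> [w Bw i /=|w H].
    by rewrite ltnS leqn0 => /eqP ->; rewrite addn0.
  by have := H 0%N; rewrite addn0; apply.
rewrite FE indz// future_prob// preimage_setT probability_setT mul1e big_ord1 fineK//.
exact: fin_num_measure.
Qed.

Lemma independent_of_index t (z : W -> Z) : independent_of_future t z ->
  forall C S, measurable C ->
  Q (z @^-1` C `&` tstar @^-1` S) = (Q (z @^-1` C) * Q (tstar @^-1` S))%E.
Proof.
move=> indz C S mC; have := indz 0%N S (fun=> setT) C (fun=> measurableT) mC.
have -> // : future t 0 S (fun=> setT) = tstar @^-1` S.
rewrite /future (_ : [set j | _] = set0) ?bigcap_set0 ?setIT//.
by rewrite -subset0 => i.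
Qed.

Lemma independent_of_futureS t (z z' : W -> Z) :
  measurable_fun setT z -> measurable_fun setT z' -> independent_of_future t z ->
  (forall C, measurable C -> exists2 D : set (Z * Omega), measurable D &
    {ae Q, forall w, C (z' w) <-> D (z w, xi t w)}) ->
  independent_of_future t.+1 z'.
Proof.
move=> mz mz' indz det n S A C mA mC.
have [D mD CD] := det C mC.
set H := future _ _ _ _.
have mH : measurable H by exact: measurable_future.
have mzx := measurable_fun_pair mz (mxi t).
have mD' : measurable [set w | D (z w, xi t w)].
  by rewrite -[X in measurable X]setTI; exact: mzx.
have mC' : measurable (z' @^-1` C) by rewrite -[X in measurable X]setTI; exact: mz'.
transitivity (Q ([set w | D (z w, xi t w)] `&` H)).
  apply: ae_eq_event; [exact: measurableI|exact: measurableI|].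
  by apply: filterS CD => w CD; split=> -[? ?]; split=> //; exact/CD.
rewrite (ae_eq_event mC' mD' CD) muleC.
apply: (pair_indep_event mz (mxi t) mH) mD => A0 B0 mA0 mB0.
pose A' i := if i is j.+1 then A j else B0.
have mA' i : measurable (A' i) by case: i.
have -> : z @^-1` A0 `&` xi t @^-1` B0 `&` H = z @^-1` A0 `&` future t n.+1 S A'.
  rewrite -setIA; congr (_ `&` _); rewrite /H /future setICA; congr (_ `&` _).
  apply/seteqP; split=> [w [Bw Hw] [|i] /= ilt|w Hw].
  - by rewrite addn0.
  - by have := Hw i; rewrite /= addSnnS; apply.
  split; first by have := Hw 0%N; rewrite addn0; apply.
  by move=> i /= ilt; have := Hw i.+1; rewrite /= addSnnS; apply.
rewrite indz// (independent_of_sample indz)// /H !future_prob// big_ord_recl/=.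
rewrite EFinM fineK; last exact: fin_num_measure.
by rewrite muleCA -[RHS]muleA; congr (_ * _)%E; rewrite muleA muleC.
Qed.

End iid_trajectory.

(** * Expectation at the random index *)

Lemma expect_sum {dT : measure_display} {T : measurableType dT} {R : realType}
    (P : probability T R) n (F : nat -> T -> R) :
  (forall i, (i < n)%N -> rintegrable P (F i)) ->
  rintegrable P (fun x => \sum_(i < n) F i x) /\
  expect P (fun x => \sum_(i < n) F i x) = \sum_(i < n) expect P (F i).
Proof.
elim: n => [|n IHn] intF.
  under eq_fun do rewrite big_ord0.
  by split; [exact: rintegrable_cst|rewrite expect_cst big_ord0].
have [In En] := IHn (fun i ilt => intF i (ltnW ilt)).
have Fn := intF n (ltnSn n).
under eq_fun do rewrite big_ord_recr/=.
by split; [exact: rintegrableD|rewrite expectD// En big_ord_recr].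
Qed.

Section random_index.
Context {R : realType} {dW dO dZ : measure_display}.
Context {W : measurableType dW} {Omega : measurableType dO} {Z : measurableType dZ}.
Variables (Q : probability W R) (P : probability Omega R).
Variables (xi : nat -> W -> Omega) (p : nat -> R) (tstar : W -> nat) (T : nat).
Hypothesis iid : iid_with_index Q P xi p tstar.
Hypothesis pT : forall s, (T < s)%N -> p s = 0.
Variables (z : nat -> W -> Z) (g : Z -> R).
Hypothesis mz : forall t, measurable_fun setT (z t).
Hypothesis indz : forall t, (t <= T)%N -> independent_of_future Q xi tstar t (z t).
Hypotheses (mg : measurable_fun setT g) (g_ge0 : forall y, 0 <= g y).
Hypothesis intg : forall t, (t <= T)%N -> rintegrable Q (fun w => g (z t w)).

Let mtstar : measurable_fun setT tstar.
Proof. by move=> _ S _; rewrite setTI; exact: (measurable_index iid). Qed.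

Let index_le : {ae Q, forall w, (tstar w <= T)%N}.
Proof.
have : {ae Q, forall w, forall s : nat, (T < s)%N -> tstar w <> s}.
  apply: ae_forall_countType => s; have [sT|Ts] := leqP s T.
    exact: aeW.
  exists (tstar @^-1` [set s]); split; first exact: (measurable_index iid).
    by rewrite (index_prob iid) pT.
  by move=> w /= H; apply: contrapT => ws; exact: H.
by apply: filterS => w H; rewrite leqNgt; apply/negP => /H; exact.
Qed.

Let measurable_z_tstar : measurable_fun setT (fun w => g (z (tstar w) w)).
Proof.
move=> _ Y mY; rewrite setTI.
rewrite (_ : _ @^-1` _ = \bigcup_s (tstar @^-1` [set s] `&` z s @^-1` (g @^-1` Y))).
  apply: bigcup_measurable => s _; apply: measurableI; first exact: (measurable_index iid).
  rewrite -[X in measurable X]setTI; apply: mz => //.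
  by rewrite -[X in measurable X]setTI; exact: mg.
apply/seteqP; split=> [w Yw|w [s _ [/= <- //]]].
by exists (tstar w).
Qed.

Let part t w := (tstar w == t)%:R * g (z t w).

(** The index now plays the part of the independent sample, with its own law in place of [P]. *)
Let part_expect t : (t <= T)%N ->
  rintegrable Q (part t) /\ expect Q (part t) = p t * expect Q (fun w => g (z t w)).
Proof.
move=> tT.
pose X : {mfun W >-> nat} := HB.pack tstar (isMeasurableFun.Build _ _ _ _ _ mtstar).
pose mu := distribution Q X.
have muE : mu [set t] = (p t)%:E by exact: (index_prob iid).
have indT C (S : set nat) : measurable C -> measurable S ->
    Q (z t @^-1` C `&` tstar @^-1` S) = (Q (z t @^-1` C) * mu S)%E.
  by move=> mC _; exact: (independent_of_index (indz tT)).
have int1 : rintegrable mu (\1_[set t]).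
  apply: (ae_le_rintegrable (g := fun=> 1)); [exact: measurable_indic|exact: rintegrable_cst|].
  by apply: aeW => y; rewrite indicE; case: (_ \in _); rewrite ?normr1 ?normr0.
have E1 : expect mu (\1_[set t]) = p t.
  transitivity (fine (mu [set t])); last by rewrite muE.
  by rewrite /expect integral_indic// setIT.
rewrite -(expectZ _ (intg tT)).
apply: (indep_expect_eq (mz t) mtstar indT (k := fun q => (q.2 == t)%:R * g q.1)).
- apply: measurable_funM; last exact: (measurableT_comp mg measurable_fst).
  have mI : measurable_fun setT (fun n : nat => (n == t)%:R : R) by [].
  exact: (measurableT_comp mI measurable_snd).
- by move=> q; rewrite mulr_ge0.
- move=> w /=; rewrite (_ : (fun y => _) = EFin \o (fun y => g (z t w) * \1_[set t] y)).
    rewrite (expectE (rintegrableZ _ int1)) expectZ// E1 mulrC//.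
  apply/funext => y /=; rewrite indicE mulrC; congr (_ * _%:R)%:E.
  by rewrite -[y == t]/(y \in pred1 t); congr nat_of_bool; apply/idP/idP => /=; rewrite !inE => /eqP.
- exact: (rintegrableZ _ (intg tT)).
Qed.

Lemma random_index_integral :
  (\int[Q]_w (g (z (tstar w) w))%:E =
   (\sum_(t < T.+1) p t * expect Q (fun w => g (z t w)))%:E)%E.
Proof.
have [I1 E1] := @expect_sum _ _ _ Q T.+1 part (fun t tT => (part_expect tT).1).
rewrite (@ae_eq_integral _ _ _ Q setT (fun w => (\sum_(t < T.+1) part t w)%:E))//.
- rewrite expectE// E1; congr EFin; apply: eq_bigr => t _.
  by rewrite (part_expect _).2// -ltnS.
- exact/measurable_EFinP.
- by move/integrableP : I1 => [].
apply: filterS index_le => w wT _; congr EFin.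
have lt : (tstar w < T.+1)%N by [].
rewrite (bigD1 (Ordinal lt))//= {1}/part eqxx mul1r big1 ?addr0// => i.
by rewrite -val_eqE/= eq_sym /part => /negbTE ->; rewrite mul0r.
Qed.

End random_index.

(** * Finite convex combinations and affine spans *)

Section convex_combination.
Context {R : realType} {d : nat}.
Notation vec := 'rV[R]_d.
Variables (D : set vec) (h : vec -> R).
Hypothesis convD : forall a b l, D a -> D b -> 0 < l < 1 -> D (l *: a + (1 - l) *: b).
Hypothesis convh : forall a b l, D a -> D b -> 0 < l < 1 ->
  h (l *: a + (1 - l) *: b) <= l * h a + (1 - l) * h b.

(** The weights are not normalized, and the positive weight of [v] keeps their sum away from zero.
    In the application the [c i] are rounding errors, which may vanish. *)
Lemma jensen n (p : 'I_n -> vec) (c : 'I_n -> R) (a : R) v :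
  (forall i, D (p i)) -> (forall i, 0 <= c i) -> D v -> 0 < a ->
  let sigma := a + \sum_i c i in
  let s := sigma^-1 *: (a *: v + \sum_i c i *: p i) in
  D s /\ sigma * h s <= a * h v + \sum_i c i * h (p i).
Proof.
move=> + + Dv a0; elim: n p c => [|n IHn] p c Dp c0 /=.
  by rewrite !big_ord0 !addr0 scalerA mulVf ?scale1r ?gt_eqF.
have [] := IHn (p \o widen_ord (leqnSn n)) (c \o widen_ord (leqnSn n)).
- by move=> i; exact: Dp.
- by move=> i; exact: c0.
rewrite /= !big_ord_recr/=.
set sg := a + \sum_(i < n) c _; set t := a *: v + \sum_(i < n) _.
set q := p ord_max; set k := c ord_max.
have sg0 : 0 < sg by rewrite ltr_wpDr// sumr_ge0.
have k0 : 0 <= k by exact: c0.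
move=> Ds Hs.
rewrite !addrA -/sg -/t.
have sgk0 : 0 < sg + k by rewrite ltr_wpDr.
have [->|kn0] := eqVneq k 0; first by rewrite scale0r mul0r !addr0.
have kgt0 : 0 < k by rewrite lt_neqAle eq_sym kn0.
pose l := sg / (sg + k).
have l01 : 0 < l < 1 by rewrite divr_gt0//= ltr_pdivrMr// mul1r ltrDl.
have E : (sg + k)^-1 *: (t + k *: q) = l *: (sg^-1 *: t) + (1 - l) *: q.
  rewrite scalerDr !scalerA; congr (_ *: _ + _ *: _); rewrite /l; field.
    by rewrite !gt_eqF.
  by rewrite gt_eqF.
rewrite E; split; first by apply: convD => //; exact: Dp.
have := convh Ds (Dp ord_max) l01; rewrite -/q -(ler_pM2l sgk0) => /le_trans; apply.
have -> : (sg + k) * (l * h (sg^-1 *: t) + (1 - l) * h q) =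
    sg * h (sg^-1 *: t) + k * h q.
  by rewrite /l; field; rewrite gt_eqF.
by rewrite lerD2r.
Qed.

End convex_combination.

Section affine_span.
Context {R : realType} {d : nat}.
Notation vec := 'rV[R]_d.

(** Appending a coordinate 1 turns affine combinations into linear ones; a family whose extended
    matrix has maximal rank then spans, as adding another point cannot raise the rank. *)
Lemma affine_spanning_family (D : set vec) : exists (n : nat) (p : 'I_n -> vec),
  (forall i, D (p i)) /\ forall v, D v -> exists2 c : 'I_n -> R,
    \sum_i c i = 1 & v = \sum_i c i *: p i.
Proof.
pose ext (v : vec) : 'rV[R]_(d + 1) := row_mx v 1%:M.
pose M n (p : 'I_n -> vec) : 'M[R]_(n, d + 1) := \matrix_i ext (p i).
pose rk m := `[<exists n (p : 'I_n -> vec), (forall i, D (p i)) /\ \rank (M n p) = m>].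
have ex : exists m, rk m.
  exists 0%N; apply/asboolP; exists 0%N, (fun i => 0); split; first by case.
  by apply/eqP; rewrite -leqn0 rank_leq_row.
have ub m : rk m -> (m <= d + 1)%N.
  by move=> /asboolP[n [p [_ <-]]]; exact: rank_leq_col.
case: (ex_maxnP ex ub) => m /asboolP[n [p [Dp rkp]]] Hm.
exists n, p; split=> // v Dv.
have vM : (ext v <= M n p)%MS.
  pose p' (i : 'I_n.+1) := if unlift ord0 i is Some j then p j else v.
  have Dp' i : D (p' i) by rewrite /p'; case: unliftP.
  have sub1 : (M n p <= M n.+1 p')%MS.
    apply/row_subP => i; rewrite (_ : row i (M n p) = row (lift ord0 i) (M n.+1 p')).
      exact: row_sub.
    by rewrite !rowK /p' liftK.
  have sub2 : (ext v <= M n.+1 p')%MS.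
    rewrite (_ : ext v = row ord0 (M n.+1 p')); first exact: row_sub.
    by rewrite rowK /p' unlift_none.
  apply: (submx_trans sub2); rewrite -(geq_leqif (mxrank_leqif_sup sub1)) rkp.
  by apply: Hm; apply/asboolP; exists n.+1, p'.
have [c cE] := submxP vM.
have : ext v = \sum_i c 0 i *: ext (p i).
  rewrite cE; apply/rowP => j; rewrite !mxE summxE; apply: eq_bigr => i _.
  by rewrite !mxE.
move=> {}cE; exists (fun i => c 0 i).
  have := congr1 (fun x => rsubmx x 0 0) cE; rewrite row_mxKr mxE eqxx mulr1n => ->.
  rewrite linear_sum summxE; apply: eq_bigr => i _.
  by rewrite linearZ/= row_mxKr !mxE eqxx mulr1.
have := congr1 lsubmx cE; rewrite row_mxKl => ->.
rewrite linear_sum; apply: eq_bigr => i _.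
by rewrite linearZ/= row_mxKl.
Qed.

End affine_span.

Lemma lip_minorant_continuous {R : realType} {d : nat} (z : 'rV[R]_d) (a l k : R) :
  continuous (fun y : 'rV[R]_d => a - l * enorm (z - y) + k * sqnorm y).
Proof.
have csq (t : R) (c : 'rV[R]_d) : continuous (fun y : 'rV[R]_d => t * sqnorm (y - c)).
  exact: sqnorm_sub_continuous.
have cen : continuous (fun y : 'rV[R]_d => enorm (z - y)).
  move=> y; apply: (@continuous_comp _ _ _ (fun y : 'rV[R]_d => sqnorm (z - y)) Num.sqrt).
    rewrite (_ : (fun _ => _) = (fun y : 'rV[R]_d => 1 * sqnorm (y - z))); first exact: csq.
    by apply/funext => y'; rewrite mul1r sqnormBC.
  exact: sqrt_continuous.
have ck : continuous (fun y : 'rV[R]_d => k * sqnorm y).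
  rewrite (_ : (fun _ => _) = (fun y : 'rV[R]_d => k * sqnorm (y - 0))); first exact: csq.
  by apply/funext => y'; rewrite subr0.
move=> y; apply: (@continuousD _ _ _ (fun y : 'rV[R]_d => a - l * enorm (z - y))); last exact: ck.
apply: (@continuousB _ _ _ (fun=> a) (fun y : 'rV[R]_d => l * enorm (z - y))); first exact: cst_continuous.
by apply: (@continuousM _ _ (fun=> l)); [exact: cst_continuous|exact: cen].
Qed.

(** * Consequences of the assumptions on the stochastic model *)

Section model.
Context {R : realType} {d : nat} {dO : measure_display} {Omega : measurableType dO}.
Variable P : probability Omega R.
Notation vec := 'rV[R]_d.
Notation row := (@row_of_tuple R d).
Variables (r : vec -> \bar R) (f : vec -> R) (fm : vec -> vec -> Omega -> R).
Variables (U : set vec) (L : Omega -> R) (tau eta Lbar : R).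
Hypothesis r_lsc : lower_semicontinuous r.
Hypothesis r_proper : exists z, (r z < +oo)%E.
Hypothesis r_Nny : forall z, r z != -oo%E.
Hypotheses (tau_ge0 : 0 <= tau) (Lbar_ge0 : 0 <= Lbar).
Hypothesis U_open : open U.
Hypothesis U_convex : convex_set U.
Hypothesis dom_U : forall z, (r z < +oo)%E -> U z.
Hypothesis fm_meas : measurable_fun
    [set p : (d.-tuple R * d.-tuple R) * Omega | U (row p.1.1) /\ U (row p.1.2)]
    (fun p => fm (row p.1.1) (row p.1.2) p.2).
Hypothesis fm_mean : forall z, U z -> (\int[P]_w (fm z z w)%:E = (f z)%:E)%E.
Hypothesis fm_upper : forall z y, U z -> U y ->
  (\int[P]_w (fm z y w - f y)%:E <= (tau / 2 * sqnorm (y - z))%:E)%E.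
Hypothesis fm_wc : forall z, U z ->
  {ae P, forall w, weakly_convex eta (fun y => (r y + (fm z y w)%:E)%E)}.
Hypotheses (L_meas : measurable_fun setT L) (L_ge0 : forall w, 0 <= L w).
Hypothesis L_sq : (\int[P]_w ((L w) ^+ 2)%:E <= (Lbar ^+ 2)%:E)%E.
Hypothesis fm_lip : forall z y, U z -> U y ->
  {ae P, forall w, fm z z w - fm z y w <= L w * enorm (z - y)}.

Let rr z := fine (r z).

Lemma r_fin z : (r z < +oo)%E -> r z = (fine (r z))%:E.
Proof. by move=> Dz; rewrite fineK// fin_numE r_Nny//= -ltey. Qed.

Lemma U_mix a b l : U a -> U b -> 0 < l < 1 -> U (l *: a + (1 - l) *: b).
Proof.
move=> Ua Ub /andP[l0 l1].
have := U_convex (Itv01 (ltW l0) (ltW l1)) (mem_set Ua) (mem_set Ub).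
by rewrite inE.
Qed.

Lemma weakly_convex_real z w :
  weakly_convex eta (fun y => r y + (fm z y w)%:E)%E ->
  forall a b l, (r a < +oo)%E -> (r b < +oo)%E -> 0 < l < 1 ->
  (r (l *: a + (1 - l) *: b)%R < +oo)%E /\
  rr (l *: a + (1 - l) *: b) + fm z (l *: a + (1 - l) *: b) w
    + eta / 2 * sqnorm (l *: a + (1 - l) *: b)
  <= l * (rr a + fm z a w + eta / 2 * sqnorm a)
     + (1 - l) * (rr b + fm z b w + eta / 2 * sqnorm b).
Proof.
move=> wc a b l Da Db l01; have := wc a b l l01.
rewrite (r_fin Da) (r_fin Db) -!EFinD => H.
have Dc : (r (l *: a + (1 - l) *: b)%R < +oo)%E.
  by rewrite ltNge leye_eq; apply/negP => /eqP E; move: H; rewrite E.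
by split=> //; move: H; rewrite (r_fin Dc) -!EFinD lee_fin.
Qed.

(** One sample at which weak convexity holds is enough, and a property holding almost surely holds
    somewhere. *)
Lemma dom_mix a b l : (r a < +oo)%E -> (r b < +oo)%E -> 0 < l < 1 ->
  (r (l *: a + (1 - l) *: b)%R < +oo)%E.
Proof.
move=> Da Db l01; have [w wc] := ae_ex (fm_wc (dom_U Da)).
by have [] := weakly_convex_real wc Da Db l01.
Qed.

(* The exceptional null set of [fm_lip] may depend on [y]; weak convexity makes
   it uniform in [y], since every [v] in the domain is up to a small error a
   rational combination of finitely many fixed points of the domain. *)
Lemma fm_lip_dom z : U z -> {ae P, forall w, forall y, (r y < +oo)%E ->
  fm z z w - fm z y w <= L w * enorm (z - y)}.
Proof.
move=> Uz.
have [n [p [Dp span]]] := affine_spanning_family [set y | (r y < +oo)%E].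
pose S (m : 'rV[rat]_n) : vec :=
  (\sum_i ratr (m 0 i))^-1 *: \sum_i ratr (m 0 i) *: p i.
have lipS : {ae P, forall w, forall m : 'rV[rat]_n, U (S m) ->
    fm z z w - fm z (S m) w <= L w * enorm (z - S m)}.
  apply: ae_forall_countType => m; have [US|nUS] := pselect (U (S m)).
    by apply: filterS (fm_lip Uz US).
  by apply: aeW => w /nUS.
apply: filterS2 lipS (fm_wc Uz) => w lipS wc v Dv.
rewrite leNgt; apply/negP => bad.
pose h y := rr y + fm z y w + eta / 2 * sqnorm y.
pose k y := fm z z w - L w * enorm (z - y) + eta / 2 * sqnorm y.
have t_lsc : lower_semicontinuous (fun y => r y + (k y)%:E)%E.
  apply: lower_semicontinuousD => //; exact: lip_minorant_continuous.
(* [bad] says that [h v < rr v + k v]. The contradiction arises at a rational combination [s] near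
   [v]: Jensen keeps [h s] at most [b], lower semicontinuity puts [rr s + k s] above [b], and [lipS]
   gives [rr s + k s <= h s]. *)
pose b := (h v + (rr v + k v)) / 2.
have hvb : h v < b by rewrite /b /h /k; lra.
have btv : (b%:E < r v + (k v)%:E)%E.
  by rewrite (r_fin Dv) -EFinD lte_fin -/(rr v); move: hvb; rewrite /b; lra.
have [V vV HV] := t_lsc _ _ btv.
have [dl dl0 {vV}Vdl] : exists2 e : R, 0 < e & forall y : vec,
    (forall j, `|y 0 j - v 0 j| < e) -> V y.
  move/nbhs_ballP : vV => [e /= e0 H]; exists e => // y yv; apply: H.
  by split=> // i j; rewrite (ord1 i) /ball/= distrC.
have [lam lam1 vE] := span v Dv.
pose K := \sum_i `|h (p i) - b|.
pose KK := \sum_i \sum_j `|p i 0 j - v 0 j|.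
have K0 : 0 <= K by apply: sumr_ge0.
have KK0 : 0 <= KK by apply: sumr_ge0 => i _; apply: sumr_ge0.
have g0 : 0 < b - h v by rewrite subr_gt0.
(* One summand for each demand on [e = den^-1]: [e] at most 1/3, the Jensen error [e * K] below
   [(1 - e) * (b - h v)], and the displacement of [s] per coordinate, at most [2 * e * KK], below
   [dl]. *)
pose den := 3 + K / (b - h v) + 2 * KK / dl.
have q1 : 0 <= K / (b - h v) by rewrite divr_ge0// ltW.
have q2 : 0 <= 2 * KK / dl by rewrite divr_ge0// ?mulr_ge0// ltW.
have den0 : 0 < den by rewrite /den; lra.
pose e := den^-1.
have e0 : 0 < e by rewrite invr_gt0.
have eden : e * den = 1 by rewrite mulVf// gt_eqF.
have e3 : e <= 1 / 3.
  have : 0 <= e * (K / (b - h v) + 2 * KK / dl) by rewrite mulr_ge0 ?(ltW e0)// addr_ge0.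
  by move: eden; rewrite /den; lra.
have eK : e * (K + (b - h v)) < b - h v.
  have -> : e * (K + (b - h v)) = (b - h v) * (e * (K / (b - h v) + 1)).
    by field; rewrite gt_eqF.
  rewrite -[ltRHS]mulr1 ltr_pM2l//.
  have : 0 <= e * (2 * KK / dl) by rewrite mulr_ge0 ?(ltW e0).
  by move: eden; rewrite /den; lra.
have eKK : 2 * e * KK < dl.
  have -> : 2 * e * KK = dl * (e * (2 * KK / dl)) by field; rewrite gt_eqF.
  rewrite -[ltRHS]mulr1 ltr_pM2l//.
  have : 0 <= e * (K / (b - h v)) by rewrite mulr_ge0 ?(ltW e0).
  by move: eden; rewrite /den; lra.
(* The affine coefficients [lam] may be negative. Rounding [(1 - e) * lam i] upwards makes the
   corrections [c i] nonnegative, so the rational combination is also a convex combination of [v]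
   and the [p i]. *)
have /choice[q Hq] : forall i, exists q : rat,
    (1 - e) * lam i < ratr q < (1 - e) * lam i + e.
  move=> i; have [|q] := @rat_in_itvoo R ((1 - e) * lam i) ((1 - e) * lam i + e).
    by rewrite ltrDl.
  by rewrite in_itv/= => H; exists q.
pose c i := ratr (q i) - (1 - e) * lam i.
have c0 i : 0 <= c i by have /andP[H _] := Hq i; rewrite subr_ge0 ltW.
have ce i : c i <= e by have /andP[_ H] := Hq i; rewrite lerBlDl ltW.
have e10 : 0 < 1 - e by lra.
have [] := @jensen _ _ _ h _ _ n p c (1 - e) v Dp c0 Dv e10.
- by move=> a' b' l Da Db l01; exact: dom_mix.
- by move=> a' b' l Da Db l01; have [_] := weakly_convex_real wc Da Db l01.
have sgE : 1 - e + \sum_i c i = \sum_i ratr (q i).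
  by rewrite sumrB -mulr_sumr lam1 mulr1 addrC subrK.
have vsE : (1 - e) *: v + \sum_i c i *: p i = \sum_i ratr (q i) *: p i.
  rewrite {1}vE scaler_sumr -big_split/=; apply: eq_bigr => i _.
  by rewrite scalerA -scalerDl /c addrC subrK.
rewrite vsE.
set sg := 1 - e + \sum_i c i; set s := sg^-1 *: _ => Ds Js.
have sc0 : 0 <= \sum_i c i by apply: sumr_ge0.
have sg2 : 1 / 2 <= sg by rewrite /sg; lra.
have sg0 : 0 < sg by lra.
have sS : s = S (\row_i q i).
  rewrite /s /S /sg sgE; congr (_^-1 *: _).
    by apply: eq_bigr => i _; rewrite mxE.
  by apply: eq_bigr => i _; rewrite mxE.
have Vs : V s.
  apply: Vdl => j.
  have -> : s 0 j - v 0 j = sg^-1 * \sum_i c i * (p i 0 j - v 0 j).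
    rewrite /s -vsE !mxE summxE.
    have -> : \sum_i c i * (p i 0 j - v 0 j) =
       \sum_i (c i *: p i) 0 j - (\sum_i c i) * v 0 j.
      by rewrite mulr_suml -sumrB; apply: eq_bigr => i _; rewrite mxE mulrBr.
    have -> : \sum_i c i = sg - (1 - e) by rewrite /sg; lra.
    by field; rewrite gt_eqF.
  rewrite normrM gtr0_norm ?invr_gt0//.
  apply: (@le_lt_trans _ _ (2 * (e * KK))); last by rewrite mulrA.
  apply: ler_pM => //.
  - by rewrite invr_ge0 ltW.
  - by rewrite -[leRHS]invrK lef_pV2 ?posrE ?invr_gt0//; lra.
  apply: (le_trans (ler_norm_sum _ _ _)); rewrite mulr_sumr; apply: ler_sum => i _.
  rewrite normrM ger0_norm//; apply: ler_pM => //.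
  by rewrite (bigD1 j)//= lerDl sumr_ge0.
have := HV _ Vs; rewrite (r_fin Ds) -EFinD lte_fin -/(rr s) => bs.
have Us : U (S (\row_i q i)) by rewrite -sS; exact: dom_U.
have := lipS _ Us; rewrite -sS => ls.
have {}bs : b < h s by move: bs; rewrite /h /k; lra.
have sgb : sg * b < sg * h s by rewrite ltr_pM2l.
have JK : \sum_i c i * h (p i) <= e * K + (\sum_i c i) * b.
  rewrite mulr_sumr mulr_suml -big_split/=; apply: ler_sum => i _.
  rewrite -lerBlDr -mulrBr (le_trans (ler_norm _))// normrM ger0_norm//.
  by rewrite ler_wpM2r.
by move: sgb Js JK eK; rewrite /sg; lra.
Qed.

(** Extension by zero off [U], measurable on the whole space, so that it can be composed with
    arbitrary measurable maps. *)
Definition fm_ext (z y : d.-tuple R) (w : Omega) : R :=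
  if `[<U (row z) /\ U (row y)>] then fm (row z) (row y) w else 0.

Lemma fm_extE z y w : U (row z) -> U (row y) ->
  fm_ext z y w = fm (row z) (row y) w.
Proof. by move=> Uz Uy; rewrite /fm_ext; case: asboolP => // -[]. Qed.

Lemma fm_ext_measurable dT (T : measurableType dT) (a b : T -> d.-tuple R)
    (c : T -> Omega) :
  measurable_fun setT a -> measurable_fun setT b -> measurable_fun setT c ->
  measurable_fun setT (fun t => fm_ext (a t) (b t) (c t)).
Proof.
move=> ma mb mc.
pose DU := [set p : (d.-tuple R * d.-tuple R) * Omega | U (row p.1.1) /\ U (row p.1.2)].
have mDU : measurable DU.
  have mU := open_row_measurable U_open.
  apply: measurableI.
    have m1 : measurable_fun setT (fun p : (d.-tuple R * d.-tuple R) * Omega => p.1.1).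
      exact: (measurableT_comp measurable_fst measurable_fst).
    by have := m1 measurableT _ mU; rewrite setTI.
  have m1 : measurable_fun setT (fun p : (d.-tuple R * d.-tuple R) * Omega => p.1.2).
    exact: (measurableT_comp measurable_snd measurable_fst).
  by have := m1 measurableT _ mU; rewrite setTI.
have mf : measurable_fun setT
    (fun p : (d.-tuple R * d.-tuple R) * Omega => fm_ext p.1.1 p.1.2 p.2).
  apply: measurable_fun_if => //.
  - apply: (@measurable_fun_bool _ _ _ _ true); rewrite setTI.
    rewrite (_ : _ @^-1` _ = DU)//.
    by apply/seteqP; split=> p /asboolP.
  - rewrite setTI (_ : _ @^-1` _ = DU)//.
    by apply/seteqP; split=> p /asboolP.
have mp : measurable_fun setT (fun t => ((a t, b t), c t)).
  by do 2 apply: measurable_fun_pair => //.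
exact: (measurableT_comp mf mp).
Qed.

Lemma fm_measurable z y : U z -> U y -> measurable_fun setT (fm z y).
Proof.
move=> Uz Uy.
apply: (eq_measurable_fun (fun w => fm_ext (tuple_of_row z) (tuple_of_row y) w)).
  by move=> w _; rewrite fm_extE !tuple_of_rowK.
by apply: fm_ext_measurable => //; exact: measurable_id.
Qed.

Lemma L2_rintegrable : rintegrable P (fun w => L w ^+ 2).
Proof.
apply/integrableP; split; first by apply/measurable_EFinP; exact: measurable_funX.
apply: le_lt_trans (le_lt_trans L_sq (ltry _)).
apply: ge0_le_integral => //.
- by apply: measurableT_comp => //; apply/measurable_EFinP; exact: measurable_funX.
- by apply/measurable_EFinP; exact: measurable_funX.
- by move=> w _ /=; rewrite lee_fin ger0_norm ?sqr_ge0.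
Qed.

Lemma expect_L2 : expect P (fun w => L w ^+ 2) <= Lbar ^+ 2.
Proof. by rewrite -lee_fin -expectE//; exact: L2_rintegrable. Qed.

Lemma L_rintegrable : rintegrable P L.
Proof.
apply: (ae_le_rintegrable (g := fun w => L w ^+ 2 + 1)) => //.
  by apply: rintegrableD; [exact: L2_rintegrable|exact: rintegrable_cst].
apply: aeW => w; rewrite ger0_norm//.
by have := sqr_ge0 (L w - 1); have := sqr_ge0 (L w); lra.
Qed.

(** Cauchy-Schwarz through L <= (L^2 + a^2)/(2a) with [a = Lbar + e]; the [e] is there because
    [Lbar] may be zero. *)
Lemma expect_L : expect P L <= Lbar.
Proof.
apply/ler_addgt0Pr => e e0.
have a0 : 0 < Lbar + e by rewrite ltr_wpDl.
have : expect P L <= expect P (fun w => (2 * (Lbar + e))^-1 * (L w ^+ 2 + (Lbar + e) ^+ 2)).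
  apply: le_expect; first exact: L_rintegrable.
    apply: rintegrableZ; apply: rintegrableD; first exact: L2_rintegrable.
    exact: rintegrable_cst.
  move=> w; rewrite ler_pdivlMl ?mulr_gt0//.
  by have := sqr_ge0 (L w - (Lbar + e)); lra.
rewrite expectZ; last first.
  by apply: rintegrableD; [exact: L2_rintegrable|exact: rintegrable_cst].
rewrite expectD ?expect_cst; [|exact: L2_rintegrable|exact: rintegrable_cst].
move=> /le_trans; apply; rewrite ler_pdivrMl ?mulr_gt0//.
have := expect_L2; have : 0 <= Lbar * e by rewrite mulr_ge0// ltW.
have := sqr_ge0 e; lra.
Qed.

Lemma fm_diag_rintegrable z : U z -> rintegrable P (fm z z).
Proof.
move=> Uz; have mf := fm_measurable Uz Uz.
apply/integrableP; split; first exact/measurable_EFinP.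
by rewrite integral_fin_num_abs// fm_mean.
Qed.

(** (B4) bounds the model below by an integrable function, the diagonal value minus a multiple of
    [L], and (B2) bounds its integral above. *)
Lemma fm_rintegrable z y : U z -> U y -> rintegrable P (fm z y).
Proof.
move=> Uz Uy; have mf := fm_measurable Uz Uy.
have : rintegrable P (fun w => fm z y w - f y).
  apply: (rintegrable_ge (k := fun w => fm z z w - enorm (z - y) * L w - f y)).
  - by apply: measurable_funB.
  - apply: rintegrableB; last exact: rintegrable_cst.
    apply: rintegrableB; first exact: fm_diag_rintegrable.
    exact/rintegrableZ/L_rintegrable.
  - by apply: filterS (fm_lip Uz Uy) => w; lra.
  - exact: le_lt_trans (fm_upper Uz Uy) (ltry _).
move=> /rintegrableD/(_ (rintegrable_cst P (f y))).
by apply: eq_integrable => // w _ /=; rewrite subrK.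
Qed.

Lemma expect_fm_diag z : U z -> expect P (fm z z) = f z.
Proof. by move=> Uz; rewrite /expect fm_mean. Qed.

Lemma expect_fm_upper z y : U z -> U y ->
  expect P (fm z y) <= f y + tau / 2 * sqnorm (y - z).
Proof.
move=> Uz Uy; have intf := fm_rintegrable Uz Uy.
have := fm_upper Uz Uy; rewrite expectE; last exact/rintegrableB/rintegrable_cst.
by rewrite expectB ?expect_cst// ?lee_fin; [lra|exact: rintegrable_cst].
Qed.

Let phi y := ((f y)%:E + r y)%E.

(** The model is centred at the convex combination [c] itself: it is exact in mean there, and its
    excess over [f] at [a] and [b] adds up to the quadratic defect with factor [tau / 2]. *)
Lemma phi_weakly_convex : weakly_convex (tau + eta) phi.
Proof.
move=> a b l l01; have /andP[l0 l1] := l01; rewrite /phi.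
have l10 : 0 < 1 - l by rewrite subr_gt0.
have [Da|] := boolP (r a < +oo)%E; last first.
  rewrite -leNgt leye_eq => /eqP ->; rewrite addey// addye// gt0_muley ?lte_fin//.
  rewrite addye ?leey//.
  have : ((f b)%:E + r b != -oo)%E by case: (r b) (r_Nny b).
  by case: ((f b)%:E + r b)%E => [x| |] // _; rewrite ?addye// ?gt0_muley// ?lte_fin.
have [Db|] := boolP (r b < +oo)%E; last first.
  rewrite -leNgt leye_eq => /eqP ->; rewrite addey// addye// gt0_muley ?lte_fin//.
  by rewrite (r_fin Da) addey ?leey.
have [Ua Ub] := (dom_U Da, dom_U Db).
set c := l *: a + (1 - l) *: b.
have Uc : U c by exact: U_mix.
have Dc : (r c < +oo)%E by exact: dom_mix.
rewrite (r_fin Da) (r_fin Db) (r_fin Dc) -!EFinD lee_fin -/(rr a) -/(rr b) -/(rr c).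
have Ia := fm_rintegrable Uc Ua; have Ib := fm_rintegrable Uc Ub.
have Ic := fm_rintegrable Uc Uc.
have := @ae_le_expect _ _ _ P
  (fun w => (rr c + eta / 2 * sqnorm c) + fm c c w)
  (fun w => (l * (rr a + eta / 2 * sqnorm a) + (1 - l) * (rr b + eta / 2 * sqnorm b))
     + (l * fm c a w + (1 - l) * fm c b w)).
have Iab : rintegrable P (fun w => l * fm c a w + (1 - l) * fm c b w).
  by apply: rintegrableD; exact: rintegrableZ.
move=> /(_ (rintegrableD (rintegrable_cst P _) Ic) (rintegrableD (rintegrable_cst P _) Iab)).
rewrite (expectD (rintegrable_cst P _) Ic) (expectD (rintegrable_cst P _) Iab).
rewrite (expectD (rintegrableZ l Ia) (rintegrableZ (1 - l) Ib)).
rewrite !expect_cst !expectZ// expect_fm_diag// => H.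
have Hae : {ae P, forall w, (rr c + eta / 2 * sqnorm c) + fm c c w <=
    (l * (rr a + eta / 2 * sqnorm a) + (1 - l) * (rr b + eta / 2 * sqnorm b))
     + (l * fm c a w + (1 - l) * fm c b w)} by
  apply: filterS (fm_wc Uc) => w wc;
  have [_] := weakly_convex_real wc Da Db l01; rewrite -/c; lra.
have := H Hae.
have ea := expect_fm_upper Uc Ua; have eb := expect_fm_upper Uc Ub.
have {}ea : l * expect P (fm c a) <= l * (f a + tau / 2 * sqnorm (a - c)) by rewrite ler_pM2l.
have {}eb : (1 - l) * expect P (fm c b) <= (1 - l) * (f b + tau / 2 * sqnorm (b - c)).
  by rewrite ler_pM2l.
have Eac : l * sqnorm (a - c) + (1 - l) * sqnorm (b - c) =
    l * sqnorm a + (1 - l) * sqnorm b - sqnorm c.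
  rewrite /c !sqnorm_dot !dotE (dotC b a); ring.
have {}Eac : tau / 2 * (l * sqnorm (a - c) + (1 - l) * sqnorm (b - c)) =
    tau / 2 * (l * sqnorm a + (1 - l) * sqnorm b - sqnorm c) by rewrite Eac.
lra.
Qed.

(** A single comparison through the model leaves an error [tau / 2 * sqnorm (a - b)]. Cutting the
    segment into [n.+1] equal pieces divides the total error by [n.+1]. *)
Lemma f_lipschitz z y : U z -> U y -> f z - f y <= Lbar * enorm (z - y).
Proof.
move=> Uz Uy.
have step a b : U a -> U b -> f a - f b <= Lbar * enorm (a - b) + tau / 2 * sqnorm (a - b).
  move=> Ua Ub.
  have := @ae_le_expect _ _ _ P (fm a a) (fun w => fm a b w + enorm (a - b) * L w).
  have IL := rintegrableZ (enorm (a - b)) L_rintegrable.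
  have Iab := fm_rintegrable Ua Ub.
  move=> /(_ (fm_rintegrable Ua Ua) (rintegrableD Iab IL)).
  rewrite expectD// expectZ ?expect_fm_diag//; last exact: L_rintegrable.
  have ab := fm_lip Ua Ub.
  have Hae : {ae P, forall w, fm a a w <= fm a b w + enorm (a - b) * L w}.
    by apply: filterS ab => w; lra.
  move=> /(_ Hae).
  have := expect_fm_upper Ua Ub; rewrite (sqnormBC b a).
  have : enorm (a - b) * expect P L <= enorm (a - b) * Lbar.
    by rewrite ler_wpM2l ?enorm_ge0// expect_L.
  lra.
have sub n : f z - f y <= Lbar * enorm (z - y) + n.+1%:R^-1 * (tau / 2 * sqnorm (z - y)).
  pose pt (k : nat) : vec := (k%:R / n.+1%:R) *: z + (1 - k%:R / n.+1%:R) *: y.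
  have Upt k : (k <= n.+1)%N -> U (pt k).
    move=> kn; have [->|k0] := posnP k; first by rewrite /pt mul0r scale0r add0r subr0 scale1r.
    have [->|kn1] := eqVneq k n.+1.
      by rewrite /pt divff ?pnatr_eq0// subrr scale0r addr0 scale1r.
    apply: U_mix => //; rewrite divr_gt0 ?ltr0n//= ltr_pdivrMr ?ltr0n// mul1r ltr_nat.
    by rewrite ltn_neqAle kn1.
  have dpt k : pt k.+1 - pt k = n.+1%:R^-1 *: (z - y).
    apply/rowP => j; rewrite !mxE -natr1; field.
    by rewrite nat1r pnatr_eq0.
  have n0 : 0 <= n.+1%:R^-1 :> R by rewrite invr_ge0.
  have tel k : (k <= n.+1)%N -> f (pt k) - f y <=
      k%:R * (Lbar * (n.+1%:R^-1 * enorm (z - y)) + tau / 2 * (n.+1%:R^-1 ^+ 2 * sqnorm (z - y))).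
    elim: k => [_|k IHk kn].
      by rewrite {1}/pt !mul0r scale0r add0r subr0 scale1r subrr.
    have := step _ _ (Upt _ kn) (Upt _ (ltnW kn)); rewrite dpt enormZ// sqnormZ.
    have := IHk (ltnW kn); rewrite -natr1.
    lra.
  have := tel n.+1 (leqnn _).
  have -> : pt n.+1 = z by rewrite /pt divff ?pnatr_eq0// subrr scale0r addr0 scale1r.
  move=> /le_trans; apply; rewrite le_eqVlt; apply/orP; left; apply/eqP.
  by field; rewrite nat1r pnatr_eq0.
apply/ler_addgt0Pr => e e0.
have s0 : 0 <= tau / 2 * sqnorm (z - y) by rewrite mulr_ge0 ?sqnorm_ge0// divr_ge0.
have den : 0 < tau / 2 * sqnorm (z - y) + 1 by rewrite ltr_wpDl.
have e'0 : 0 < e / (tau / 2 * sqnorm (z - y) + 1) by rewrite divr_gt0.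
have [n _ /(_ n (leqnn _)) /= ne] := near_infty_natSinv_lt (PosNum e'0).
apply: (le_trans (sub n)); rewrite lerD2l.
move: ne; rewrite ltr_pdivlMr//.
have n0 : 0 <= n.+1%:R^-1 :> R by rewrite invr_ge0.
by move: n0; move: (n.+1%:R^-1) => n1 n0 ne; lra.
Qed.

(** * Regularity of the composite objective and measurability of its envelope *)

Hypothesis f_llip : locally_lipschitz f.
Variables (rhob : R).
Hypotheses (rhob_gt0 : 0 < rhob) (rhob_gt : tau + eta < rhob).

Lemma f_continuous : continuous f.
Proof.
move=> x; apply/continuous_sqnormP => e e0.
have [dl dl0 [K HK]] := f_llip x.
have K0 : 0 < `|K| + 1 by rewrite ltr_wpDl.
have m0 : 0 < Num.min dl (e / (`|K| + 1)) by rewrite lt_min dl0 divr_gt0.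
exists (Num.min dl (e / (`|K| + 1)) ^+ 2); first by rewrite exprn_gt0.
move=> y; rewrite -sqr_enorm ltr_pXn2r ?nnegrE ?enorm_ge0 ?(ltW m0)//.
rewrite lt_min => /andP[ydl ye].
have x0 : enorm (x - x) < dl by rewrite subrr /enorm sqnorm0 sqrtr0.
apply: le_lt_trans (HK y x ydl x0) _.
rewrite ltr_pdivlMr// in ye.
have : K * enorm (y - x) <= `|K| * enorm (y - x).
  by rewrite ler_wpM2r ?enorm_ge0// ler_norm.
have := enorm_ge0 (y - x); lra.
Qed.

Lemma phi_lsc : lower_semicontinuous phi.
Proof.
rewrite /phi; under eq_fun do rewrite addeC.
by apply: lower_semicontinuousD => //; exact: f_continuous.
Qed.

Lemma phi_lty y : (phi y < +oo)%E = (r y < +oo)%E.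
Proof. by rewrite /phi; case: (r y) => [z| |] //; rewrite -EFinD !ltry. Qed.

Lemma phi_proper : exists z, (phi z < +oo)%E.
Proof. by have [z Dz] := r_proper; exists z; rewrite phi_lty. Qed.

Lemma phi_Nny z : phi z != -oo%E.
Proof. by rewrite /phi; case: (r z) (r_Nny z). Qed.

Lemma fine_phi y : (r y < +oo)%E -> fine (phi y) = f y + fine (r y).
Proof. by move=> Dy; rewrite /phi (r_fin Dy). Qed.

Let px := prox phi rhob.
Let M x := fine (moreau phi rhob^-1 x).

Lemma px_dom x : (r (px x) < +oo)%E.
Proof.
rewrite -phi_lty.
exact: (prox_dom phi_lsc phi_proper phi_Nny phi_weakly_convex rhob_gt0 rhob_gt).
Qed.

Let px_min x y : (r y < +oo)%E ->
  f (px x) + rr (px x) + rhob / 2 * sqnorm (px x - x)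
  <= f y + rr y + rhob / 2 * sqnorm (y - x).
Proof.
move=> Dy.
have := prox_strong_min phi_lsc phi_proper phi_Nny phi_weakly_convex rhob_gt0 rhob_gt x.
move=> /(_ y); rewrite phi_lty => /(_ Dy).
rewrite !fine_phi//; last exact: px_dom.
have : 0 <= (rhob - (tau + eta)) / 2 * sqnorm (y - px x).
  by rewrite mulr_ge0 ?sqnorm_ge0// divr_ge0// subr_ge0 ltW.
rewrite /rr /px; lra.
Qed.

Let moreau_px x : moreau phi rhob^-1 x =
  (f (px x) + rr (px x) + rhob / 2 * sqnorm (px x - x))%:E.
Proof.
rewrite (moreau_prox phi_lsc phi_proper phi_Nny phi_weakly_convex rhob_gt0 rhob_gt).
by rewrite fine_phi//; exact: px_dom.
Qed.

Lemma moreau_finE x : moreau phi rhob^-1 x = (M x)%:E.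
Proof. by rewrite /M moreau_px. Qed.

Let M_le x y : (r y < +oo)%E -> M x <= f y + rr y + rhob / 2 * sqnorm (y - x).
Proof. by rewrite /M moreau_px; exact: px_min. Qed.

Lemma measurable_continuous_comp dT (T : measurableType dT) (x : T -> vec) (g : vec -> R) :
  continuous g -> rvec_measurable x -> measurable_fun setT (fun t => g (x t)).
Proof.
move=> cg /measurable_tuple_of_row mx.
apply: eq_measurable_fun (measurableT_comp (continuous_row_measurable cg) mx).
by move=> t _ /=; rewrite tuple_of_rowK.
Qed.

Lemma measurable_M dT (T : measurableType dT) (x : T -> vec) :
  rvec_measurable x -> measurable_fun setT (fun t => M (x t)).
Proof.
apply: measurable_continuous_comp.
exact: (moreau_continuous phi_lsc phi_proper phi_Nny phi_weakly_convex rhob_gt0 rhob_gt).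
Qed.

Lemma measurable_px dT (T : measurableType dT) (x : T -> vec) :
  rvec_measurable x -> rvec_measurable (fun t => px (x t)).
Proof.
move=> mx i; apply: (@measurable_continuous_comp _ _ _ (fun y => px y 0 i)) mx.
exact: (prox_coord_continuous phi_lsc phi_proper phi_Nny phi_weakly_convex rhob_gt0 rhob_gt).
Qed.

Let dom_measurable dT (T : measurableType dT) (a : T -> d.-tuple R) :
  measurable_fun setT a -> measurable [set t | (r (row (a t)) < +oo)%E].
Proof.
move=> ma; have mr := measurableT_comp (lsc_row_measurable r_lsc) ma.
have := measurable_lte measurableT mr (measurable_cst (+oo : \bar R)%E).
by rewrite setTI.
Qed.

Let U_measurable dT (T : measurableType dT) (a : T -> d.-tuple R) :
  measurable_fun setT a -> measurable [set t | U (row (a t))].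
Proof.
by move=> ma; have := ma measurableT _ (open_row_measurable U_open); rewrite setTI.
Qed.

Let rr_measurable dT (T : measurableType dT) (a : T -> d.-tuple R) :
  measurable_fun setT a -> measurable_fun setT (fun t => rr (row (a t))).
Proof.
move=> ma; have mr := measurableT_comp (lsc_row_measurable r_lsc) ma.
exact: (measurableT_comp (fine_measurable measurableT) mr).
Qed.

Lemma sqnorm_rintegrable_px dT (T : measurableType dT) (Q : probability T R) (x : T -> vec) :
  rvec_measurable x -> rintegrable Q (fun w => sqnorm (x w)) ->
  rintegrable Q (fun w => sqnorm (px (x w) - x w)).
Proof.
move=> mx intx.
have [A HA] := sqnorm_prox_bound phi_lsc phi_proper phi_Nny phi_weakly_convex rhob_gt0 rhob_gt.
apply: (ae_le_rintegrable (g := fun w => 2 * (A * (sqnorm (x w) + 1)) + 2 * sqnorm (x w))).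
- by apply: measurable_sqnormB => //; exact: measurable_px.
- apply: rintegrableD; last exact: rintegrableZ.
  do 2 apply: rintegrableZ; apply: rintegrableD => //; exact: rintegrable_cst.
apply: aeW => w; rewrite ger0_norm ?sqnorm_ge0//.
apply: (le_trans (sqnormD_le _ _)); rewrite sqnormN.
have := HA (x w); rewrite -/px => H; lra.
Qed.

Lemma M_rintegrable dT (T : measurableType dT) (Q : probability T R) (x : T -> vec) :
  rvec_measurable x -> rintegrable Q (fun w => sqnorm (x w)) ->
  rintegrable Q (fun w => M (x w)).
Proof.
move=> mx intx.
have [A HA] := moreau_bound phi_lsc phi_proper phi_Nny phi_weakly_convex rhob_gt0 rhob_gt.
apply: (ae_le_rintegrable (g := fun w => A * (sqnorm (x w) + 1))).
- exact: measurable_M.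
- apply: rintegrableZ; apply: rintegrableD => //; exact: rintegrable_cst.
by apply: aeW => w; exact: HA.
Qed.

Lemma sqgrad_px x : sqgrad_moreau phi rhob^-1 x = rhob ^+ 2 * sqnorm (px x - x).
Proof.
exact: (sqgrad_moreauE phi_lsc phi_proper phi_Nny phi_weakly_convex rhob_gt0 rhob_gt).
Qed.

(** * One step of the method *)

Section step.
Context {dW : measure_display} {W : measurableType dW}.
Variables (Q : probability W R) (x x' : W -> vec) (xi : W -> Omega) (beta : R).
Hypotheses (mx : rvec_measurable x) (mx' : rvec_measurable x').
Hypothesis mxi : measurable_fun setT xi.
Hypothesis indep : forall A B, measurable A -> measurable B ->
  Q ((tuple_of_row \o x) @^-1` A `&` xi @^-1` B) =
  (Q ((tuple_of_row \o x) @^-1` A) * P B)%E.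
Hypothesis Ux : {ae Q, forall w, U (x w)}.
Hypothesis x'_min : {ae Q, forall w, forall y,
  (r (x' w) + (fm (x w) (x' w) (xi w))%:E + (beta / 2 * sqnorm (x' w - x w))%:E
   <= r y + (fm (x w) y (xi w))%:E + (beta / 2 * sqnorm (y - x w))%:E)%E}.
Hypothesis beta_gt : rhob < beta.

Let zeta := tuple_of_row \o x.
Let v := tuple_of_row \o x'.
Let u w := (zeta w, xi w).
Notation X := (d.-tuple R * Omega)%type.

Let mzeta : measurable_fun setT zeta. Proof. exact/measurable_tuple_of_row. Qed.
Let mv : measurable_fun setT v. Proof. exact/measurable_tuple_of_row. Qed.

Let zetaK w : row (zeta w) = x w. Proof. exact: tuple_of_rowK. Qed.
Let vK w : row (v w) = x' w. Proof. exact: tuple_of_rowK. Qed.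

Let obj (p : X) (y : d.-tuple R) : R :=
  rr (row y) + fm_ext p.1 y p.2 + beta / 2 * sqnorm (row y - row p.1).

Let obj_measurable dT (T : measurableType dT) (p : T -> X) (y : T -> d.-tuple R) :
  measurable_fun setT p -> measurable_fun setT y ->
  measurable_fun setT (fun t => obj (p t) (y t)).
Proof.
move=> mp my.
have mp1 : measurable_fun setT (fun t => (p t).1) by exact: (measurableT_comp measurable_fst mp).
have mp2 : measurable_fun setT (fun t => (p t).2) by exact: (measurableT_comp measurable_snd mp).
apply: measurable_funD; first apply: measurable_funD.
- exact: rr_measurable.
- exact: fm_ext_measurable.
apply: measurable_funM => //; apply: measurable_sqnormB; exact: rvec_measurable_row.
Qed.

Let min_real : {ae Q, forall w, [/\ U (x w), (r (x' w) < +oo)%E &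
  forall y, (r (row y) < +oo)%E -> obj (u w) (v w) <= obj (u w) y]}.
Proof.
apply: filterS2 Ux x'_min => w Uxw min.
have Dx' : (r (x' w) < +oo)%E.
  have [y0 Dy0] := r_proper.
  rewrite ltNge leye_eq; apply/negP => /eqP E; have := min y0.
  by rewrite E (r_fin Dy0) addye// addye// -!EFinD leye_eq.
split=> // y Dy; have := min (row y); rewrite (r_fin Dx') (r_fin Dy) -!EFinD lee_fin.
by rewrite /obj /= !fm_extE ?vK ?zetaK//; exact: dom_U.
Qed.

Lemma iterate_dom : {ae Q, forall w, (r (x' w) < +oo)%E}.
Proof. by apply: filterS min_real => w []. Qed.

(** The exceptional sets of (B3) depend on the base point, so convexity cannot be used directly at
    the random iterates. Its failure at a competitor [a (u w)], for one of countably many weights,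
    is a measurable event, which [ae_not_section] shows to be null; the weights then tend to
    zero. *)
Let strong_min (a : X -> d.-tuple R) : measurable_fun setT a ->
  {ae Q, forall w, (r (row (a (u w))) < +oo)%E ->
    obj (u w) (v w) + (beta - eta) / 2 * sqnorm (row (a (u w)) - x' w)
    <= obj (u w) (a (u w))}.
Proof.
move=> ma.
pose l (k : nat) : R := k.+2%:R^-1.
have l01 k : 0 < l k < 1.
  by rewrite /l invr_gt0 ltr0n/= invf_lt1 ?ltr0n// ltr1n.
pose mix k (p : X * d.-tuple R) : d.-tuple R :=
  tuple_of_row (l k *: row (a p.1) + (1 - l k) *: row p.2).
pose rhs k (p : X * d.-tuple R) : R :=
  l k * obj p.1 (a p.1) + (1 - l k) * obj p.1 p.2
    - (beta - eta) / 2 * (l k * (1 - l k) * sqnorm (row (a p.1) - row p.2)).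
pose bad k : set (X * d.-tuple R) :=
  ([set p | U (row p.1.1)] `&` [set p | (r (row p.2) < +oo)%E]
   `&` [set p | (r (row (a p.1)) < +oo)%E])
   `&` [set p | rhs k p < obj p.1 (mix k p)].
have mfst : measurable_fun setT (fst : X * d.-tuple R -> X) by exact: measurable_fst.
have msnd : measurable_fun setT (snd : X * d.-tuple R -> d.-tuple R) by exact: measurable_snd.
have ma1 : measurable_fun setT (fun p : X * d.-tuple R => a p.1).
  exact: (measurableT_comp ma mfst).
have mmix k : measurable_fun setT (mix k).
  apply/(measurable_tuple_of_row (fun p => l k *: row (a p.1) + (1 - l k) *: row p.2)).
  by apply: rvec_measurable_mix; exact: rvec_measurable_row.
have mbad k : measurable (bad k).
  apply: measurableI; first apply: measurableI; first apply: measurableI.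
  - by apply: U_measurable; exact: (measurableT_comp measurable_fst mfst).
  - exact: dom_measurable.
  - exact: dom_measurable.
  apply: (@measurable_set_pred _ _ (fun p => rhs k p < obj p.1 (mix k p))).
  apply: measurable_fun_ltr; last exact: obj_measurable.
  apply: measurable_funB; first apply: measurable_funD.
  - by apply: measurable_funM => //; exact: obj_measurable.
  - by apply: measurable_funM => //; exact: obj_measurable.
  apply: measurable_funM => //; apply: measurable_funM => //.
  by apply: measurable_sqnormB; exact: rvec_measurable_row.
have nbad : {ae Q, forall w, forall k, ~ bad k (u w, v w)}.
  apply: ae_forall_countType => k.
  apply: (ae_not_section mzeta mxi indep mv (mbad k)).
  apply: filterS Ux => w Uxw.
  apply: filterS (fm_wc Uxw) => y wc t [[[Uz Dt] Da]] /=.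
  apply/negP; rewrite -leNgt.
  have [Dc H] := weakly_convex_real wc Da Dt (l01 k).
  move: H; rewrite /obj /rhs /mix /obj /= !fm_extE ?tuple_of_rowK ?zetaK//;
    try exact: dom_U.
  rewrite sqnorm_mix sqnorm_mix0; lra.
apply: filterS2 nbad min_real => w nbad [Uxw Dx' min] Da.
set S := sqnorm (row (a (u w)) - x' w).
have S0 : 0 <= (beta - eta) / 2 * S.
  rewrite mulr_ge0 ?sqnorm_ge0// divr_ge0// subr_ge0.
  by have := beta_gt; have := rhob_gt; have := tau_ge0; lra.
have key k : obj (u w) (v w) + (1 - l k) * ((beta - eta) / 2 * S) <= obj (u w) (a (u w)).
  have Dv : (r (row (v w)) < +oo)%E by rewrite vK.
  have Dc : (r (row (mix k (u w, v w))) < +oo)%E.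
    by rewrite tuple_of_rowK; exact: dom_mix.
  have : obj (u w) (mix k (u w, v w)) <= rhs k (u w, v w).
    rewrite leNgt; apply/negP => H; apply: (nbad k); split => //; split=> //; split=> //=.
    by rewrite zetaK.
  move=> /(le_trans (min _ Dc)); rewrite /rhs /= vK -/S => H.
  have /andP[lk0 _] := l01 k.
  by rewrite -(ler_pM2l lk0); lra.
apply/ler_addgt0Pr => e e0.
have den : 0 < (beta - eta) / 2 * S + 1 by rewrite ltr_wpDl.
have e'0 : 0 < e / ((beta - eta) / 2 * S + 1) by rewrite divr_gt0.
have [n _ /(_ n.+1 (leqnSn _)) /= ne] := near_infty_natSinv_lt (PosNum e'0).
have := key n; move: ne; rewrite ltr_pdivlMr// -/(l n).
have /andP[lk0 _] := l01 n.
by move: (l n) lk0 => ln ln0; lra.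
Qed.

Let mu : measurable_fun setT u. Proof. exact: measurable_fun_pair. Qed.

Let kappa := (beta - eta) / 2.
Let kappa_gt0 : 0 < kappa.
Proof.
rewrite /kappa divr_gt0// subr_gt0.
by have := beta_gt; have := rhob_gt; have := tau_ge0; lra.
Qed.

Let sublevel_selection (q : rat) : exists (G : set X) (s : X -> d.-tuple R),
  [/\ measurable G, measurable_fun setT s,
      {ae Q, forall w, obj (u w) (v w) < ratr q -> G (u w)} &
      forall p, G p -> (r (row (s p)) < +oo)%E /\ obj p (s p) < ratr q].
Proof.
pose B : set (X * d.-tuple R) :=
  [set p | (r (row p.2) < +oo)%E] `&` [set p | obj p.1 p.2 < ratr q].
have mB : measurable B.
  apply: measurableI; first by apply: dom_measurable; exact: measurable_snd.
  apply: (@measurable_set_pred _ _ (fun p => obj p.1 p.2 < ratr q)).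
  apply: measurable_fun_ltr => //; apply: obj_measurable.
    exact: measurable_fst.
  exact: measurable_snd.
have [G [s [mG ms QG Gs]]] := measurable_selection Q mu mv mB.
exists G, s; split=> //.
have : {ae Q, forall w, ~ (B (u w, v w) /\ ~ G (u w))}.
  exists [set w | B (u w, v w) /\ ~ G (u w)]; split=> //; last by move=> w /= /contrapT.
  apply: measurableD.
    have mp : measurable_fun setT (fun w => (u w, v w)) by exact: measurable_fun_pair.
    by have := mp measurableT _ mB; rewrite setTI.
  by rewrite -[X in measurable X]setTI; exact: mu.
apply: filterS2 min_real => w [_ Dx' _] nB objq.
apply: contrapT => nG; apply: nB; split=> //; split=> //=.
by rewrite vK.
Qed.

Let determined : set (set (d.-tuple R)) :=
  [set C | exists2 D : set X, measurable D & {ae Q, forall w, C (v w) <-> D (u w)}].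

Let determined_sigma_algebra : sigma_algebra setT determined.
Proof.
split.
- by exists set0 => //; exact: aeW.
- move=> C [D mD CD]; exists (~` D); first exact: measurableC.
  by apply: filterS CD => w CD; split=> [[_ nC] /CD//|nD]; split=> // /CD.
- move=> C HC.
  have /choice[D HD] : forall n, exists D : set X, measurable D /\
      {ae Q, forall w, C n (v w) <-> D (u w)}.
    by move=> n; have [D mD CD] := HC n; exists D.
  exists (\bigcup_n D n); first by apply: bigcupT_measurable => n; have [] := HD n.
  have : {ae Q, forall w, forall n, C n (v w) <-> D n (u w)}.
    by apply: ae_foralln => n; have [] := HD n.
  by apply: filterS => w CD; split=> -[n _ H]; exists n => //; exact/CD.
Qed.

(* Almost minimizers over the rational sublevel sets locate the minimizer, by
   strong convexity; they are functions of [u] alone. *)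
Let determined_ray i (a : R) : determined [set t | tnth t i < a].
Proof.
have [G HG] := choice sublevel_selection.
have [s Hs] := choice HG.
(* If the value of a competitor exceeds the minimum by less than [n.+1%:R^-1], strong convexity
   places it within [K n] of the minimizer. *)
pose K (n : nat) := Num.sqrt (kappa^-1 / n.+1%:R).
have mG q : measurable (G q) by have [] := Hs q.
have q'E (q : rat) (n : nat) : ratr (q - n.+1%:R^-1) = ratr q - n.+1%:R^-1 :> R.
  by rewrite rmorphB /= fmorphV /= rmorph_nat.
(* [G q] without [G (q - n.+1%:R^-1)] means that the minimal value lies below [q] by at most
   [n.+1%:R^-1], so [s q] locates the minimizer up to [K n]. The ray is the union over all such
   certificates. *)
exists [set p | exists qn : rat * nat, (G qn.1 `&` ~` G (qn.1 - qn.2.+1%:R^-1)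
    `&` [set p | tnth (s qn.1 p) i + K qn.2 < a]) p].
  apply: measurable_bigcup_countType => -[q n] /=; apply: measurableI.
    by apply: measurableI => //; exact: measurableC.
  apply: (@measurable_set_pred _ _ (fun p => tnth (s q p) i + K n < a)).
  apply: measurable_fun_ltr => //; apply: measurable_funD => //.
  by have [_ ms _ _] := Hs q; exact: (measurableT_comp (measurable_tnth i) ms).
have selw : {ae Q, forall w, forall q, obj (u w) (v w) < ratr q -> G q (u w)}.
  by apply: ae_forall_countType => q; have [] := Hs q.
have strw : {ae Q, forall w, forall q, (r (row (s q (u w))) < +oo)%E ->
    obj (u w) (v w) + (beta - eta) / 2 * sqnorm (row (s q (u w)) - x' w)
    <= obj (u w) (s q (u w))}.
  by apply: ae_forall_countType => q; apply: strong_min; have [] := Hs q.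
apply: filterS3 selw strw min_real => w selw strw [Uxw Dx' min].
have Gobj q : G q (u w) -> obj (u w) (v w) < ratr q.
  by move=> Gq; have [_ _ _ /(_ _ Gq)[Ds]] := Hs q; apply: le_lt_trans; exact: min.
have close q n : G q (u w) -> ~ G (q - n.+1%:R^-1) (u w) ->
    `|tnth (s q (u w)) i - tnth (v w) i| < K n.
  move=> Gq nG; have [_ _ _ /(_ _ Gq)[Ds sq]] := Hs q.
  have vq : ratr q - n.+1%:R^-1 <= obj (u w) (v w).
    by rewrite -q'E leNgt; apply/negP => /selw.
  have := strw q Ds; rewrite -/kappa => st.
  have K0 : 0 < kappa^-1 / n.+1%:R by rewrite divr_gt0// invr_gt0.
  rewrite -sqr_lt_normE ?sqrtr_gt0// sqr_sqrtr; last exact: ltW.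
  have := sqr_coord_le (row (s q (u w)) - x' w) i.
  rewrite !mxE tnth_mktuple => /le_lt_trans; apply.
  rewrite ltr_pdivlMl//.
  by move: st sq vq; move: (n.+1%:R^-1) => n1; lra.
split=> /=.
  move=> va; pose del := kappa * ((a - tnth (v w) i) / 2) ^+ 2.
  have g0 : 0 < (a - tnth (v w) i) / 2 by rewrite divr_gt0// subr_gt0.
  have del0 : 0 < del by rewrite mulr_gt0// exprn_gt0.
  have [n _ /(_ n (leqnn _)) /= ne] := near_infty_natSinv_lt (PosNum del0).
  have n0 : 0 < n.+1%:R^-1 :> R by rewrite invr_gt0.
  have Kn : K n < (a - tnth (v w) i) / 2.
    rewrite -[ltRHS](ger0_norm (ltW g0)) -sqrtr_sqr ltr_sqrt ?exprn_gt0//.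
    by rewrite ltr_pdivrMl.
  have [|q] := @rat_in_itvoo R (obj (u w) (v w)) (obj (u w) (v w) + n.+1%:R^-1).
    by rewrite ltrDl.
  rewrite in_itv/= => /andP[q1 q2].
  have Gq : G q (u w) by exact: selw.
  have nG : ~ G (q - n.+1%:R^-1) (u w).
    by move=> /Gobj; rewrite q'E ltNge lerBlDr (ltW q2).
  exists (q, n); split; first by split.
  rewrite /=; have := close q n Gq nG; rewrite ltr_norml => /andP[_]; lra.
move=> [[q n] [[/= Gq nG] sa]].
have := close q n Gq nG; rewrite ltr_norml => /andP[]; lra.
Qed.

Lemma iterate_determined (C : set (d.-tuple R)) : measurable C ->
  exists2 D : set X, measurable D &
    {ae Q, forall w, C (tuple_of_row (x' w)) <-> D (tuple_of_row (x w), xi w)}.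
Proof.
move=> mC; suff : determined C by [].
have mid : measurable_fun setT (id : g_sigma_algebraType determined -> d.-tuple R).
  apply/measurable_fun_tnthP => i.
  apply: (measurability _ (RGenInftyO.measurableE R)) => _ [_ [a ->] <-].
  rewrite setTI; apply: sub_sigma_algebra.
  rewrite (_ : _ @^-1` _ = [set t | tnth t i < a]); first exact: determined_ray.
  by apply/seteqP; split=> t /=; rewrite in_itv.
have := mid measurableT C mC.
by rewrite setTI preimage_id measurable_g_measurableTypeE//; exact: determined_sigma_algebra.
Qed.

Let D2 w := sqnorm (px (x w) - x w).
Let dist z := enorm (px z - z).
(** Increment of the model from [z] to its proximal point minus that of [f]; (B2) bounds its mean by
    [tau / 2] times the squared length of the move. *)
Let G (z : vec) (y : Omega) := fm z (px z) y - fm z z y - f (px z) + f z.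

(** Two minimality statements are added: that of [x'] for the subproblem, tested at the proximal
    point, and that of the proximal point for the envelope, tested at [x']. The values of [r]
    cancel, and Lipschitz bounds bring the remaining values at [x'] back to [x]. *)
Let key_ineq : {ae Q, forall w, (beta - eta) / 2 * sqnorm (px (x w) - x' w) <=
  G (x w) (xi w) + (beta - rhob) / 2 * D2 w + (L (xi w) ^+ 2 + Lbar ^+ 2) / (beta - rhob)}.
Proof.
have mpx : measurable_fun setT (fun p : X => tuple_of_row (px (row p.1))).
  apply/(measurable_tuple_of_row (fun p : X => px (row p.1))).
  by apply: measurable_px; apply: rvec_measurable_row; exact: measurable_fst.
have strw := strong_min mpx.
pose B : set (X * d.-tuple R) :=
  ([set p | U (row p.1.1)] `&` [set p | (r (row p.2) < +oo)%E])
  `&` [set p | L p.1.2 * enorm (row p.1.1 - row p.2) <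
         fm_ext p.1.1 p.1.1 p.1.2 - fm_ext p.1.1 p.2 p.1.2].
have mfst : measurable_fun setT (fst : X * d.-tuple R -> X) by exact: measurable_fst.
have msnd : measurable_fun setT (snd : X * d.-tuple R -> d.-tuple R) by exact: measurable_snd.
have mf1 := measurableT_comp measurable_fst mfst.
have mf2 := measurableT_comp measurable_snd mfst.
have mB : measurable B.
  apply: measurableI; first apply: measurableI.
  - exact: U_measurable.
  - exact: dom_measurable.
  apply: (@measurable_set_pred _ _ (fun p => L p.1.2 * enorm (row p.1.1 - row p.2) <
         fm_ext p.1.1 p.1.1 p.1.2 - fm_ext p.1.1 p.2 p.1.2)).
  apply: measurable_fun_ltr; last by apply: measurable_funB; exact: fm_ext_measurable.
  apply: measurable_funM; first exact: (measurableT_comp L_meas mf2).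
  by apply: measurable_enormB; exact: rvec_measurable_row.
have lipw : {ae Q, forall w, ~ B (u w, v w)}.
  apply: (ae_not_section mzeta mxi indep mv mB).
  apply: filterS Ux => w Uxw.
  apply: filterS (fm_lip_dom Uxw) => y lip t [[Uz Dt]] /=.
  apply/negP; rewrite -leNgt !fm_extE ?zetaK//; last exact: dom_U.
  exact: lip.
apply: filterS3 strw lipw min_real => w strw nB [Uxw Dx' _].
have Dp := px_dom (x w).
have Up := dom_U Dp; have Ux' := dom_U Dx'.
have lip : fm (x w) (x w) (xi w) - fm (x w) (x' w) (xi w) <= L (xi w) * enorm (x w - x' w).
  rewrite leNgt; apply/negP => H; apply: nB; split; first by split; rewrite /= ?vK ?zetaK.
  by rewrite /= !fm_extE ?vK ?zetaK.
move: strw; rewrite /obj /= !tuple_of_rowK => /(_ Dp).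
rewrite !fm_extE ?tuple_of_rowK ?zetaK//.
have flip := f_lipschitz Ux' Uxw; rewrite enormBC in flip.
have pmin := px_min (x w) Dx'.
set dl := enorm (x w - x' w) in lip flip.
rewrite (sqnormBC (x' w)) -!(sqr_enorm (x w - x' w)) -/dl in pmin *.
have br0 : 0 < beta - rhob by rewrite subr_gt0.
set l := L (xi w) in lip *.
(* The maximum over [dl] is (l + Lbar)^2 / (2 (beta - rhob)), and (l + Lbar)^2 <= 2 (l^2 +
   Lbar^2). *)
have Y : (l + Lbar) * dl - (beta - rhob) / 2 * dl ^+ 2 <= (l ^+ 2 + Lbar ^+ 2) / (beta - rhob).
  rewrite ler_pdivlMr//.
  have := sqr_ge0 ((beta - rhob) * dl - (l + Lbar)).
  have := sqr_ge0 (l - Lbar).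
  lra.
rewrite /G /D2; lra.
Qed.

Let G_ge z : U z -> {ae P, forall y, 0 <= G z y + (L y + Lbar) * dist z}.
Proof.
move=> Uz; have Up := dom_U (px_dom z).
apply: filterS (fm_lip Uz Up) => y lip.
have := f_lipschitz Up Uz; rewrite -/(dist z) => flip.
move: lip; rewrite enormBC -/(dist z) /G; lra.
Qed.

Let G_rintegrable z : U z -> rintegrable P (G z).
Proof.
move=> Uz; have Up := dom_U (px_dom z).
apply: rintegrableD; last exact: rintegrable_cst.
apply: rintegrableB; last exact: rintegrable_cst.
by apply: rintegrableB; exact: fm_rintegrable.
Qed.

Let expect_G z : U z -> expect P (G z) <= tau / 2 * sqnorm (px z - z).
Proof.
move=> Uz; have Up := dom_U (px_dom z).
have I1 := fm_rintegrable Uz Up; have I2 := fm_rintegrable Uz Uz.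
have I3 := rintegrableB I1 I2; have I4 := rintegrable_cst P (f (px z)).
rewrite /G (expectD (rintegrableB I3 I4) (rintegrable_cst P (f z))).
rewrite (expectB I3 I4) (expectB I1 I2) !expect_cst expect_fm_diag//.
have := expect_fm_upper Uz Up; lra.
Qed.

Hypothesis intx : rintegrable Q (fun w => sqnorm (x w)).

Let D2_rintegrable : rintegrable Q D2.
Proof. exact: sqnorm_rintegrable_px. Qed.

Let dist_measurable : measurable_fun setT (fun z : d.-tuple R => dist (row z)).
Proof.
have mr : rvec_measurable row.
  by apply: (@rvec_measurable_row _ _ _ _ id); exact: measurable_id.
by apply: measurable_enormB => //; exact: measurable_px.
Qed.

Let dist_rintegrable : rintegrable Q (fun w => dist (x w)).
Proof.
apply: (ae_le_rintegrable (g := fun w => D2 w + 1)).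
- apply: eq_measurable_fun (measurableT_comp dist_measurable mzeta) => w _ /=.
  by rewrite zetaK.
- by apply: rintegrableD => //; exact: rintegrable_cst.
apply: aeW => w; rewrite ger0_norm ?enorm_ge0// /D2 -sqr_enorm -/(dist (x w)).
have := sqr_ge0 (dist (x w) - 1); have := sqr_ge0 (dist (x w)); lra.
Qed.

(** The shifted increment. Truncation at zero makes it nonnegative everywhere, as Tonelli requires;
    by [G_ge] it changes nothing for almost every sample at a base point in [U]. *)
Let gap (p : X) : R := Num.max 0 (fm_ext p.1 (tuple_of_row (px (row p.1))) p.2
  - fm_ext p.1 p.1 p.2 - f (px (row p.1)) + f (row p.1) + (L p.2 + Lbar) * dist (row p.1)).

Let gap_bound : rintegrable Q (fun w => gap (u w)) /\
  expect Q (fun w => gap (u w)) <=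
  expect Q (fun w => tau / 2 * D2 w + (expect P L + Lbar) * dist (x w)).
Proof.
have EL0 : 0 <= expect P L by rewrite fine_ge0// integral_ge0// => y _; rewrite lee_fin.
have mf1 : measurable_fun setT (fst : X -> _) by exact: measurable_fst.
have mf2 : measurable_fun setT (snd : X -> _) by exact: measurable_snd.
have mrow : rvec_measurable (fun p : X => row p.1) by exact: rvec_measurable_row.
have mpx : measurable_fun setT (fun p : X => tuple_of_row (px (row p.1))).
  apply/(measurable_tuple_of_row (fun p : X => px (row p.1))).
  exact: measurable_px.
apply: (indep_expect_le mzeta mxi indep).
- apply: measurable_maxr => //.
  apply: measurable_funD; first apply: measurable_funD; first apply: measurable_funB;
    first apply: measurable_funB.
  + exact: fm_ext_measurable.
  + exact: fm_ext_measurable.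
  + apply: measurable_continuous_comp; first exact: f_continuous.
    exact: measurable_px.
  + by apply: measurable_continuous_comp => //; exact: f_continuous.
  apply: measurable_funM; last exact: (measurableT_comp dist_measurable mf1).
  by apply: measurable_funD => //; exact: (measurableT_comp L_meas mf2).
- by move=> p; rewrite le_max lexx.
- apply: filterS Ux => w Uxw.
  have Up := dom_U (px_dom (x w)).
  have IG := G_rintegrable Uxw.
  have IL : rintegrable P (fun y => (L y + Lbar) * dist (x w)).
    have -> : (fun y => (L y + Lbar) * dist (x w)) = (fun y => dist (x w) * (L y + Lbar)).
      by apply/funext => y; rewrite mulrC.
    by apply: rintegrableZ; apply: rintegrableD; [exact: L_rintegrable|exact: rintegrable_cst].
  have IGL := rintegrableD IG IL.
  rewrite (@ae_eq_integral _ _ _ P setT (fun y => (G (x w) y + (L y + Lbar) * dist (x w))%:E))//.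
  + rewrite expectE// lee_fin (expectD IG IL).
    have -> : expect P (fun y => (L y + Lbar) * dist (x w)) = (expect P L + Lbar) * dist (x w).
      have -> : (fun y => (L y + Lbar) * dist (x w)) = (fun y => dist (x w) * (L y + Lbar)).
        by apply/funext => y; rewrite mulrC.
      rewrite expectZ ?(expectD L_rintegrable (rintegrable_cst P Lbar)) ?expect_cst 1?mulrC//.
      exact: (rintegrableD L_rintegrable (rintegrable_cst P Lbar)).
    by rewrite lerD2r /D2; exact: expect_G.
  + apply/measurable_EFinP; apply: measurable_maxr => //.
    apply: eq_measurable_fun (rintegrable_measurable IGL) => y _ /=.
    by rewrite /G !fm_extE ?tuple_of_rowK ?zetaK.
  + by apply/measurable_EFinP; exact: (rintegrable_measurable IGL).
  apply: filterS (G_ge Uxw) => y G0 _; rewrite /gap /= !fm_extE ?tuple_of_rowK ?zetaK//.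
  by rewrite -/(G (x w) y) max_r.
- move=> w; rewrite addr_ge0// mulr_ge0 ?sqnorm_ge0 ?enorm_ge0 ?divr_ge0//.
  by rewrite addr_ge0.
- by apply: rintegrableD; exact: rintegrableZ.
Qed.

(** An equality, so that subtracting the shift after integration leaves no loss. *)
Let Ldist_expect :
  rintegrable Q (fun w => (L (xi w) + Lbar) * dist (x w)) /\
  expect Q (fun w => (L (xi w) + Lbar) * dist (x w)) =
  expect Q (fun w => (expect P L + Lbar) * dist (x w)).
Proof.
have [] := @indep_expect_eq _ _ _ _ _ _ _ Q P zeta xi mzeta mxi indep
  (fun p => (L p.2 + Lbar) * dist (row p.1)) (fun w => (expect P L + Lbar) * dist (x w)).
- apply: measurable_funM.
    by apply: measurable_funD => //; exact: (measurableT_comp L_meas measurable_snd).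
  exact: (measurableT_comp dist_measurable measurable_fst).
- by move=> p; rewrite mulr_ge0 ?enorm_ge0// addr_ge0.
- move=> w /=; rewrite zetaK.
  have -> : (fun y => ((L y + Lbar) * dist (x w))%:E) =
      (fun y => (dist (x w) * (L y + Lbar))%:E).
    by apply/funext => y; rewrite mulrC.
  have IL := rintegrableD L_rintegrable (rintegrable_cst P Lbar).
  rewrite (expectE (rintegrableZ _ IL)) expectZ//.
  by rewrite (expectD L_rintegrable (rintegrable_cst P Lbar)) expect_cst mulrC.
- exact: rintegrableZ.
by under eq_fun do rewrite /= zetaK.
Qed.

Let L2_expect : rintegrable Q (fun w => L (xi w) ^+ 2) /\
  expect Q (fun w => L (xi w) ^+ 2) <= Lbar ^+ 2.
Proof.
have [] := @indep_expect_eq _ _ _ _ _ _ _ Q P zeta xi mzeta mxi indep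
  (fun p => L p.2 ^+ 2) (fun w => expect P (fun y => L y ^+ 2)).
- by apply: measurable_funX; exact: (measurableT_comp L_meas measurable_snd).
- by move=> p; exact: sqr_ge0.
- by move=> w; rewrite (expectE L2_rintegrable).
- exact: rintegrable_cst.
by move=> I ->; split=> //; rewrite expect_cst; exact: expect_L2.
Qed.

Let dist_px_x' : rintegrable Q (fun w => sqnorm (px (x w) - x' w)) /\
  (beta - eta) / 2 * expect Q (fun w => sqnorm (px (x w) - x' w)) <=
  (tau + beta - rhob) / 2 * expect Q D2 + 2 * Lbar ^+ 2 / (beta - rhob).
Proof.
have [Ig Eg] := gap_bound; have [Id Ed] := Ldist_expect; have [IL EL] := L2_expect.
have br0 : 0 < beta - rhob by rewrite subr_gt0.
pose h w := ((gap (u w) - (L (xi w) + Lbar) * dist (x w)) + (beta - rhob) / 2 * D2 w)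
  + (beta - rhob)^-1 * (L (xi w) ^+ 2 + Lbar ^+ 2).
have I1 := rintegrableB Ig Id.
have I2 := rintegrableZ ((beta - rhob) / 2) D2_rintegrable.
have I3 := rintegrableD IL (rintegrable_cst Q (Lbar ^+ 2)).
have Ih : rintegrable Q h := rintegrableD (rintegrableD I1 I2) (rintegrableZ _ I3).
have le_h : {ae Q, forall w, kappa * sqnorm (px (x w) - x' w) <= h w}.
  apply: filterS2 key_ineq Ux => w key Uxw; apply: (le_trans key).
  have Up := dom_U (px_dom (x w)).
  have : G (x w) (xi w) + (L (xi w) + Lbar) * dist (x w) <= gap (u w).
    by rewrite /gap /= !fm_extE ?tuple_of_rowK ?zetaK// le_max lexx orbT.
  rewrite /h [X in _ + X <= _]mulrC; lra.
have Is : rintegrable Q (fun w => sqnorm (px (x w) - x' w)).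
  apply: (ae_le_rintegrable (g := fun w => kappa^-1 * h w)).
  - by apply: measurable_sqnormB => //; exact: measurable_px.
  - exact: rintegrableZ.
  apply: filterS le_h => w; rewrite ger0_norm ?sqnorm_ge0// => H.
  by rewrite ler_pdivlMl.
split=> //.
rewrite -/kappa -expectZ//; apply: (le_trans (ae_le_expect (rintegrableZ kappa Is) Ih le_h)).
rewrite /h (expectD (rintegrableD I1 I2) (rintegrableZ _ I3)) (expectD I1 I2).
rewrite (expectB Ig Id) (expectZ _ D2_rintegrable) (expectZ _ I3).
rewrite (expectD IL (rintegrable_cst Q (Lbar ^+ 2))) expect_cst Ed.
move: Eg; rewrite (expectD (rintegrableZ _ D2_rintegrable) (rintegrableZ _ dist_rintegrable)).
rewrite (expectZ _ D2_rintegrable).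
have : (beta - rhob)^-1 * (expect Q (fun w => L (xi w) ^+ 2) + Lbar ^+ 2) <=
    2 * Lbar ^+ 2 / (beta - rhob).
  by rewrite [leRHS]mulrC ler_pM2l ?invr_gt0//; lra.
lra.
Qed.

Lemma step_rintegrable : rintegrable Q (fun w => sqnorm (x' w)).
Proof.
have [Is _] := dist_px_x'.
have [A HA] := sqnorm_prox_bound phi_lsc phi_proper phi_Nny phi_weakly_convex rhob_gt0 rhob_gt.
apply: (ae_le_rintegrable (g := fun w =>
  2 * (A * (sqnorm (x w) + 1)) + 2 * sqnorm (px (x w) - x' w))).
- have m0 : rvec_measurable (fun _ : W => 0 : vec) by move=> i; exact: measurable_cst.
  by apply: eq_measurable_fun (measurable_sqnormB mx' m0) => w _; rewrite subr0.
- apply: rintegrableD; last exact: rintegrableZ.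
  by do 2 apply: rintegrableZ; apply: rintegrableD => //; exact: rintegrable_cst.
apply: aeW => w; rewrite ger0_norm ?sqnorm_ge0//.
have := sqnormD_le (px (x w)) (- (px (x w) - x' w)); rewrite sqnormN opprB addrC subrK.
have := HA (x w); rewrite -/px; lra.
Qed.

Lemma step_descent :
  expect Q (fun w => M (x' w)) <= expect Q (fun w => M (x w))
    - (rhob - tau - eta) / (2 * rhob * (beta - eta)) *
      expect Q (fun w => sqgrad_moreau phi rhob^-1 (x w))
    + 2 * rhob * Lbar ^+ 2 / ((beta - eta) * (beta - rhob)).
Proof.
have [Is Es] := dist_px_x'.
have IM := M_rintegrable mx intx.
have IM' := M_rintegrable mx' step_rintegrable.
pose h w := (M (x w) - rhob / 2 * D2 w) + rhob / 2 * sqnorm (px (x w) - x' w).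
have I1 := rintegrableB IM (rintegrableZ (rhob / 2) D2_rintegrable).
have I2 := rintegrableZ (rhob / 2) Is.
have : expect Q (fun w => M (x' w)) <= expect Q h.
  apply: le_expect => //; first exact: (rintegrableD I1 I2).
  move=> w; have := M_le (x' w) (px_dom (x w)).
  by rewrite /h /M (moreau_px (x w)) /= /D2; lra.
rewrite /h (expectD I1 I2) (expectB IM (rintegrableZ _ D2_rintegrable)).
rewrite (expectZ _ D2_rintegrable) (expectZ _ Is).
have -> : expect Q (fun w => sqgrad_moreau phi rhob^-1 (x w)) = rhob ^+ 2 * expect Q D2.
  rewrite -(expectZ _ D2_rintegrable); congr expect; apply/funext => w.
  exact: sqgrad_px.
move=> /le_trans; apply.
have be0 : 0 < beta - eta by have := kappa_gt0; rewrite /kappa; lra.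
have br0 : 0 < beta - rhob by rewrite subr_gt0.
set E := expect Q D2 in Es *; set F := expect Q _ in Es *.
have {}Es : F <= 2 / (beta - eta) * ((tau + beta - rhob) / 2 * E + 2 * Lbar ^+ 2 / (beta - rhob)).
  rewrite -ler_pdivrMl ?divr_gt0// (_ : (2 / (beta - eta))^-1 = (beta - eta) / 2)//.
  by field; rewrite gt_eqF.
have : rhob / 2 * F <= rhob / 2 * (2 / (beta - eta) *
    ((tau + beta - rhob) / 2 * E + 2 * Lbar ^+ 2 / (beta - rhob))).
  by rewrite ler_pM2l// divr_gt0.
(* The coefficient comes from (tau + beta - rhob)/(beta - eta) = 1 - (rhob - tau - eta)/(beta -
   eta); the 1 cancels the term [rhob / 2 * D2] gained at [x]. *)
rewrite (_ : _ * (2 / _ * _) = rhob / 2 * E - (rhob - tau - eta) / (2 * rhob * (beta - eta)) * (rhob ^+ 2 * E)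
   + 2 * rhob * Lbar ^+ 2 / ((beta - eta) * (beta - rhob))).
  lra.
by field; rewrite !gt_eqF.
Qed.

End step.

(** * The whole trajectory: summation and the random iterate *)

Section trajectory.
Context {dW : measure_display} {W : measurableType dW}.
Variables (Q : probability W R) (T : nat) (beta : nat -> R) (x0 : vec).
Variables (xi : nat -> W -> Omega) (tstar : W -> nat) (x : nat -> W -> vec).
Hypothesis iid : iid_with_index Q P xi
  (fun t => if (t <= T)%N then
     ((rhob - tau - eta) / (beta t - eta)) /
     (\sum_(s < T.+1) (rhob - tau - eta) / (beta s - eta))
   else 0) tstar.
Hypothesis beta_gt : forall t, (t <= T)%N -> rhob < beta t.
Hypotheses (Ux0 : U x0) (x_init : forall w, x 0%N w = x0).
Hypothesis mx : forall t, rvec_measurable (x t).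
Hypothesis x_min : forall t, (t <= T)%N -> {ae Q, forall w, forall y,
  (r (x t.+1 w) + (fm (x t w) (x t.+1 w) (xi t w))%:E
     + (beta t / 2 * sqnorm (x t.+1 w - x t w))%:E
   <= r y + (fm (x t w) y (xi t w))%:E + (beta t / 2 * sqnorm (y - x t w))%:E)%E}.

Let mxi t : measurable_fun setT (xi t). Proof. by have [] := iid. Qed.

(** The three properties are carried together because the step lemmas take all of them at time [t]
    to reach time [t.+1]. *)
Lemma iterate_invariant t : (t <= T.+1)%N ->
  [/\ {ae Q, forall w, U (x t w)}, rintegrable Q (fun w => sqnorm (x t w)) &
      independent_of_future Q xi tstar t (tuple_of_row \o x t)].
Proof.
elim: t => [_|t IHt tT].
  split; first by apply: aeW => w; rewrite x_init.
    by under eq_fun do rewrite x_init; exact: rintegrable_cst.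
  have -> : tuple_of_row \o x 0 = (fun=> tuple_of_row x0).
    by apply/funext => w /=; rewrite x_init.
  exact: independent_of_future_cst.
have [Ut It Jt] := IHt (ltnW tT).
have ind := independent_of_sample iid Jt.
have mt := mx t; have mt1 := mx t.+1; have bt := beta_gt tT; have xm := x_min tT.
have mz s : measurable_fun setT (tuple_of_row \o x s) by exact/measurable_tuple_of_row.
split.
- by apply: filterS (iterate_dom Ut xm) => w; exact: dom_U.
- exact: (step_rintegrable mt mt1 (mxi t) ind Ut xm bt It).
- apply: (independent_of_futureS iid (mz t) (mz t.+1) Jt) => C mC.
  exact: (iterate_determined mt mt1 (mxi t) ind Ut xm bt mC).
Qed.

Let G2 t := expect Q (fun w => sqgrad_moreau phi rhob^-1 (x t w)).
Let EM t := expect Q (fun w => M (x t w)).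

Let descent t : (t <= T)%N ->
  EM t.+1 <= EM t - (rhob - tau - eta) / (2 * rhob * (beta t - eta)) * G2 t
    + 2 * rhob * Lbar ^+ 2 / ((beta t - eta) * (beta t - rhob)).
Proof.
move=> tT; have [Ut It Jt] := iterate_invariant (leqW tT).
exact: (step_descent (mx t) (mx t.+1) (mxi t) (independent_of_sample iid Jt) Ut (x_min tT)
  (beta_gt tT) It).
Qed.

Let sqgrad_rintegrable t : (t <= T)%N ->
  rintegrable Q (fun w => sqgrad_moreau phi rhob^-1 (x t w)).
Proof.
move=> tT; have [_ It _] := iterate_invariant (leqW tT).
under eq_fun do rewrite sqgrad_px.
by apply: rintegrableZ; exact: sqnorm_rintegrable_px.
Qed.

Lemma moreau_descent t : (t <= T)%N ->
  (\int[Q]_w moreau phi rhob^-1 (x t.+1 w)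
   <= \int[Q]_w moreau phi rhob^-1 (x t w)
      - ((rhob - tau - eta) / (2 * rhob * (beta t - eta)))%:E
        * \int[Q]_w (sqgrad_moreau phi rhob^-1 (x t w))%:E
      + (2 * rhob * Lbar ^+ 2 / ((beta t - eta) * (beta t - rhob)))%:E)%E.
Proof.
move=> tT; have [_ It _] := iterate_invariant (leqW tT).
have [_ It1 _] := @iterate_invariant t.+1 tT.
under eq_integral do rewrite moreau_finE.
under [X in (_ <= X - _ + _)%E]eq_integral do rewrite moreau_finE.
rewrite (expectE (M_rintegrable (mx t) It)) (expectE (M_rintegrable (mx t.+1) It1)).
rewrite (expectE (sqgrad_rintegrable tT)) -EFinM -EFinB -EFinD lee_fin.
exact: descent.
Qed.

Let delta_gt0 : 0 < rhob - tau - eta. Proof. by move: rhob_gt; lra. Qed.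

Let beta_eta t : (t <= T)%N -> 0 < beta t - eta.
Proof. by move=> /beta_gt; move: rhob_gt tau_ge0; lra. Qed.

Let a t := (rhob - tau - eta) / (beta t - eta).
Let b t := ((beta t - eta) * (beta t - rhob))^-1.

Let a_sum_gt0 : 0 < \sum_(t < T.+1) a t.
Proof.
rewrite big_ord_recl ltr_pwDl//; first by rewrite divr_gt0// beta_eta.
apply: sumr_ge0 => i _; rewrite ltW// divr_gt0// beta_eta//.
exact: (ltn_ord (lift ord0 i)).
Qed.

Let telescoped n : (n <= T.+1)%N ->
  \sum_(t < n) a t * G2 t <= 2 * rhob * (EM 0 - EM n) + 4 * rhob ^+ 2 * Lbar ^+ 2 * \sum_(t < n) b t.
Proof.
elim: n => [_|n IHn nT]; first by rewrite !big_ord0 subrr !mulr0 addr0.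
rewrite !big_ord_recr/=.
have be := beta_eta nT.
have br : 0 < beta n - rhob by rewrite subr_gt0 beta_gt.
have r2 : 0 < 2 * rhob by rewrite mulr_gt0.
have := descent nT; rewrite -(ler_pM2l r2).
rewrite (_ : 2 * rhob * (_ - _ + _) =
    2 * rhob * EM n - a n * G2 n + 4 * rhob ^+ 2 * Lbar ^+ 2 * b n); last first.
  by rewrite /a /b; field; rewrite !gt_eqF.
have := IHn (ltnW nT).
move: (\sum_(i < n) _) (\sum_(i < n) _) (EM 0) (EM n) (EM n.+1) (a n * G2 n) (b n).
by move=> s1 s2 e0 e1 e2 an bn; lra.
Qed.

Let random_iterate_integral :
  (\int[Q]_w (sqgrad_moreau phi rhob^-1 (x (tstar w) w))%:E =
   ((\sum_(t < T.+1) a t * G2 t) / \sum_(t < T.+1) a t)%:E)%E.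
Proof.
pose z t := tuple_of_row \o x t.
pose g (y : d.-tuple R) := sqgrad_moreau phi rhob^-1 (row y).
have gE t w : g (z t w) = sqgrad_moreau phi rhob^-1 (x t w) by rewrite /g /z /= tuple_of_rowK.
have mz t : measurable_fun setT (z t) by exact/measurable_tuple_of_row.
have indz t : (t <= T)%N -> independent_of_future Q xi tstar t (z t).
  by move=> tT; have [] := iterate_invariant (leqW tT).
have mrow : rvec_measurable row.
  by apply: (@rvec_measurable_row _ _ _ _ id); exact: measurable_id.
have mg : measurable_fun setT g.
  rewrite /g; under eq_fun do rewrite sqgrad_px.
  by apply: measurable_funM => //; apply: measurable_sqnormB => //; exact: measurable_px.
have g0 y : 0 <= g y by exact: sqnorm_ge0.
have intg t : (t <= T)%N -> rintegrable Q (fun w => g (z t w)).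
  by move=> tT; under eq_fun do rewrite gE; exact: sqgrad_rintegrable.
have pT s : (T < s)%N -> (if (s <= T)%N then a s / \sum_(t < T.+1) a t else 0) = 0.
  by rewrite ltnNge => /negbTE ->.
have E := random_index_integral iid pT mz indz mg g0 intg.
transitivity (\int[Q]_w (g (z (tstar w) w))%:E)%E.
  by apply: eq_integral => w _; rewrite gE.
rewrite E; congr EFin; rewrite mulr_suml; apply: eq_bigr => t _.
have tT : (t <= T)%N by rewrite -ltnS.
have EG : (fun w => g (z t w)) = (fun w => sqgrad_moreau phi rhob^-1 (x t w)).
  by apply/funext => w; exact: gE.
rewrite tT EG -/(G2 t); exact: mulrAC.
Qed.

Let le_moreau m : inf_fun phi = m%:E -> forall y, m <= M y.
Proof.
move=> phim y; rewrite /M moreau_px /=.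
have := ereal_inf_lbound (imageT phi (px y)); rewrite -/(inf_fun phi) phim.
rewrite {1}/phi (r_fin (px_dom y)) -EFinD lee_fin -/(rr _).
have : 0 <= rhob / 2 * sqnorm (px y - y) by rewrite mulr_ge0 ?sqnorm_ge0// divr_ge0// ltW.
lra.
Qed.

Lemma random_iterate_bound :
  (\int[Q]_w (sqgrad_moreau phi rhob^-1 (x (tstar w) w))%:E
   <= (rhob%:E * (moreau phi rhob^-1 x0 - inf_fun phi)
       + (2 * rhob ^+ 2 * Lbar ^+ 2 *
          \sum_(t < T.+1) ((beta t - eta) * (beta t - rhob))^-1)%:E)
      * ((\sum_(t < T.+1) (rhob - tau - eta) / (2 * (beta t - eta)))^-1)%:E)%E.
Proof.
rewrite random_iterate_integral moreau_finE.
have -> : \sum_(t < T.+1) (rhob - tau - eta) / (2 * (beta t - eta)) =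
    (\sum_(t < T.+1) a t) / 2.
  rewrite mulr_suml; apply: eq_bigr => t _; rewrite /a; field.
  by rewrite gt_eqF// beta_eta// -ltnS.
have := a_sum_gt0; set S := \sum_(t < T.+1) a t => S0.
have S20 : 0 < (S / 2)^-1 by rewrite invr_gt0 divr_gt0.
(* An infimum [+oo] contradicts properness, and for [-oo] the right-hand side is [+oo]; only the
   finite case needs the telescoped sum. *)
case E : (inf_fun phi) => [m| |].
- set c := 2 * rhob ^+ 2 * _ * _; set s := (S / 2)^-1.
  rewrite (_ : (_ * _)%E = ((rhob * (M x0 - m) + c) * s)%:E)//.
  rewrite lee_fin /s /c => {s c}.
  have := telescoped (leqnn _).
  have [_ IT _] := iterate_invariant (leqnn T.+1).
  have -> : EM 0 = M x0.
    by rewrite /EM; under eq_fun do rewrite x_init; rewrite expect_cst.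
  have mE : m <= EM T.+1.
    rewrite -[leLHS](expect_cst Q); apply: le_expect.
    - exact: rintegrable_cst.
    - exact: M_rintegrable.
    - by move=> w; exact: le_moreau.
  move=> H; rewrite invfM invrK [leRHS]mulrA [leRHS]mulrAC ler_pM2r ?invr_gt0//.
  apply: (le_trans H).
  have : rhob * m <= rhob * EM T.+1 by rewrite ler_pM2l.
  rewrite -/(b _); move: (\sum_(t < _) _) (EM T.+1) (M x0) => s e m0; lra.
- have [z Dz] := phi_proper.
  have := ereal_inf_lbound (imageT phi z); rewrite -/(inf_fun phi) E leye_eq => /eqP Ez.
  by rewrite Ez ltxx in Dz.
by rewrite [(_ - -oo)%E]addey// gt0_muley ?lte_fin// addye// gt0_mulye ?lte_fin// leey.
Qed.

Lemma random_iterate_bound_cst (gamma : R) : 0 < gamma ->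
  (forall t, (t <= T)%N -> beta t = rhob + gamma^-1 * Num.sqrt (T.+1)%:R) ->
  (\int[Q]_w (sqgrad_moreau phi rhob^-1 (x (tstar w) w))%:E
   <= (2%:E * (rhob%:E * (moreau phi rhob^-1 x0 - inf_fun phi)
               + (2 * rhob ^+ 2 * Lbar ^+ 2 * gamma ^+ 2)%:E))
      * ((rhob - tau - eta)^-1 *
         ((rhob - eta) / (T.+1)%:R + (gamma * Num.sqrt (T.+1)%:R)^-1))%:E)%E.
Proof.
move=> g0 betaE; apply: (le_trans random_iterate_bound).
set n : R := (T.+1)%:R; set q := Num.sqrt n.
have q0 : 0 < q by rewrite sqrtr_gt0.
have nE : n = q ^+ 2 by rewrite sqr_sqrtr.
have re0 : 0 < rhob - eta by move: rhob_gt tau_ge0; lra.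
have B0 : 0 < gamma * (rhob - eta) + q by rewrite addr_gt0// mulr_gt0.
rewrite [X in (_ <= X * _)%E]muleC -[leRHS]muleA -EFinM.
have -> : \sum_(t < T.+1) (rhob - tau - eta) / (2 * (beta t - eta)) =
    n * ((rhob - tau - eta) / (2 * (rhob + gamma^-1 * q - eta))).
  under eq_bigr => t _ do rewrite (betaE _ (leq_ord t)).
  rewrite sumr_const card_ord; exact/esym/mulr_natl.
have -> : \sum_(t < T.+1) ((beta t - eta) * (beta t - rhob))^-1 =
    n * ((rhob + gamma^-1 * q - eta) * (rhob + gamma^-1 * q - rhob))^-1.
  under eq_bigr => t _ do rewrite (betaE _ (leq_ord t)).
  rewrite sumr_const card_ord; exact/esym/mulr_natl.
have B1 : rhob + gamma^-1 * q - eta = (gamma * (rhob - eta) + q) / gamma.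
  by field; rewrite gt_eqF.
have -> : (n * ((rhob - tau - eta) / (2 * (rhob + gamma^-1 * q - eta))))^-1 =
    2 * ((rhob - tau - eta)^-1 * ((rhob - eta) / n + (gamma * q)^-1)).
  by rewrite B1 nE; field; rewrite !gt_eqF.
apply: lee_wpmul2r.
  rewrite lee_fin mulr_ge0// mulr_ge0 ?invr_ge0 ?(ltW delta_gt0)//.
  by rewrite addr_ge0 ?divr_ge0 ?invr_ge0 ?mulr_ge0 ?ltW// nE exprn_gt0.
apply: leeD2l; rewrite lee_fin; apply: ler_wpM2l; first by rewrite mulr_ge0 ?sqr_ge0// mulr_ge0 ?sqr_ge0.
(* The stated bound keeps [gamma ^+ 2] and drops the remaining factor, which is at most 1. *)
have -> : n * ((rhob + gamma^-1 * q - eta) * (rhob + gamma^-1 * q - rhob))^-1 =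
    gamma ^+ 2 * (q / (gamma * (rhob - eta) + q)).
  have -> : rhob + gamma^-1 * q - rhob = q / gamma by field; rewrite gt_eqF.
  by rewrite B1 nE; field; rewrite !gt_eqF.
rewrite -[leRHS]mulr1 ler_wpM2l ?sqr_ge0// ler_pdivrMr// mul1r lerDr.
by rewrite mulr_ge0// ltW.
Qed.

End trajectory.
End model.

Theorem theorem4p3 (R : realType) (d : nat)
    (dO : measure_display) (Omega : measurableType dO) (P : probability Omega R)
    (dW : measure_display) (W : measurableType dW) (Q : probability W R)
    (r : 'rV[R]_d -> \bar R) (f : 'rV[R]_d -> R)
    (fm : 'rV[R]_d -> 'rV[R]_d -> Omega -> R)
    (U : set 'rV[R]_d) (L : Omega -> R) (tau eta Lbar : R)
    (T : nat) (rhob : R) (beta : nat -> R) (x0 : 'rV[R]_d)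
    (xi : nat -> W -> Omega) (tstar : W -> nat) (x : nat -> W -> 'rV[R]_d) :
  (* r closed (lsc), proper, with values in R u {+oo}; f locally Lipschitz *)
  lower_semicontinuous r ->
  (exists z, (r z < +oo)%E) -> (forall z, r z != -oo%E) ->
  locally_lipschitz f ->
  0 <= tau -> 0 <= Lbar ->
  (* (B1) xi_0, xi_1, ... i.i.d. ~ P, and tstar independent of them with
     P(tstar = t) proportional to (rhob - tau - eta)/(beta t - eta), t = 0..T *)
  iid_with_index Q P xi
    (fun t => if (t <= T)%N then
       ((rhob - tau - eta) / (beta t - eta)) /
       (\sum_(s < T.+1) (rhob - tau - eta) / (beta s - eta))
     else 0) tstar ->
  (* (B2) *)
  open U -> convex_set U -> (forall z, (r z < +oo)%E -> U z) ->
  measurable_fun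
    [set p : (d.-tuple R * d.-tuple R) * Omega |
       U (row_of_tuple p.1.1) /\ U (row_of_tuple p.1.2)]
    (fun p => fm (row_of_tuple p.1.1) (row_of_tuple p.1.2) p.2) ->
  (forall z, U z -> (\int[P]_w (fm z z w)%:E = (f z)%:E)%E) ->
  (forall z y, U z -> U y ->
     (\int[P]_w (fm z y w - f y)%:E <= (tau / 2 * sqnorm (y - z))%:E)%E) ->
  (* (B3) *)
  (forall z, U z ->
     {ae P, forall w, weakly_convex eta (fun y => (r y + (fm z y w)%:E)%E)}) ->
  (* (B4) *)
  measurable_fun setT L -> (forall w, 0 <= L w) ->
  (\int[P]_w ((L w) ^+ 2)%:E <= (Lbar ^+ 2)%:E)%E ->
  (forall z y, U z -> U y ->
     {ae P, forall w, fm z z w - fm z y w <= L w * enorm (z - y)}) ->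
  (* parameters *)
  0 < rhob -> tau + eta < rhob ->
  (forall t, (t <= T)%N -> rhob < beta t) ->
  U x0 ->
  (* the iterates *)
  (forall w, x 0%N w = x0) ->
  (forall t, rvec_measurable (x t)) ->
  (forall t, (t <= T)%N ->
     {ae Q, forall w, forall y,
        (r (x t.+1 w) + (fm (x t w) (x t.+1 w) (xi t w))%:E
           + (beta t / 2 * sqnorm (x t.+1 w - x t w))%:E
         <= r y + (fm (x t w) y (xi t w))%:E
           + (beta t / 2 * sqnorm (y - x t w))%:E)%E}) ->
  (* conclusions *)
  (forall t, (t <= T)%N ->
     (\int[Q]_w moreau (fun y => (f y)%:E + r y)%E rhob^-1 (x t.+1 w)
      <= \int[Q]_w moreau (fun y => (f y)%:E + r y)%E rhob^-1 (x t w)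
         - ((rhob - tau - eta) / (2 * rhob * (beta t - eta)))%:E
           * \int[Q]_w (sqgrad_moreau (fun y => (f y)%:E + r y)%E rhob^-1 (x t w))%:E
         + (2 * rhob * Lbar ^+ 2 / ((beta t - eta) * (beta t - rhob)))%:E)%E)
  /\
  (\int[Q]_w (sqgrad_moreau (fun y => (f y)%:E + r y)%E rhob^-1 (x (tstar w) w))%:E
   <= (rhob%:E * (moreau (fun y => (f y)%:E + r y)%E rhob^-1 x0
                  - inf_fun (fun y => (f y)%:E + r y)%E)
       + (2 * rhob ^+ 2 * Lbar ^+ 2 *
          \sum_(t < T.+1) ((beta t - eta) * (beta t - rhob))^-1)%:E)
      * ((\sum_(t < T.+1) (rhob - tau - eta) / (2 * (beta t - eta)))^-1)%:E)%E
  /\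
  (forall gamma : R, 0 < gamma ->
     (forall t, (t <= T)%N -> beta t = rhob + gamma^-1 * Num.sqrt (T.+1)%:R) ->
     (\int[Q]_w (sqgrad_moreau (fun y => (f y)%:E + r y)%E rhob^-1 (x (tstar w) w))%:E
      <= (2%:E * (rhob%:E * (moreau (fun y => (f y)%:E + r y)%E rhob^-1 x0
                             - inf_fun (fun y => (f y)%:E + r y)%E)
                  + (2 * rhob ^+ 2 * Lbar ^+ 2 * gamma ^+ 2)%:E))
         * ((rhob - tau - eta)^-1 *
            ((rhob - eta) / (T.+1)%:R + (gamma * Num.sqrt (T.+1)%:R)^-1))%:E)%E).
Proof.
move=> r_lsc r_proper r_Nny f_llip tau0 Lbar0 iid Uo Uc domU fm_meas fm_mean fm_up fm_wc
  mL L0 L2 fm_lip rhob0 rhob_gt beta_gt Ux0 x_init mx x_min.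
split; last split.
- exact: (moreau_descent r_lsc r_proper r_Nny tau0 Lbar0 Uo Uc domU fm_meas fm_mean fm_up
    fm_wc mL L0 L2 fm_lip f_llip rhob0 rhob_gt iid beta_gt Ux0 x_init mx x_min).
- exact: (random_iterate_bound r_lsc r_proper r_Nny tau0 Lbar0 Uo Uc domU fm_meas fm_mean fm_up
    fm_wc mL L0 L2 fm_lip f_llip rhob0 rhob_gt iid beta_gt Ux0 x_init mx x_min).
- exact: (random_iterate_bound_cst r_lsc r_proper r_Nny tau0 Lbar0 Uo Uc domU fm_meas fm_mean fm_up
    fm_wc mL L0 L2 fm_lip f_llip rhob0 rhob_gt iid beta_gt Ux0 x_init mx x_min).
Qed.
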